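(* Let $d$ be a fixed constant. There exists a randomized algorithm which, given $\epsilon>0$ and an instance of size $n$ of the fair $k$-median problem in a metric space of doubling dimension $d$, outputs a solution of cost at most $(1+\epsilon)$ times the optimal cost (with no violation of the fairness constraints), in running time $\tilde{O}\big(n^{(\frac{\log n}{\epsilon})^{O(d)}\, l}\big)$, where $l$ is the number of client groups.
   Context: Doubling dimension: for a metric space $(X,dist)$ and $x\in X$, $r\ge 0$, let $B(x,r)=\{y\in X: dist(x,y)\le r\}$. The doubling dimension of $(X,dist)$ is the smallest integer $d$ such that every ball of radius $2r$ can be covered by at most $2^d$ balls of radius $r$. Fair $k$-median problem: the input is a metric space $(X,dist)$ with a set of clients $\mathcal{C}$ and a set of facilities $\mathcal{F}$, $X=\mathcal{C}\cup\mathcal{F}$ with $|X|=n$ (the size of the instance), a non-negative integer $k$, an integer $l$, and two vectors $\boldsymbol\alpha,\boldsymbol\beta\in\mathbb{R}^l$ with $0\le\alpha_i\le\beta_i\le 1$. The client set is partitioned into $l$ pairwise disjoint groups $\mathcal{C}=\mathcal{C}_1\cup\dots\cup\mathcal{C}_l$ (a client in $\mathcal{C}_i$ is of type $i$). A feasible solution is a set $F\subseteq\mathcal{F}$ with $|F|\le k$ and an assignment $\mu:\mathcal{C}\to F$ such that for every $f\in F$ and every $i\in[l]$, $\alpha_i\le \frac{|\{c\in\mathcal{C}_i:\mu(c)=f\}|}{|\{c\in\mathcal{C}:\mu(c)=f\}|}\le\beta_i$. Its cost is $\sum_{c\in\mathcal{C}}dist(c,\mu(c))$, and the goal is to minimize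 the cost.
   Formalization: In the running time, log n/ε is replaced by max(log n/ε, x₀) with x₀ depending only on d, and the bound is claimed only for n ≥ 2, l ≥ 1, since the literal formula is too small to allow any algorithm when ε is much larger than log n, or when n = 1 or l = 0. *)

(* Defs.v *)
From mathcomp Require Import all_boot all_order all_algebra.
From mathcomp Require Import classical_sets reals exp.

Set Implicit Arguments.
Unset Strict Implicit.
Unset Printing Implicit Defensive.

Import Order.TTheory GRing.Theory Num.Theory.
Local Open Scope ring_scope.

Section FairKMedian.
Variable R : realType.

Definition is_metric (X : finType) (dist : X -> X -> R) : Prop :=
  [/\ forall x y, 0 <= dist x y,
      forall x y, dist x y = 0 <-> x = y,
      forall x y, dist x y = dist y x
    & forall x y z, dist x z <= dist x y + dist y z].

Definition cball (X : finType) (dist : X -> X -> R) (x : X) (r : R) : {set X} :=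
  finset (fun y => dist x y <= r).

Definition doubling (X : finType) (dist : X -> X -> R) (d : nat) : Prop :=
  forall (x : X) (r : R), 0 <= r ->
    exists S : {set X}, (#|S| <= 2 ^ d)%N /\
      cball dist x (2 * r) \subset \bigcup_(y in S) cball dist y r.

Definition doubling_dimension (X : finType) (dist : X -> X -> R) (d : nat) :
    Prop :=
  doubling dist d /\ forall d' : nat, doubling dist d' -> (d <= d')%N.

(* The points are numbered 0, ..., n - 1, since an algorithm receives them in
   some order.  Clients and facilities may share points. *)
Record instance (n l : nat) := Instance {
  dist : 'I_n -> 'I_n -> R;
  clients : {set 'I_n};
  facilities : {set 'I_n};
  group : 'I_l -> {set 'I_n};
  kmax : nat;
  alpha : 'I_l -> R;
  beta : 'I_l -> R;
  dist_metric : is_metric dist;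
  points_cover : clients :|: facilities = [set: 'I_n];
  groups_cover : clients = \bigcup_(i < l) group i;
  groups_disjoint : forall i j, i != j -> [disjoint group i & group j];
  alpha_beta : forall i, 0 <= alpha i <= beta i /\ beta i <= 1
}.

Section Solutions.
Variables (n l : nat) (I : instance n l).
Implicit Types (F : {set 'I_n}) (mu : {ffun 'I_n -> 'I_n}).

Definition cluster mu (f : 'I_n) : {set 'I_n} :=
  finset (fun c => (c \in clients I) && (mu c == f)).

(* Only the values of mu on clients matter.  The proportions of an empty
   cluster are undefined, so an open facility without clients is not
   constrained. *)
Definition feasible F mu : bool :=
  [&& F \subset facilities I,
      (#|F| <= kmax I)%N,
      [forall c in clients I, mu c \in F]
    & [forall f in F, forall i : 'I_l, (cluster mu f != finset.set0) ==>
        (alpha I i <= #|group I i :&: cluster mu f|%:R / #|cluster mu f|%:R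
                   <= beta I i)]].

Definition cost mu : R := \sum_(c in clients I) dist I c (mu c).

Definition has_solution : Prop := exists F mu, feasible F mu.

(* A minimum when there is a solution, as there are finitely many. *)
Definition opt : R :=
  inf (fun v : R => exists F mu, feasible F mu /\ v = cost mu).

End Solutions.

End FairKMedian.

(* A randomized real RAM: integer and real registers, an integer memory and a
   real memory, both addressed by integer registers.  Every instruction takes
   unit time.  In order not to make unit cost unreasonably powerful, there is no
   integer multiplication, no way to convert a real into an integer other than
   by comparisons, and no constants but natural numbers.  Division by zero
   yields zero; subtraction of integers is truncated. *)
Inductive instr :=
| IConst of nat & nat             (* i <- constant *)
| IAdd of nat & nat & nat         (* i <- j + k *)
| ISub of nat & nat & nat         (* i <- j - k *)
| ILoad of nat & nat              (* i <- imem[j] *)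
| IStore of nat & nat             (* imem[i] <- j *)
| ICoin of nat                    (* i <- fair random bit *)
| RConst of nat & nat             (* r <- constant *)
| ROfInt of nat & nat             (* r <- integer register i *)
| RAdd of nat & nat & nat
| RSub of nat & nat & nat
| RMul of nat & nat & nat
| RDiv of nat & nat & nat
| RLoad of nat & nat              (* r <- rmem[integer register i] *)
| RStore of nat & nat             (* rmem[integer register i] <- r *)
| Jump of nat
| JumpILe of nat & nat & nat      (* if i <= j goto t *)
| JumpRLe of nat & nat & nat.     (* if r <= s goto t *)

Definition program := seq instr.

Section Machine.
Variable R : realType.

Record state := State {
  pc : nat;
  ireg : nat -> nat;
  rreg : nat -> R;
  imem : nat -> nat;
  rmem : nat -> R
}.

Definition set_ireg (s : state) (i v : nat) : state :=
  State (pc s).+1 [eta ireg s with i |-> v] (rreg s) (imem s) (rmem s).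
Definition set_rreg (s : state) (r : nat) (v : R) : state :=
  State (pc s).+1 (ireg s) [eta rreg s with r |-> v] (imem s) (rmem s).
Definition set_imem (s : state) (a v : nat) : state :=
  State (pc s).+1 (ireg s) (rreg s) [eta imem s with a |-> v] (rmem s).
Definition set_rmem (s : state) (a : nat) (v : R) : state :=
  State (pc s).+1 (ireg s) (rreg s) (imem s) [eta rmem s with a |-> v].
Definition goto (s : state) (t : nat) : state :=
  State t (ireg s) (rreg s) (imem s) (rmem s).

Definition exec (coin : bool) (s : state) (c : instr) : state :=
  match c with
  | IConst i v => set_ireg s i v
  | IAdd i j k => set_ireg s i (ireg s j + ireg s k)%N
  | ISub i j k => set_ireg s i (ireg s j - ireg s k)%N
  | ILoad i j => set_ireg s i (imem s (ireg s j))
  | IStore i j => set_imem s (ireg s i) (ireg s j)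
  | ICoin i => set_ireg s i coin
  | RConst r v => set_rreg s r v%:R
  | ROfInt r i => set_rreg s r (ireg s i)%:R
  | RAdd r a b => set_rreg s r (rreg s a + rreg s b)
  | RSub r a b => set_rreg s r (rreg s a - rreg s b)
  | RMul r a b => set_rreg s r (rreg s a * rreg s b)
  | RDiv r a b => set_rreg s r (rreg s a / rreg s b)
  | RLoad r i => set_rreg s r (rmem s (ireg s i))
  | RStore i r => set_rmem s (ireg s i) (rreg s r)
  | Jump t => goto s t
  | JumpILe i j t => goto s (if (ireg s i <= ireg s j)%N then t else (pc s).+1)
  | JumpRLe r a t => goto s (if rreg s r <= rreg s a then t else (pc s).+1)
  end.

Definition halted (p : program) (s : state) : bool := (size p <= pc s)%N.

Definition step (p : program) (s : state) (coin : bool) : state :=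
  if onth p (pc s) is Some c then exec coin s c else s.

(* Each step is provided with a fresh coin, which only ICoin looks at; so T
   steps are driven by a uniformly random element of T.-tuple bool. *)
Definition run (p : program) (s : state) (coins : seq bool) : state :=
  foldl (step p) s coins.

Definition prob (T : nat) (E : pred (T.-tuple bool)) : R :=
  #|E|%:R / 2 ^+ T.

Section InputOutput.
Variables (n l : nat) (I : instance R n l).

(* Type of a client plus one; 0 for a point which is not a client. *)
Definition client_code (x : 'I_n) : nat :=
  if [pick i | x \in group I i] is Some i then (val i).+1 else 0%N.

(* Initially the integer registers 0, 1, 2 contain n, l, k, the real register 0
   contains epsilon, the integer memory lists the client codes and the
   indicator of the facilities, and the real memory lists alpha, beta and the
   distances in row-major order.  Everything else is zero. *)
Definition input (eps : R) : state :=
  State 0%N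
    (nth 0%N [:: n; l; kmax I])
    (nth 0 [:: eps])
    (nth 0%N ([seq client_code x | x <- enum 'I_n] ++
              [seq nat_of_bool (x \in facilities I) | x <- enum 'I_n]))
    (nth 0 ([seq alpha I i | i <- enum 'I_l] ++
            [seq beta I i | i <- enum 'I_l] ++
            [seq dist I x y | x <- enum 'I_n, y <- enum 'I_n])).

(* The solution (F, mu) is read in the integer memory: the n first cells are
   the indicator of F, the n next ones contain mu. *)
Definition outputs (s : state) (F : {set 'I_n}) (mu : {ffun 'I_n -> 'I_n}) :
    bool :=
  [forall x : 'I_n, (x \in F) == (imem s x != 0%N)] &&
  [forall c in clients I, imem s (n + c)%N == mu c :> nat].

Definition solved (s : state) : bool :=
  [exists F : {set 'I_n}, exists mu : {ffun 'I_n -> 'I_n},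
    outputs s F mu && feasible I F mu].

Definition solved_within (v : R) (s : state) : bool :=
  [exists F : {set 'I_n}, exists mu : {ffun 'I_n -> 'I_n},
    [&& outputs s F mu, feasible I F mu & cost I mu <= v]].

End InputOutput.

(* n ^ ((log n / eps) ^ (C d) l).  The threshold x0 expresses that the bound is
   asymptotic in log n / eps: taken literally it tends to 1 when eps grows and
   would be less than the time needed to read the input. *)
Definition qpoly_bound (C d : nat) (x0 : R) (n l : nat) (eps : R) : R :=
  n%:R `^ (Num.max (ln n%:R / eps) x0 ^+ (C * d) * l%:R).

(* T = O(g log^b g) with constant a, that is, T belongs to soft-O of g. *)
Definition soft_O (a b T : nat) (g : R) : Prop := T%:R <= a%:R * (g * ln g ^+ b).

End Machine.

(* Main.v *)
(** Fix an optimal solution, its longest edge L and a shift rho in [1/2, 1].  The points are decomposed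
    hierarchically: at the radii r_i = L 2^(i - z), with z = O(log n), each point joins the first point
    of a greedy r_i/2-net at distance at most rho r_i.  The space being doubling, an edge of length x is
    cut at level i for a fraction O(x / r_i) of the shifts, so that for a suitable shift the sum over
    all edges of the radii of the levels that cut them is O(log n) times the cost.  A cell of radius r
    has a set of (log n / eps)^O(d) portals which come within eps r / O(log n) of all its points;
    hence all edges can be routed through the portals of the cells that they leave, at an extra cost of
    eps times the optimum.

    To deal with fairness, each client emits a token and each open facility emits a fair multiset of
    demand tokens.  Tokens of the same kind are interchangeable, so all that matters about a cell is
    the number of tokens of each kind at each portal, which leaves n^((log n / eps)^O(d) l) signatures.
    For each L and rho, the algorithm starts from the single points and closes a table, with the
    cheapest entry found for each signature, under elementary rules: add a demand, move a token,
    connect a client to a demand of its type, concatenate two intervals of an ordering for which all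
    cells are intervals.  The rules are sound whatever the decomposition is, so the best complete entry
    is a fair solution; the decomposition shows that the closure contains a cheap one.

    The algorithm is deterministic.  It is written as a function [main] of the constants of the
    instance, and [cpt f] states that f is computed by a program within time B^O(1), where B is
    a number exceeding that of the signatures. *)
From HB Require Import structures.
Require Import Defs.
From mathcomp Require Import all_boot all_order all_algebra.
From mathcomp Require Import boolp classical_sets reals sequences exp.
From mathcomp Require Import zify ring lra.
Import Order.TTheory GRing.Theory Num.Theory.
Local Open Scope ring_scope.

Set Implicit Arguments.
Unset Strict Implicit.
Unset Printing Implicit Defensive.

Local Open Scope nat_scope.
(** * Functions computed on the real RAM *)

(** The range of levels is chosen so that both ends are harmless. At radius [L / 2^z] with
    [n < 2^z], the portal costs of all edges together are O(delta L), and [L] is at most the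
    optimum. For a good shift the radii of all cuts sum up to at most [3 K D] times the optimum,
    with [K = 2^(3 d)] and [D] levels; this is less than [L 4^z] when [L > 0], so the top level, of
    radius [L 4^z], cuts no edge and every token gets connected. A good shift is found by
    exhaustion: among [M = 2^(3 z)] equidistant ones, enough to absorb the rounding of the cut
    counts, one is at least as good as the average.

    The obstacle raised by fairness is that a signature cannot remember which facility a demand
    comes from. Fairness is therefore decided when a facility opens, by fixing a prototype; later a
    client may meet any demand of its type. In the end each facility has as many clients of each
    type as its prototype, though possibly other ones.

    All overheads are of the form [B^O(1)]. The constants that they put in the exponent stay below
    the threshold on [log n / eps], hence below its [d]-th power when [d > 0], which explains the
    exponent [2 d]. *)

Section Framework.
Variable R : realType.
Notation st := (state R).

Definition located (p : program) off (c : program) :=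
  forall i, i < size c -> onth p (off + i) = onth c i.

Lemma located_cat p off c1 c2 : located p off (c1 ++ c2) ->
  located p off c1 /\ located p (off + size c1) c2.
Proof.
move=> h; split=> i hi.
  by rewrite h ?size_cat ?(ltn_addr _ hi)// !onthE map_cat nth_cat size_map hi.
rewrite -addnA h ?size_cat ?ltn_add2l// !onthE map_cat nth_cat size_map.
by rewrite ltnNge leq_addr /= addKn.
Qed.

Lemma located_cons p off c cs : located p off (c :: cs) ->
  onth p off = Some c /\ located p off.+1 cs.
Proof.
move=> h; split; first by have := h 0 isT; rewrite addn0.
by move=> i hi; rewrite addSnnS (h i.+1).
Qed.

(** Quantifying over all coin sequences of length [t] says that the execution is deterministic; the
    coins merely count the steps. *)
Definition reach p t (s s' : st) := forall w, size w = t -> run p s w = s'.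

Lemma reach_trans p t1 t2 s1 s2 s3 :
  reach p t1 s1 s2 -> reach p t2 s2 s3 -> reach p (t1 + t2) s1 s3.
Proof.
move=> h1 h2 w hw; rewrite -(cat_take_drop t1 w) /run foldl_cat.
rewrite -/(run p s1 _) h1; last by rewrite size_takel// hw leq_addr.
by rewrite -/(run p _ _) h2// size_drop hw addKn.
Qed.

Lemma reach1 p c s s' : onth p (pc s) = Some c ->
  (forall b, exec b s c = s') -> reach p 1 s s'.
Proof. by move=> hc hs [|b []]//= _; rewrite /step hc. Qed.

Definition straight (c : instr) :=
  match c with ICoin _ | Jump _ | JumpILe _ _ _ | JumpRLe _ _ _ => false | _ => true end.

Definition exs (s : st) (c : program) := foldl (@exec R false) s c.

Lemma reach_straight p off c s : all straight c -> located p off c ->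
  pc s = off -> reach p (size c) s (exs s c) /\ pc (exs s c) = off + size c.
Proof.
elim: c off s => [|i c IH] off s /=; first by move=> _ _ <-; rewrite addn0; split=> // -[].
case/andP=> hi hc /located_cons[h1 h2] hs.
have hp : pc (exec false s i) = off.+1 by case: i hi {h1} => //= *; rewrite hs.
have [h3 h4] := IH _ _ hc h2 hp.
split; last by rewrite /exs /= h4 addSnnS.
have -> : (size c).+1 = 1 + size c by [].
apply: reach_trans h3; apply: (@reach1 _ i); first by rewrite hs.
by move=> b; case: i hi {h1 hp h4 h2}.
Qed.

(* Integer registers 0-7 hold the constants below, 8 the heap pointer, 9 zero;
   arguments and results are passed in register 10. *)
Record ctx := Ctx {
  cst : nat -> nat;
  base : nat;
  cim : nat -> nat;
  crm : nat -> R }.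

Definition cn g := cst g 0.
Definition cl g := cst g 1.
Definition ck g := cst g 2.
Definition cB g := cst g 3.
Definition cz g := cst g 4.
Definition cQ g := cst g 5.
Definition cM g := cst g 6.
Definition cD g := cst g 7.

(** [cB] bounds list lengths and loop counts. [base] lies above both parts of the input, so the heap
    never overwrites it, and it is positive, so that address 0 is free to represent the empty
    list. *)
Definition okg g := [/\ 1 < cB g, 0 < base g, cn g < cB g, cl g + cl g + cn g * cn g <= base g
  & [/\ (cl g).+1.*2 <= cB g, cM g <= cB g, cz g * 3 < cB g, cD g <= cB g
    & cn g + cn g <= base g]].

Definition inv g (s : st) :=
  [/\ forall i, i < 8 -> ireg s i = cst g i, ireg s 9 = 0, base g <= ireg s 8
    & forall a, a < base g -> imem s a = cim g a /\ rmem s a = crm g a].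

Definition ext (s s' : st) := ireg s 8 <= ireg s' 8 /\
  forall a, a < ireg s 8 -> imem s' a = imem s a /\ rmem s' a = rmem s a.

Lemma ext_trans s1 s2 s3 : ext s1 s2 -> ext s2 s3 -> ext s1 s3.
Proof.
move=> [a b] [c d]; split; first exact: leq_trans a c.
move=> x hx; have [<- <-] := b _ hx; apply: d; exact: leq_trans hx a.
Qed.

(** A value is represented by one word, a pointer for compound types. Cells below the heap pointer
    are never modified, so a representation survives all later computations; this is what [rp_ext]
    records. *)
Class rtype (A : Type) := RType {
  rp : ctx -> st -> nat -> A -> Prop;
  rp_ext : forall g s s' w a, ext s s' -> rp g s w a -> rp g s' w a }.

#[global] Instance rt_nat : rtype nat := @RType nat (fun _ _ w a => w = a)
  (fun _ _ _ _ _ _ h => h).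
#[global] Instance rt_bool : rtype bool :=
  @RType bool (fun _ _ w a => w = nat_of_bool a) (fun _ _ _ _ _ _ h => h).
#[global] Instance rt_unit : rtype unit := @RType unit (fun _ _ _ _ => True)
  (fun _ _ _ _ _ _ h => h).

#[global] Instance rt_R : rtype R.
Proof.
refine (@RType R (fun g s w r => w < ireg s 8 /\ rmem s w = r) _).
move=> g s s' w r [h1 h2] [h3 <-]; split; first exact: leq_trans h3 h1.
by case: (h2 _ h3).
Defined.

#[global] Instance rt_prod A B (rA : rtype A) (rB : rtype B) : rtype (A * B).
Proof.
refine (@RType (A * B) (fun g s w x => [/\ w.+1 < ireg s 8,
   rp g s (imem s w) x.1 & rp g s (imem s w.+1) x.2]) _).
move=> g s s' w x e [h1 h2 h3]; have [e1 e2] := e; split.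
- exact: leq_trans h1 e1.
- by have [-> _] := e2 _ (ltnW h1); apply: rp_ext h2.
- by have [-> _] := e2 _ h1; apply: rp_ext h3.
Defined.

(* The empty list is the pointer 0. *)
Fixpoint rseq A (rA : rtype A) g (s : st) w (x : seq A) : Prop :=
  if x is a :: x' then
    [/\ 0 < w, w.+1 < ireg s 8, rp g s (imem s w) a & rseq rA g s (imem s w.+1) x']
  else w = 0.

(** The length bound belongs to the representation, so that a loop over any represented list
    multiplies the time by a power of [B] only. *)
#[global] Instance rt_seq A (rA : rtype A) : rtype (seq A).
Proof.
refine (@RType (seq A) (fun g s w x => size x <= cB g /\ rseq rA g s w x) _).
move=> g s s' w x e [h1 h2]; split=> // {h1}; have [e1 e2] := e.
elim: x w h2 => //= a x IH w [h1 h2 h3 h4]; split=> //.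
- exact: leq_trans h2 e1.
- by have [-> _] := e2 _ (ltnW h2); apply: rp_ext h3.
- by have [-> _] := e2 _ h2; apply: IH.
Defined.

Definition post g k (s s' : st) := [/\ inv g s', ext s s'
  & forall i, i < k -> ireg s' (20 + i) = ireg s (20 + i)].

Lemma post_trans g k s1 s2 s3 : post g k s1 s2 -> post g k s2 s3 -> post g k s1 s3.
Proof.
move=> [_ h1 h2] [h3 h4 h5]; split=> //; first exact: ext_trans h1 h4.
by move=> i hi; rewrite h5// h2.
Qed.

(* The code depends on its address [off], jumps being absolute, and on the number [k] of registers
   from 20 on that it has to preserve; all memory in use is preserved too. *)
Definition cptP A B {rA : rtype A} {rB : rtype B} (P : ctx -> A -> Prop)
    (f : ctx -> A -> B) :=
  exists e (code : nat -> nat -> program), forall k off p g s a,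
    okg g -> located p off (code k off) -> pc s = off -> inv g s ->
    rp g s (ireg s 10) a -> P g a ->
    exists t s', [/\ t <= cB g ^ e.+1, reach p t s s',
      pc s' = off + size (code k off), post g k s s' & rp g s' (ireg s' 10) (f g a)].

Definition cpt A B {rA : rtype A} {rB : rtype B} (f : ctx -> A -> B) :=
  cptP (fun _ _ => True) f.

(** For [x, y >= 2] one has [x + y <= x * y], so sums of powers of [B] are again bounded by powers.
    Positive exponents, written [e.+1], ensure that each power is at least 2. *)
Lemma leB_add B a b c e1 e2 e3 : 1 < B -> a <= B ^ e1.+1 -> b <= B ^ e2.+1 ->
  (e1 + e2).+2 = e3 -> c = a + b -> c <= B ^ e3.
Proof.
move=> hB ha hb <- ->; apply: (leq_trans (leq_add ha hb)).
rewrite -addnS -addSn expnD.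
have h1 : 1 < B ^ e1.+1 by rewrite (leq_trans hB)// -{1}(expn1 B) leq_pexp2l// ltnW.
have h2 : 1 < B ^ e2.+1 by rewrite (leq_trans hB)// -{1}(expn1 B) leq_pexp2l// ltnW.
by move: h1 h2; set x := B ^ _; set y := B ^ _ => h1 h2; nia.
Qed.

Lemma leB_cst B c : 1 < B -> c <= B ^ c.+1.
Proof. by move=> hB; apply: ltnW; apply: ltn_trans (ltn_expl c hB) _; rewrite ltn_exp2l. Qed.

Lemma leB_le B t e e' : 1 < B -> t <= B ^ e -> e <= e' -> t <= B ^ e'.
Proof. by move=> hB h1 h2; apply: (leq_trans h1); rewrite leq_exp2l. Qed.

Lemma cptP_straight A B {rA : rtype A} {rB : rtype B} P (f : ctx -> A -> B) c :
  all straight c ->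
  (forall g s a, okg g -> inv g s -> rp g s (ireg s 10) a -> P g a ->
     (forall k, post g k s (exs s c)) /\ rp g (exs s c) (ireg (exs s c) 10) (f g a)) ->
  cptP P f.
Proof.
move=> hc h; exists (size c), (fun _ _ => c) => k off p g s a hg hl hs hi ha hP.
have [h1 h2] := reach_straight hc hl hs; have [h3 h4] := h _ _ _ hg hi ha hP.
exists (size c), (exs s c); split=> //; apply: leB_cst; by case: hg.
Qed.

Lemma post_regs g k (s s' : st) : inv g s -> imem s' = imem s -> rmem s' = rmem s ->
  (forall i, i < 10 -> ireg s' i = ireg s i) ->
  (forall i, i < k -> ireg s' (20 + i) = ireg s (20 + i)) -> post g k s s'.
Proof.
move=> [h1 h2 h3 h4] e1 e2 e3 e4; split=> //.
  split; rewrite ?e1 ?e2 ?e3// => i hi.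
  by rewrite e3 ?h1// (leq_trans hi).
by split; rewrite ?e1 ?e2 ?e3.
Qed.

Lemma cptP_ext A B {rA : rtype A} {rB : rtype B} P (f f' : ctx -> A -> B) :
  cptP P f -> (forall g s w a, okg g -> rp g s w a -> P g a -> f g a = f' g a) ->
  cptP P f'.
Proof.
move=> [e [c h]] ee; exists e, c => k off p g s a hg hl hs hi ha hP.
by rewrite -(ee _ _ _ _ hg ha hP); apply: h.
Qed.

Lemma cptP_sub A B {rA : rtype A} {rB : rtype B} (P P' : ctx -> A -> Prop) (f : ctx -> A -> B) :
  cptP P f -> (forall g a, P' g a -> P g a) -> cptP P' f.
Proof.
move=> [e [c h]] ee; exists e, c => k off p g s a hg hl hs hi ha hP.
by apply: h => //; apply: ee.
Qed.

Lemma cpt_id A {rA : rtype A} : cpt (fun _ (a : A) => a).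
Proof.
by apply: (@cptP_straight _ _ _ _ _ _ [::]).
Qed.

Lemma cpt_comp A B C {rA : rtype A} {rB : rtype B} {rC : rtype C}
    (h : ctx -> B -> C) (f : ctx -> A -> B) :
  cpt h -> cpt f -> cpt (fun g a => h g (f g a)).
Proof.
move=> [e1 [c1 h1]] [e2 [c2 h2]].
exists (e2 + e1).+1, (fun k off => c2 k off ++ c1 k (off + size (c2 k off))).
move=> k off p g s a hg /located_cat[l1 l2] hs hi ha hP.
have [t1 [s1 [b1 r1 p1 q1 a1]]] := h2 _ _ _ _ _ _ hg l1 hs hi ha I.
have [i1 x1 y1] := q1.
have [t2 [s2 [b2 r2 p2 q2 a2]]] := h1 _ _ _ _ _ _ hg l2 p1 i1 a1 I.
exists (t1 + t2), s2; split=> //.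
- by apply: leB_add b1 b2 _ _ => //; case: hg.
- exact: reach_trans r1 r2.
- by rewrite p2 size_cat addnA.
- exact: post_trans q1 q2.
Qed.

Lemma rp_regs A {rA : rtype A} g (s s' : st) w a : imem s' = imem s -> rmem s' = rmem s ->
  ireg s' 8 = ireg s 8 -> rp g s w a -> rp g s' w a.
Proof. by move=> e1 e2 e3; apply: rp_ext; split; rewrite ?e1 ?e2 ?e3. Qed.

Definition alloc2 (i j : nat) : program :=
  [:: IStore 8 i; IConst 13 1; IAdd 14 8 13; IStore 14 j; IAdd 10 8 9; IAdd 8 14 13].

Lemma alloc2P g s i j : inv g s -> i < 13 -> j < 13 -> forall k,
  post g k s (exs s (alloc2 i j)).
Proof.
move=> [h1 h2 h3 h4] hi hj k; split.
- split=> /=.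
  + by case=> [|[|[|[|[|[|[|[|]]]]]]]]//= _; apply: h1.
  + by [].
  + by apply: (leq_trans h3); rewrite !addn1 ltnW.
  + move=> a ha; have [<- <-] := h4 _ ha; split=> //.
    have h : a < ireg s 8 by apply: leq_trans ha h3.
    by rewrite !ltn_eqF// addn1 ltnS ltnW.
- split=> /=; first by rewrite !addn1 ltnW.
  by move=> a h; rewrite !ltn_eqF// addn1 ltnS ltnW.
- by move=> x _; rewrite /=.
Qed.

End Framework.

(** * Single instructions as computed functions *)

Section Primitives.
Variable R : realType.
Notation st := (state R).
Notation ctx := (ctx R).

Lemma exs_cat (s : st) c1 c2 : exs s (c1 ++ c2) = exs (exs s c1) c2.
Proof. exact: foldl_cat. Qed.

Lemma post_scratch g (s s' : st) : inv g s -> imem s' = imem s -> rmem s' = rmem s ->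
  (forall i, (i < 10) || (20 <= i) -> ireg s' i = ireg s i) -> forall k, post g k s s'.
Proof.
move=> h1 h2 h3 h4 k; apply: post_regs => // i hi; apply: h4; first by rewrite hi.
by rewrite leq_addr orbT.
Qed.

Definition ld2 : program := [:: ILoad 11 10; IConst 12 1; IAdd 12 10 12; ILoad 12 12].

Lemma ld2P A B (rA : rtype R A) (rB : rtype R B) (g : ctx) (s : st) (a : A * B) :
  inv g s -> rp g s (ireg s 10) a ->
  (forall k, post g k s (exs s ld2)) /\
  rp g (exs s ld2) (ireg (exs s ld2) 11) a.1 /\ rp g (exs s ld2) (ireg (exs s ld2) 12) a.2.
Proof.
move=> hi [h1 h2 h3]; split.
  by apply: post_scratch => // i hh; rewrite /=; move: i hh; do 20?case=> //.
rewrite /= addn1; split.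
  by apply: rp_regs h2.
by apply: rp_regs h3.
Qed.

Ltac scratch := apply: post_scratch => //=; do 20?case=> //.

Lemma cpt_fst0 A B (rA : rtype R A) (rB : rtype R B) : cpt (fun (_ : ctx) (a : A * B) => a.1).
Proof.
apply: (@cptP_straight _ _ _ _ _ _ _ (ld2 ++ [:: IAdd 10 11 9])) => // g s a hg hi ha _.
rewrite exs_cat; have [h1 [h2 h3]] := ld2P hi ha; split.
  by move=> k; apply: post_trans (h1 k) _; have [? _ _] := h1 0; scratch.
have [[_ h9 _ _] _ _] := h1 0.
move: (exs s ld2) {h1} h2 h3 h9 => s1 h2 h3 h9.
by rewrite /= h9 addn0; apply: rp_regs h2.
Qed.

Lemma cpt_snd0 A B (rA : rtype R A) (rB : rtype R B) : cpt (fun (_ : ctx) (a : A * B) => a.2).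
Proof.
apply: (@cptP_straight _ _ _ _ _ _ _ (ld2 ++ [:: IAdd 10 12 9])) => // g s a hg hi ha _.
rewrite exs_cat; have [h1 [h2 h3]] := ld2P hi ha; split.
  by move=> k; apply: post_trans (h1 k) _; have [? _ _] := h1 0; scratch.
have [[_ h9 _ _] _ _] := h1 0.
move: (exs s ld2) {h1} h2 h3 h9 => s1 h2 h3 h9.
by rewrite /= h9 addn0; apply: rp_regs h3.
Qed.

Lemma cpt_addn0 : cpt (fun (_ : ctx) (a : nat * nat) => a.1 + a.2).
Proof.
apply: (@cptP_straight _ _ _ _ _ _ _ (ld2 ++ [:: IAdd 10 11 12])) => // g s a hg hi ha _.
rewrite exs_cat; have [h1 [h2 h3]] := ld2P hi ha; split.
  by move=> k; apply: post_trans (h1 k) _; have [? _ _] := h1 0; scratch.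
by rewrite /rp /= -h2 -h3.
Qed.

Lemma cpt_subn0 : cpt (fun (_ : ctx) (a : nat * nat) => a.1 - a.2).
Proof.
apply: (@cptP_straight _ _ _ _ _ _ _ (ld2 ++ [:: ISub 10 11 12])) => // g s a hg hi ha _.
rewrite exs_cat; have [h1 [h2 h3]] := ld2P hi ha; split.
  by move=> k; apply: post_trans (h1 k) _; have [? _ _] := h1 0; scratch.
by rewrite /rp /= -h2 -h3.
Qed.

(** With truncated subtraction, [1 - (a - b)] is the truth value of [a <= b], which avoids a
    jump. *)
Lemma cpt_leq0 : cpt (fun (_ : ctx) (a : nat * nat) => a.1 <= a.2).
Proof.
apply: (@cptP_straight _ _ _ _ _ _ _
  (ld2 ++ [:: ISub 10 11 12; IConst 11 1; ISub 10 11 10])) => // g s a hg hi ha _.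
rewrite exs_cat; have [h1 [h2 h3]] := ld2P hi ha; split.
  by move=> k; apply: post_trans (h1 k) _; have [? _ _] := h1 0; scratch.
rewrite /rp /=; move: h2 h3; rewrite /rp /= => -> ->.
by rewrite -subn_eq0; case: (a.1 - a.2).
Qed.

Lemma cpt_const A (rA : rtype R A) (v : nat) : cpt (fun (_ : ctx) (_ : A) => v).
Proof.
apply: (@cptP_straight _ _ _ _ _ _ _ [:: IConst 10 v]) => // g s a hg hi ha _.
by split=> //; scratch.
Qed.

Lemma cpt_bool A (rA : rtype R A) (v : bool) : cpt (fun (_ : ctx) (_ : A) => v).
Proof.
apply: (@cptP_straight _ _ _ _ _ _ _ [:: IConst 10 v]) => // g s a hg hi ha _.
by split=> //; scratch.
Qed.

Lemma cpt_cst A (rA : rtype R A) i : i < 8 -> cpt (fun (g : ctx) (_ : A) => cst g i).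
Proof.
move=> hh; apply: (@cptP_straight _ _ _ _ _ _ _ [:: IAdd 10 i 9]) => // g s a hg hi ha _.
split; first by scratch.
by rewrite /rp /=; have [h1 -> _ _] := hi; rewrite h1// addn0.
Qed.

Lemma cpt_nil A B (rA : rtype R A) (rB : rtype R B) : cpt (fun (_ : ctx) (_ : A) => [::] : seq B).
Proof.
apply: (@cptP_straight _ _ _ _ _ _ _ [:: IConst 10 0]) => // g s a hg hi ha _.
by split=> //; scratch.
Qed.

Definition allocR : program := [:: RStore 8 0; IAdd 10 8 9; IConst 11 1; IAdd 8 8 11].

Lemma allocRP (g : ctx) (s : st) : inv g s -> (forall k, post g k s (exs s allocR)) /\
  rp g (exs s allocR) (ireg (exs s allocR) 10) (rreg s 0).
Proof.
move=> [h1 h2 h3 h4]; split; last first.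
  by rewrite /rp /= h2 addn0 addn1 ltnSn eqxx.
move=> k; split.
- split=> /=.
  + by case=> [|[|[|[|[|[|[|[|]]]]]]]]//= _; apply: h1.
  + by [].
  + by apply: (leq_trans h3); rewrite !addn1.
  + move=> a ha; have [<- <-] := h4 _ ha; split=> //.
    by rewrite ltn_eqF//; apply: leq_trans ha h3.
- by split=> /= [|a h]; rewrite ?addn1// ltn_eqF.
- by move=> x _; rewrite /=.
Qed.

Definition opR (c : instr) : program := ld2 ++ [:: RLoad 0 11; RLoad 1 12; c] ++ allocR.

Lemma opRP c (h : R -> R -> R) : straight c ->
  (forall b (s : st), exec b s c = set_rreg s 0 (h (rreg s 0) (rreg s 1))) ->
  cpt (fun (_ : ctx) (a : R * R) => h a.1 a.2).
Proof.
move=> hc hx; apply: (@cptP_straight _ _ _ _ _ _ _ (opR c)).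
  by rewrite /opR all_cat /= hc.
move=> g s a hg hi ha _; rewrite /opR !exs_cat.
have [h1 [h2 h3]] := ld2P hi ha.
set s1 := exs s ld2 in h1 h2 h3 *; set s2 := exs s1 _.
have h4 : forall k, post g k s1 s2.
  by have [? _ _] := h1 0; move=> k; apply: post_scratch => //=; rewrite /s2 /exs /= hx.
have [i2 _ _] := h4 0; have [h5 h6] := allocRP i2.
split; first by move=> k; apply: post_trans (h1 k) (post_trans (h4 k) (h5 k)).
suff -> : h a.1 a.2 = rreg s2 0 by exact: h6.
have [_ e1] := h2; have [_ e2] := h3.
by rewrite /s2 /exs /= hx /= e1 e2.
Qed.

Lemma cpt_addR0 : cpt (fun (_ : ctx) (a : R * R) => (a.1 + a.2)%R).
Proof. by apply: (@opRP (RAdd 0 0 1) (fun x y => x + y)%R). Qed.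

Lemma cpt_mulR0 : cpt (fun (_ : ctx) (a : R * R) => (a.1 * a.2)%R).
Proof. by apply: (@opRP (RMul 0 0 1) (fun x y => x * y)%R). Qed.

Lemma cpt_divR0 : cpt (fun (_ : ctx) (a : R * R) => (a.1 / a.2)%R).
Proof. by apply: (@opRP (RDiv 0 0 1) (fun x y => x / y)%R). Qed.

Lemma cpt_natR0 : cpt (fun (_ : ctx) (a : nat) => a%:R : R).
Proof.
apply: (@cptP_straight _ _ _ _ _ _ _ (ROfInt 0 10 :: allocR)) => // g s a hg hi ha _.
rewrite -cat1s exs_cat; set s2 := exs s _.
have h4 : forall k, post g k s s2 by move=> k; apply: post_scratch.
have [i2 _ _] := h4 0; have [h5 h6] := allocRP i2.
split; first by move=> k; apply: post_trans (h4 k) (h5 k).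
suff -> : a%:R = rreg s2 0 :> R by exact: h6.
by rewrite /= (ha : _ = _).
Qed.

Lemma reach_jumpI p (s : st) i j t : onth p (pc s) = Some (JumpILe i j t) ->
  reach p 1 s (goto s (if ireg s i <= ireg s j then t else (pc s).+1)).
Proof. by move=> h; apply: reach1 h _. Qed.

Lemma post_goto g k (s : st) t : inv g s -> post g k s (goto s t).
Proof. by move=> h; apply: post_regs. Qed.

Lemma rp_goto A (rA : rtype R A) g (s : st) t w (a : A) : rp g s w a -> rp g (goto s t) w a.
Proof. exact: rp_regs. Qed.

Lemma cpt_leR0 : cpt (fun (_ : ctx) (a : R * R) => (a.1 <= a.2)%R).
Proof.
(* The first six instructions load the operands, so the conditional jump is at [off + 6], the branch
   for true at [off + 9] and the end at [off + 10]. The exponent 10 is for [leB_cst], as at most 10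
   steps are made. *)
exists 10, (fun _ off => (ld2 ++ [:: RLoad 0 11; RLoad 1 12]) ++
   [:: JumpRLe 0 1 (off + 9); IConst 10 0; Jump (off + 10); IConst 10 1]).
move=> k off p g s a hg /located_cat[l1 l2] hs hi ha _.
have hst : all straight (ld2 ++ [:: RLoad 0 11; RLoad 1 12]) by [].
have [r1 p1] := reach_straight hst l1 hs.
rewrite exs_cat in r1 p1.
have [h1 [h2 h3]] := ld2P hi ha.
set s1 := exs s ld2 in h1 h2 h3 r1 p1; set s2 := exs s1 _ in r1 p1.
have h4 : post g k s1 s2 by have [? _ _] := h1 0; apply: post_scratch.
have [q1 /located_cons[q2 /located_cons[q3 /located_cons[q4 _]]]] := located_cons l2.
have e1 : rreg s2 0 = a.1 by case: h2.
have e2 : rreg s2 1 = a.2 by case: h3.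
have [i2 _ _] := h4.
set s3 := goto s2 (if (a.1 <= a.2)%R then off + 9 else (pc s2).+1).
have r3 : reach p 1 s2 s3.
  rewrite /s3 -e1 -e2; apply: (@reach1 _ _ (JumpRLe 0 1 (off + 9))) => //.
  by rewrite p1.
have hh : forall b : bool, exists2 t, t <= 2 & exists s4, [/\ reach p t 
   (goto s2 (if b then off + 9 else (pc s2).+1)) s4, pc s4 = off + 10, post g k s2 s4 & 
   ireg s4 10 = b].
  case.
    exists 1 => //; exists (set_ireg (goto s2 (off + 9)) 10 1); split=> //.
    - apply: (@reach1 _ _ (IConst 10 1)) => //=; rewrite -q4; congr (onth _ _).
      by rewrite -!addnS.
    - by rewrite /= -addnS.
    - by apply: post_regs => //=; do 20?case=> //.
  exists 2 => //; exists (goto (set_ireg (goto s2 (pc s2).+1) 10 0) (off + 10)).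
  split=> //; last first.
    by apply: post_regs => //=; do 20?case=> //.
  apply: (@reach_trans _ _ 1 1 _ (set_ireg (goto s2 (pc s2).+1) 10 0)).
    by apply: (@reach1 _ _ (IConst 10 0)) => //; rewrite -[LHS]/(onth p (pc s2).+1) p1.
  by apply: (@reach1 _ _ (Jump (off + 10))) => //; rewrite -[LHS]/(onth p (pc s2).+2) p1.
have [t ht [s4 [r4 p4 h5 e4]]] := hh (a.1 <= a.2)%R.
exists (6 + (1 + t)), s4; split=> //.
- by apply: (@leq_trans 10); [lia | apply: leB_cst; case: hg].
- exact: reach_trans r1 (reach_trans r3 r4).
Qed.

End Primitives.

(** * Pairing, branching, loops and composition *)

Section Combinators.
Variable R : realType.
Notation st := (state R).
Notation ctx := (ctx R).

Definition mv i j := IAdd i j 9.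

Lemma mv_run p i j g (s : st) : onth p (pc s) = Some (mv i j) -> inv g s -> 10 <= i ->
  exists s', [/\ reach p 1 s s', pc s' = (pc s).+1, inv g s', ext s s'
    & forall x, ireg s' x = if x == i then ireg s j else ireg s x].
Proof.
move=> h1 h2 h3; exists (set_ireg s i (ireg s j + ireg s 9)); have [q1 q2 q3 q4] := h2.
have h8 : 8 == i = false by case: (8 =P i) h3 => // <-.
have h9 : 9 == i = false by case: (9 =P i) h3 => // <-.
split=> //.
- by apply: reach1 h1 _.
- split=> //=; rewrite ?h8 ?h9// => x hx; rewrite ltn_eqF ?q1//.
  by rewrite (leq_trans hx)// (leq_trans _ h3).
- by split=> //=; rewrite h8.
- by move=> x /=; rewrite q2 addn0.
Qed.

Lemma alloc2_pair A B (rA : rtype R A) (rB : rtype R B) g (s : st) (a : A) (b : B) :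
  inv g s -> rp g s (ireg s 11) a -> rp g s (ireg s 12) b ->
  rp g (exs s (alloc2 11 12)) (ireg (exs s (alloc2 11 12)) 10) (a, b) /\
  0 < ireg (exs s (alloc2 11 12)) 10 \/ base g = 0.
Proof.
move=> hi ha hb; have [_ he _] := @alloc2P _ _ _ 11 12 hi isT isT 0.
have [h1 h2 h3 h4] := hi.
case: (posnP (base g)) => h5; [by right|left]; split; last first.
  by rewrite /= h2 addn0; apply: leq_trans h5 h3.
split.
- by rewrite /= h2 addn0 !addn1.
- have -> : imem (exs s (alloc2 11 12)) (ireg (exs s (alloc2 11 12)) 10) = ireg s 11.
    by rewrite /= h2 addn0 addn1 eqxx ltn_eqF.
  exact: rp_ext ha.
- have -> : imem (exs s (alloc2 11 12)) (ireg (exs s (alloc2 11 12)) 10).+1 = ireg s 12.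
    by rewrite /= h2 addn0 addn1 eqxx.
  exact: rp_ext hb.
Qed.

Lemma eq20 k i : i < 20 -> i == 20 + k = false.
Proof. by move=> h; rewrite ltn_eqF// ltn_addr. Qed.

Lemma eq02 k i : i < 20 -> 20 + k == i = false.
Proof. by move=> h; rewrite eq_sym eq20. Qed.

(** The registers from 20 on serve as a stack of height [k]: the argument is saved in [20 + k] while
    [f1] runs, and the first result in [20 + k.+1] while [f2] runs. *)
Lemma cpt_pair A B C (rA : rtype R A) (rB : rtype R B) (rC : rtype R C)
    (f1 : ctx -> A -> B) (f2 : ctx -> A -> C) :
  cpt f1 -> cpt f2 -> cpt (fun g a => (f1 g a, f2 g a)).
Proof.
move=> [e1 [c1 h1]] [e2 [c2 h2]].
pose o1 off := off.+1; pose k1 k off := c1 k.+1 (o1 off).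
pose o2 k off := o1 off + size (k1 k off); pose k2 k off := c2 k.+2 (o2 k off).+2.
exists (12 + (e1 + e2).+1).+1, (fun k off => [:: mv (20 + k) 10] ++ k1 k off ++ 
  [:: mv (20 + k.+1) 10; mv 10 (20 + k)] ++ k2 k off ++
  mv 12 10 :: mv 11 (20 + k.+1) :: alloc2 11 12).
move=> k off p g s a hg /located_cons[l1 /located_cat[l2 /located_cons[l3
  /located_cons[l4 /located_cat[l5 /located_cons[l6 /located_cons[l7 l8]]]]]]] hs hi ha _.
rewrite -hs in l1.
have [s1 [r1 p1 i1 x1 q1]] := mv_run l1 hi isT.
rewrite hs in p1.
have a1 : rp g s1 (ireg s1 10) a by rewrite q1 eq20//; apply: rp_ext ha.
have [t2 [s2 [b2 r2 p2 [i2 x2 y2] a2]]] := h1 _ _ _ _ _ _ hg l2 p1 i1 a1 I.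
rewrite -p2 in l3; have [s3 [r3 p3 i3 x3 q3]] := mv_run l3 i2 isT.
rewrite p2 in p3; rewrite -p3 in l4.
have [s4 [r4 p4 i4 x4 q4]] := mv_run l4 i3 isT.
have e4 : ireg s4 10 = ireg s 10.
  by rewrite q4 eqxx q3 eqn_add2l ltn_eqF// y2// q1 eqxx.
have a4 : rp g s4 (ireg s4 10) a.
  by rewrite e4; apply: rp_ext ha; do 3!(apply: ext_trans; [eassumption|]).
rewrite p3 in p4.
have [t5 [s5 [b5 r5 p5 [i5 x5 y5] a5]]] := h2 _ _ _ _ _ _ hg l5 p4 i4 a4 I.
rewrite -p5 in l6; have [s6 [r6 p6 i6 x6 q6]] := mv_run l6 i5 isT.
rewrite p5 in p6; rewrite -p6 in l7; have [s7 [r7 p7 i7 x7 q7]] := mv_run l7 i6 isT.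
rewrite p6 in p7.
have [r8 p8] := reach_straight (isT : all straight (alloc2 11 12)) l8 p7.
have w12 : rp g s7 (ireg s7 12) (f2 g a).
  by rewrite q7 /= q6 /=; apply: rp_ext a5; apply: ext_trans x6 x7.
have w11 : rp g s7 (ireg s7 11) (f1 g a).
  rewrite q7 /= q6 eq02// y5// q4 eq02// q3 eqxx.
  by apply: rp_ext a2; do 4!(apply: ext_trans; [eassumption|]).
have [[w _]|hb] := alloc2_pair i7 w11 w12; last by case: hg; rewrite hb.
have [i8 x8 y8] := @alloc2P _ _ _ 11 12 i7 isT isT k.
exists (1 + (t2 + (1 + (1 + (t5 + (1 + (1 + size (alloc2 11 12)))))))), (exs s7 (alloc2 11 12)).
split.
- have h := leB_add _ b2 b5 erefl erefl.
  case: hg => hB _ _ _ _; apply: (@leB_add _ 11 (t2 + t5) _ 12 (e1 + e2).+1) => //.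
  + by apply: leq_trans (leB_cst 12 hB).
  + exact: h.
  + by rewrite /=; lia.
- by do 7!(apply: reach_trans; [eassumption|]).
- rewrite p8 !size_cat /= /o2 /o1; lia.
- split=> //; first by do 7!(apply: ext_trans; [eassumption|]).
  move=> i hk; rewrite y8// q7 eq02// q6 eq02//.
  have hk1 := leqW hk; have hk2 := leqW hk1.
  by rewrite y5// q4 eq02// q3 eqn_add2l ltn_eqF// y2// q1 eqn_add2l ltn_eqF.
- exact: w.
Qed.

(** Each branch has to work only where it is taken. The bounded cons relies on this: it may assume
    that the length test has succeeded. *)
Lemma cptP_if A B (rA : rtype R A) (rB : rtype R B) (b : ctx -> A -> bool)
    (f1 f2 : ctx -> A -> B) :
  cpt b -> cptP (fun g a => b g a) f1 -> cptP (fun g a => ~~ b g a) f2 ->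
  cpt (fun g a => if b g a then f1 g a else f2 g a).
Proof.
move=> [e0 [c0 h0]] [e1 [c1 h1]] [e2 [c2 h2]].
pose o1 off := off.+1; pose k0 k off := c0 k.+1 (o1 off).
pose o2 k off := (o1 off + size (k0 k off)).+3; pose k1 k off := c1 k (o2 k off).
pose o3 k off := (o2 k off + size (k1 k off)).+1; pose k2 k off := c2 k (o3 k off).
exists (12 + (e0 + (e1 + e2).+1).+1).+1, (fun k off => mv (20 + k) 10 :: k0 k off ++ 
  mv 11 10 :: mv 10 (20 + k) :: JumpILe 11 9 (o3 k off) :: k1 k off ++
  Jump (o3 k off + size (k2 k off)) :: k2 k off).
move=> k off p g s a hg /located_cons[l1 /located_cat[l2 /located_cons[l3
  /located_cons[l4 /located_cons[l5 /located_cat[l6 /located_cons[l7 l8]]]]]]] hs hi ha _.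
rewrite -hs in l1.
have [s1 [r1 p1 i1 x1 q1]] := mv_run l1 hi isT.
rewrite hs in p1.
have a1 : rp g s1 (ireg s1 10) a by rewrite q1 eq20//; apply: rp_ext ha.
have [t2 [s2 [b2 r2 p2 [i2 x2 y2] a2]]] := h0 _ _ _ _ _ _ hg l2 p1 i1 a1 I.
rewrite -p2 in l3; have [s3 [r3 p3 i3 x3 q3]] := mv_run l3 i2 isT.
rewrite p2 in p3; rewrite -p3 in l4.
have [s4 [r4 p4 i4 x4 q4]] := mv_run l4 i3 isT.
have e4 : ireg s4 10 = ireg s 10.
  by rewrite q4 eqxx q3 eq02// y2// q1 eqxx.
have a4 : rp g s4 (ireg s4 10) a.
  by rewrite e4; apply: rp_ext ha; do 3!(apply: ext_trans; [eassumption|]).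
rewrite p3 in p4; rewrite -p4 in l5.
have r5 := reach_jumpI l5.
have e11 : ireg s4 11 = b g a by rewrite q4 /= q3 /= a2.
have e9 : ireg s4 9 = 0 by case: i4.
rewrite e11 e9 p4 in r5.
have x04 : ext s s4 by do 3!(apply: ext_trans; [eassumption|]).
have y04 : forall i, i < k -> ireg s4 (20 + i) = ireg s (20 + i).
  move=> i hk; rewrite q4 eq02// q3 eq02// y2 ?(leqW hk)// q1 eqn_add2l ltn_eqF//.
case: hg => hB hg2 hg3 hg4 hg5; have hg : okg g by [].
have r04 : reach p (1 + (t2 + (1 + 1))) s s4 by do 3!(apply: reach_trans; [eassumption|]).
have bound e t : t <= cB g ^ e.+1 -> e <= e1 + e2 -> 
    6 + (t2 + t) <= cB g ^ (12 + (e0 + (e1 + e2).+1).+1).+2.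
  move=> ht he; apply: (@leB_add _ 6 (t2 + t) _ 12 (e0 + (e1 + e2).+1).+1) => //.
    by apply: leq_trans (leB_cst 12 hB).
  apply: (@leB_add _ t2 t _ e0 (e1 + e2).+1) => //.
  by apply: leB_le ht _ => //; rewrite ltnS leqW.
have [hb|hb] := boolP (b g a).
  rewrite hb /= in r5; set s5 := goto s4 _ in r5.
  have [i5 x5 y5] := post_goto k (o2 k off) i4.
  have [t6 [s6 [b6 r6 p6 [i6 x6 y6] a6]]] := h1 _ _ _ _ _ _ hg l6 (erefl : pc s5 = o2 k off) i5 
     (rp_goto _ a4) hb.
  rewrite -p6 in l7.
  set tt := o3 k off + _ in l7.
  have r7 : reach p 1 s6 (goto s6 tt) by apply: reach1 l7 _.
  have [i7 x7 y7] := post_goto k tt i6.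
  exists (1 + (t2 + (1 + 1)) + (1 + (t6 + 1))), (goto s6 tt); split.
  - have -> : 1 + (t2 + (1 + 1)) + (1 + (t6 + 1)) = 5 + (t2 + t6) by lia.
    by apply: ltnW; apply: bound b6 _; rewrite leq_addr.
  - by apply: reach_trans r04 _; apply: reach_trans r5 _; apply: reach_trans r6 _.
  - by rewrite /tt /= !size_cat /= size_cat /= /o3 /o2 /o1; lia.
  - split=> //.
      by apply: ext_trans x04 _; apply: ext_trans x5 _; apply: ext_trans x6 _.
    by move=> i hk; rewrite y7// y6// y5// y04.
  - exact: rp_goto a6.
rewrite (negbTE hb) /= in r5; set s5 := goto s4 _ in r5.
have [i5 x5 y5] := post_goto k (o3 k off) i4.
have [t6 [s6 [b6 r6 p6 [i6 x6 y6] a6]]] := h2 _ _ _ _ _ _ hg l8 (erefl : pc s5 = o3 k off) i5 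
   (rp_goto _ a4) hb.
exists (1 + (t2 + (1 + 1)) + (1 + t6)), s6; split=> //.
- have -> : 1 + (t2 + (1 + 1)) + (1 + t6) = 4 + (t2 + t6) by lia.
  by do 2?apply: ltnW; apply: bound b6 _; rewrite leq_addl.
- by apply: reach_trans r04 _; apply: reach_trans r5 _.
- by rewrite p6 /= size_cat /= size_cat /= -/(k2 k off) /o3 /o2 /o1; lia.
- split=> //.
    by apply: ext_trans x04 _; apply: ext_trans x5 _.
  by move=> i hk; rewrite y6// y5// y04.
Qed.

Lemma cptP_cons A (rA : rtype R A) :
  cptP (fun g a => size a.2 < cB g) (fun (_ : ctx) (a : A * seq A) => a.1 :: a.2).
Proof.
apply: (@cptP_straight _ _ _ _ _ _ _ (ld2 ++ alloc2 11 12)) => // g s a hg hi ha hP.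
rewrite exs_cat; have [h1 [h2 h3]] := ld2P hi ha.
have [i1 _ _] := h1 0; have [[w1 w2]|hb] := alloc2_pair i1 h2 h3; last by case: hg; rewrite hb.
split; first by move=> k; apply: post_trans (h1 k) (@alloc2P _ _ _ 11 12 i1 isT isT k).
move: (exs (exs s ld2) _) (ireg _ _) w1 w2 => s2 w [/= q1 q2 [q3 q4]] q5.
by split.
Qed.

Definition ld22 : program := [:: IConst 12 1; IAdd 11 10 12; ILoad 11 11; IAdd 11 11 12; ILoad 11 11].

(** [G] is the environment, [A] the accumulator and [Y] the loop variable, whose word is zero
    exactly when the loop stops. Its measure decreases and is at most [B], so the time is at most
    that of the body times a power of [B]. *)
Lemma cpt_while G A Y (rG : rtype R G) (rA : rtype R A) (rY : rtype R Y)
    (emp : Y -> bool) (mu : Y -> nat) (b F : ctx -> G * (A * Y) -> G * (A * Y)) :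
  (forall g s w y, rp g s w y -> (w == 0) = emp y) ->
  (forall g v, ~~ emp v.2.2 -> mu (b g v).2.2 < mu v.2.2) ->
  (forall g v, F g v = if emp v.2.2 then v else F g (b g v)) ->
  cptP (fun g v => ~~ emp v.2.2) b -> cptP (fun g v => mu v.2.2 <= cB g) F.
Proof.
move=> he hd hF [e [c h]].
pose o1 off := (off + 5).+1; pose k1 k off := c k (o1 off).
pose o2 k off := (o1 off + size (k1 k off)).+1.
exists (16 + (e.+1)).+1, (fun k off => ld22 ++ JumpILe 11 9 (o2 k off) :: k1 k off ++ [:: Jump off]).
move=> k off p g s a hg /located_cat[l1 /located_cons[l2 /located_cat[l3 /located_cons[l4 _]]]] hs hi ha hmu.
suff : forall N (a : G * (A * Y)) (s : st), pc s = off -> mu a.2.2 < N -> inv g s ->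
   @rp R _ (rt_prod rG (rt_prod rA rY)) g s (ireg s 10) a ->
   exists t s', [/\ t <= N * (7 + cB g ^ e.+1), reach p t s s', pc s' = o2 k off, post g k s s' & 
     @rp R _ (rt_prod rG (rt_prod rA rY)) g s' (ireg s' 10) (F g a)].
  move=> H; have [|t [s' [q1 q2 q3 q4 q5]]] := H (mu a.2.2).+1 a s hs _ hi ha; first by [].
  exists t, s'; split=> //; last by rewrite q3 !size_cat /= /o2 /o1; rewrite size_cat /=; lia.
  apply: leq_trans q1 _; case: hg => hB _ _ _ _.
  apply: (@leq_trans ((cB g + cB g) * (7 + cB g ^ e.+1))).
    by rewrite leq_mul2r; apply/orP; right; move: hmu hB; set x := mu _; set y := cB g; lia.
  apply: (@leq_trans (cB g ^ 2 * (cB g ^ (8 + e.+1)))).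
    apply: leq_mul; first by rewrite addnn -mul2n -mulnn leq_mul2r hB orbT.
    exact: (@leB_add _ 7 _ _ 7 e _ hB (leB_cst 7 hB) (leqnn _)).
  by rewrite -expnD leq_exp2l//; lia.
elim=> // N IH {hmu}{}a {}s {}hs hN {}hi {}ha.
have [r1 p1] := reach_straight (isT : all straight ld22) l1 hs.
set s1 := exs s ld22 in r1 p1.
have [i1 x1 y1] : post g k s s1 by apply: post_scratch => //=; do 20?case=> //.
rewrite -p1 in l2; have r2 := reach_jumpI l2; rewrite p1 in r2.
have e9 : ireg s1 9 = 0 by case: i1.
have e11 : exists w, ireg s1 11 = w /\ rp g s w a.2.2.
  by case: ha => _ _ [_ _ ha]; eexists; split; [|exact: ha]; rewrite /= !addn1.
case: e11 => w [e11 hw]; rewrite e11 e9 leqn0 (he _ _ _ _ hw) in r2.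
rewrite hF; case: ifPn r2 => hb r2.
  set s2 := goto s1 _ in r2.
  have [i2 x2 y2] := post_goto k (o2 k off) i1.
  exists (5 + 1), s2; split=> //.
  - exact: reach_trans r1 r2.
  - by apply: rp_goto; apply: rp_ext x1 ha.
set s2 := goto s1 _ in r2.
have [i2 x2 y2] := post_goto k (o1 off) i1.
have a2 : rp g s2 (ireg s2 10) a by apply: rp_goto; apply: rp_ext x1 ha.
have [t3 [s3 [b3 r3 p3 [i3 x3 y3] a3]]] := h _ _ _ _ _ _ hg l3 (erefl : pc s2 = o1 off) i2 a2 hb.
rewrite -p3 in l4.
have r4 : reach p 1 s3 (goto s3 off) by apply: reach1 l4 _.
have [i4 x4 y4] := post_goto k off i3.
have hlt : mu (b g a).2.2 < N by apply: leq_trans (hd _ _ hb) _.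
have [t5 [s5 [b5 r5 p5 [i5 x5 y5] a5]]] := IH (b g a) (goto s3 off) erefl hlt i4 (rp_goto _ a3).
exists (5 + (1 + (t3 + (1 + t5)))), s5; split=> //.
- by rewrite mulSn; lia.
- exact: reach_trans r1 (reach_trans r2 (reach_trans r3 (reach_trans r4 r5))).
- split=> //; first exact: ext_trans x1 (ext_trans x2 (ext_trans x3 (ext_trans x4 x5))).
  by move=> i hk; rewrite y5// y4// y3// y2// y1.
Qed.

Lemma cptP_rp A B (rA : rtype R A) (rB : rtype R B) P (f : ctx -> A -> B) :
  cptP P f -> (forall g s w a, rp g s w a -> P g a) -> cpt f.
Proof.
move=> [e [c h]] hP; exists e, c => k off p g s a hg hl hs hi ha _.
by apply: h => //; apply: hP ha.
Qed.

Lemma cptP_comp A B C (rA : rtype R A) (rB : rtype R B) (rC : rtype R C) P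
    (h : ctx -> B -> C) (f : ctx -> A -> B) :
  cptP P h -> cpt f -> (forall g a, okg g -> P g (f g a)) -> cpt (fun g a => h g (f g a)).
Proof.
move=> [e1 [c1 h1]] [e2 [c2 h2]] hP.
exists (e2 + e1).+1, (fun k off => c2 k off ++ c1 k (off + size (c2 k off))).
move=> k off p g s a hg /located_cat[l1 l2] hs hi ha _.
have [t1 [s1 [b1 r1 p1 q1 a1]]] := h2 _ _ _ _ _ _ hg l1 hs hi ha I.
have [i1 x1 y1] := q1.
have [t2 [s2 [b2 r2 p2 q2 a2]]] := h1 _ _ _ _ _ _ hg l2 p1 i1 a1 (hP _ _ hg).
exists (t1 + t2), s2; split=> //.
- by apply: leB_add b1 b2 _ _ => //; case: hg.
- exact: reach_trans r1 r2.
- by rewrite p2 size_cat addnA.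
- exact: post_trans q1 q2.
Qed.

(* A nonempty list and the pair of its head and tail have the same representation. *)
Lemma cpt_uncons G A X (rG : rtype R G) (rA : rtype R A) (rX : rtype R X)
    (b : ctx -> G * (A * (X * seq X)) -> G * (A * seq X)) : cpt b ->
  cptP (fun g v => ~~ nilp v.2.2)
    (fun g (v : G * (A * seq X)) => if v.2.2 is x :: l then b g (v.1, (v.2.1, (x, l))) else v).
Proof.
move=> [e [c h]]; exists e, c => k off p g s [v1 [v2 [//|x l]]] hg hl hs hi ha _.
apply: h => //; case: ha => h1 h2 [h3 h4 [h5 [h6 h7 h8 h9]]].
by split=> //; split=> //; split=> //; split=> //; apply: ltnW.
Qed.

End Combinators.

(** * Composition rules for expressions with an environment *)

Section Lifted.
Variable R : realType.
Notation st := (state R).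
Notation ctx := (ctx R).
Context {G : Type} {rG : rtype R G}.

Lemma cpt_fst A B (rA : rtype R A) (rB : rtype R B) (f : ctx -> G -> A * B) :
  cpt f -> cpt (fun g x => (f g x).1).
Proof. by move=> h; apply: (cpt_comp (cpt_fst0 rA rB) h). Qed.

Lemma cpt_snd A B (rA : rtype R A) (rB : rtype R B) (f : ctx -> G -> A * B) :
  cpt f -> cpt (fun g x => (f g x).2).
Proof. by move=> h; apply: (cpt_comp (cpt_snd0 rA rB) h). Qed.

Lemma cpt_op2 A B C (rA : rtype R A) (rB : rtype R B) (rC : rtype R C)
    (h : ctx -> A -> B -> C) (f1 : ctx -> G -> A) (f2 : ctx -> G -> B) :
  cpt (fun g (a : A * B) => h g a.1 a.2) -> cpt f1 -> cpt f2 ->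
  cpt (fun g x => h g (f1 g x) (f2 g x)).
Proof. by move=> h0 h1 h2; apply: (cpt_comp h0 (cpt_pair h1 h2)). Qed.

Implicit Types (f h : ctx -> G -> nat) (b c : ctx -> G -> bool) (r q : ctx -> G -> R).

Lemma cpt_addn f h : cpt f -> cpt h -> cpt (fun g x => f g x + h g x).
Proof. exact: (cpt_op2 (h := fun _ => addn)) (cpt_addn0 R). Qed.

Lemma cpt_subn f h : cpt f -> cpt h -> cpt (fun g x => f g x - h g x).
Proof. exact: (cpt_op2 (h := fun _ => subn)) (cpt_subn0 R). Qed.

Lemma cpt_leq f h : cpt f -> cpt h -> cpt (fun g x => f g x <= h g x).
Proof. exact: (cpt_op2 (h := fun _ => leq)) (cpt_leq0 R). Qed.

Lemma cpt_succn f : cpt f -> cpt (fun g x => (f g x).+1).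
Proof.
move=> hf; apply: (cptP_ext (cpt_addn hf (cpt_const _ 1))) => g s w a _ _ _.
by rewrite addn1.
Qed.

Lemma cpt_predn f : cpt f -> cpt (fun g x => (f g x).-1).
Proof.
move=> hf; apply: (cptP_ext (cpt_subn hf (cpt_const _ 1))) => g s w a _ _ _.
by rewrite subn1.
Qed.

Lemma cpt_if A (rA : rtype R A) b (x1 x2 : ctx -> G -> A) :
  cpt b -> cpt x1 -> cpt x2 -> cpt (fun g x => if b g x then x1 g x else x2 g x).
Proof.
by move=> h1 h2 h3; apply: cptP_if => //; [apply: cptP_sub h2 _ | apply: cptP_sub h3 _].
Qed.

Lemma cpt_andb b c : cpt b -> cpt c -> cpt (fun g x => b g x && c g x).
Proof. by move=> h1 h2; apply: (cpt_if h1 h2 (cpt_bool _ false)). Qed.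

Lemma cpt_orb b c : cpt b -> cpt c -> cpt (fun g x => b g x || c g x).
Proof. by move=> h1 h2; apply: (cpt_if h1 (cpt_bool _ true) h2). Qed.

Lemma cpt_negb b : cpt b -> cpt (fun g x => ~~ b g x).
Proof. by move=> h1; apply: (cpt_if h1 (cpt_bool _ false) (cpt_bool _ true)). Qed.

Lemma cpt_eqn f h : cpt f -> cpt h -> cpt (fun g x => f g x == h g x).
Proof.
move=> h1 h2.
apply: (cptP_ext (cpt_andb (cpt_leq h1 h2) (cpt_leq h2 h1))) => g s w a _ _ _.
by rewrite eqn_leq.
Qed.

Lemma cpt_eqb b c : cpt b -> cpt c -> cpt (fun g x => b g x == c g x).
Proof.
move=> h1 h2; apply: (cptP_ext (cpt_if h1 h2 (cpt_negb h2))) => g s w a _ _ _.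
by case: (b g a) (c g a) => -[].
Qed.

Lemma cpt_addR r q : cpt r -> cpt q -> cpt (fun g x => r g x + q g x)%R.
Proof. move=> h1 h2; exact (cpt_op2 (h := fun _ (a b : R) => (a + b)%R) (cpt_addR0 R) h1 h2). Qed.

Lemma cpt_mulR r q : cpt r -> cpt q -> cpt (fun g x => r g x * q g x)%R.
Proof. move=> h1 h2; exact (cpt_op2 (h := fun _ (a b : R) => (a * b)%R) (cpt_mulR0 R) h1 h2). Qed.

Lemma cpt_divR r q : cpt r -> cpt q -> cpt (fun g x => r g x / q g x)%R.
Proof. move=> h1 h2; exact (cpt_op2 (h := fun _ (a b : R) => (a / b)%R) (cpt_divR0 R) h1 h2). Qed.

Lemma cpt_leR r q : cpt r -> cpt q -> cpt (fun g x => r g x <= q g x)%R.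
Proof. move=> h1 h2; exact (cpt_op2 (h := fun _ (a b : R) => (a <= b)%R) (cpt_leR0 R) h1 h2). Qed.

Lemma cpt_ltR r q : cpt r -> cpt q -> cpt (fun g x => r g x < q g x)%R.
Proof.
move=> h1 h2; apply: (cptP_ext (cpt_negb (cpt_leR h2 h1))) => g s w a _ _ _.
by rewrite -real_ltNge// num_real.
Qed.

Lemma cpt_natR f : cpt f -> cpt (fun g x => (f g x)%:R : R).
Proof. by move=> hf; apply: (cpt_comp (cpt_natR0 R) hf). Qed.

Lemma cpt_rnat n : cpt (fun (_ : ctx) (_ : G) => n%:R : R).
Proof. exact: (cpt_natR (cpt_const _ n)). Qed.

Lemma cpt_R0 : cpt (fun (_ : ctx) (_ : G) => 0%R : R). Proof. exact: (cpt_rnat 0). Qed.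
Lemma cpt_R1 : cpt (fun (_ : ctx) (_ : G) => 1%R : R). Proof. exact: (cpt_rnat 1). Qed.
Lemma cpt_cn : cpt (fun g (_ : G) => cn g). Proof. exact: (@cpt_cst _ _ _ 0). Qed.
Lemma cpt_cl : cpt (fun g (_ : G) => cl g). Proof. exact: (@cpt_cst _ _ _ 1). Qed.
Lemma cpt_ck : cpt (fun g (_ : G) => ck g). Proof. exact: (@cpt_cst _ _ _ 2). Qed.
Lemma cpt_cB : cpt (fun g (_ : G) => cB g). Proof. exact: (@cpt_cst _ _ _ 3). Qed.
Lemma cpt_cz : cpt (fun g (_ : G) => cz g). Proof. exact: (@cpt_cst _ _ _ 4). Qed.
Lemma cpt_cQ : cpt (fun g (_ : G) => cQ g). Proof. exact: (@cpt_cst _ _ _ 5). Qed.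
Lemma cpt_cM : cpt (fun g (_ : G) => cM g). Proof. exact: (@cpt_cst _ _ _ 6). Qed.
Lemma cpt_cD : cpt (fun g (_ : G) => cD g). Proof. exact: (@cpt_cst _ _ _ 7). Qed.

End Lifted.

Ltac cpt_proj := lazymatch goal with
 | |- @cpt _ _ _ _ _ (fun g x => fst (@?f g x)) => refine (cpt_fst (f := f) _)
 | |- @cpt _ _ _ _ _ (fun g x => snd (@?f g x)) => refine (cpt_snd (f := f) _)
 | |- @cpt _ _ _ _ _ (fun g x => (@?f g x, @?h g x)) => refine (cpt_pair (f1 := f) (f2 := h) _ _)
 end.
Ltac cpt_step := first
 [ assumption | cpt_proj
 | apply cpt_id | apply cpt_const | apply cpt_bool | apply cpt_nil | apply cpt_rnat
 | apply cpt_R0 | apply cpt_R1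
 | apply cpt_cn | apply cpt_cl | apply cpt_ck | apply cpt_cB | apply cpt_cz
 | apply cpt_cQ | apply cpt_cM | apply cpt_cD
 | apply cpt_addn | apply cpt_subn | apply cpt_eqn | apply cpt_eqb
 | apply cpt_leq | apply cpt_succn | apply cpt_predn
 | apply cpt_andb | apply cpt_orb | apply cpt_negb
 | apply cpt_addR | apply cpt_divR | apply cpt_mulR | apply cpt_leR | apply cpt_ltR
 | apply cpt_natR | apply cpt_if ].
Ltac cpt_auto := repeat cpt_step.

(** * Loops over lists and over bounded numbers *)

Section Lists.
Variable R : realType.
Notation st := (state R).
Notation ctx := (ctx R).

Fixpoint down A (h : nat -> A -> A) N z := if N is N'.+1 then down h N' (h N' z) else z.

Section Core.
Context {G A X Y : Type} {rG : rtype R G} {rA : rtype R A} {rX : rtype R X} {rY : rtype R Y}.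

Lemma cpt_foldl0 (h : ctx -> (G * A) * X -> A) : cpt h ->
  cpt (fun g (v : G * (A * seq X)) => foldl (fun z x => h g ((v.1, z), x)) v.2.1 v.2.2).
Proof.
move=> hh.
pose b g (v : G * (A * (X * seq X))) := (v.1, (h g ((v.1, v.2.1), v.2.2.1), v.2.2.2)).
have cb : cpt b.
  have ch : cpt (fun g (v : G * (A * (X * seq X))) => h g ((v.1, v.2.1), v.2.2.1)).
    by apply: (cpt_comp hh); cpt_auto.
  by rewrite /b; cpt_auto.
pose F g (v : G * (A * seq X)) :=
  (v.1, (foldl (fun z x => h g ((v.1, z), x)) v.2.1 v.2.2, [::] : seq X)).
have cF : cpt F; last by apply: (cpt_fst (f := fun g v => (F g v).2)); apply: cpt_snd.
refine (@cptP_rp _ _ _ _ _ (fun g v => size v.2.2 <= cB g) F _ _).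
  apply: (@cpt_while _ _ _ _ _ _ _ (fun s => nilp s) (fun s => size s)
    (fun g v => if v.2.2 is x :: l then b g (v.1, (v.2.1, (x, l))) else v)).
  - by move=> g s w [|x l] [_] => [->//|[h1 _ _ _]]; rewrite gtn_eqF.
  - by move=> g [v1 [v2 [|x l]]].
  - by move=> g [v1 [v2 [|x l]]].
  - exact: cpt_uncons.
by move=> g s w v [_ _ [_ _ []]].
Qed.

Lemma cpt_down0 (h : ctx -> (G * A) * nat -> A) : cpt h ->
  cpt (fun g (v : G * (A * nat)) =>
    down (fun i z => h g ((v.1, z), i)) (minn v.2.2 (cB g)) v.2.1).
Proof.
move=> hh.
pose b g (v : G * (A * nat)) := (v.1, (h g ((v.1, v.2.1), v.2.2.-1), v.2.2.-1)).
have cb : cpt b.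
  have ch : cpt (fun g (v : G * (A * nat)) => h g ((v.1, v.2.1), v.2.2.-1)).
    by apply: (cpt_comp hh); cpt_auto.
  by rewrite /b; cpt_auto.
pose F g (v : G * (A * nat)) := (v.1, (down (fun i z => h g ((v.1, z), i)) v.2.2 v.2.1, 0)).
have cF : cptP (fun g v => v.2.2 <= cB g) F.
  apply: (@cpt_while _ _ _ _ _ _ _ (fun n => n == 0) (fun n => n) b).
  - by move=> g s w n ->.
  - by move=> g [v1 [v2 []]]// n _ /=.
  - by move=> g [v1 [v2 []]].
  - exact: cptP_sub cb _.
apply: (@cptP_ext _ _ _ _ _ _ (fun g v => (F g (v.1, (v.2.1, minn v.2.2 (cB g)))).2.1)) => //.
apply: cpt_fst; apply: cpt_snd; apply: (cptP_comp cF); last by move=> *; apply: geq_minr.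
have cm : cpt (fun g (v : G * (A * nat)) => minn v.2.2 (cB g)).
  have : cpt (fun g (v : G * (A * nat)) => if v.2.2 < cB g then v.2.2 else cB g) by cpt_auto.
  exact.
by cpt_auto.
Qed.

(* Lists are kept of length at most [B], which bounds the time of every loop. *)
Definition tcons T B (x : T) s := if size s < B then x :: s else s.

End Core.

Lemma cpt_foldl G A X (rG : rtype R G) (rA : rtype R A) (rX : rtype R X)
    (h : ctx -> G -> A -> X -> A) (z : ctx -> G -> A) (s : ctx -> G -> seq X) :
  cpt (fun g (v : (G * A) * X) => h g v.1.1 v.1.2 v.2) -> cpt z -> cpt s ->
  cpt (fun g x => foldl (h g x) (z g x) (s g x)).
Proof.
move=> h1 h2 h3.
by apply: (cpt_comp (cpt_foldl0 h1) (f := fun g x => (x, (z g x, s g x)))); cpt_auto.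
Qed.

Lemma cpt_down G A (rG : rtype R G) (rA : rtype R A)
    (h : ctx -> G -> nat -> A -> A) (z : ctx -> G -> A) (N : ctx -> G -> nat) :
  cpt (fun g (v : (G * A) * nat) => h g v.1.1 v.2 v.1.2) -> cpt z -> cpt N ->
  cpt (fun g x => down (h g x) (minn (N g x) (cB g)) (z g x)).
Proof.
move=> h1 h2 h3.
by apply: (cpt_comp (cpt_down0 h1) (f := fun g x => (x, (z g x, N g x)))); cpt_auto.
Qed.

Lemma cpt_size G X (rG : rtype R G) (rX : rtype R X) (s : ctx -> G -> seq X) :
  cpt s -> cpt (fun g x => size (s g x)).
Proof.
move=> h.
apply: (cptP_ext (f := fun g x => foldl (fun n _ => n.+1) 0 (s g x))).
  by apply: cpt_foldl; cpt_auto.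
move=> g _ _ a _ _ _; rewrite -[RHS]addn0; elim: (s g a) 0 => //= _ l IH n.
by rewrite IH addnS.
Qed.

Lemma cpt_tcons G X (rG : rtype R G) (rX : rtype R X) (x : ctx -> G -> X) (s : ctx -> G -> seq X) :
  cpt x -> cpt s -> cpt (fun g v => tcons (cB g) (x g v) (s g v)).
Proof.
move=> h1 h2.
apply: (cpt_comp (h := fun g (a : X * seq X) => tcons (cB g) a.1 a.2)
  (f := fun g v => (x g v, s g v))); last exact: cpt_pair.
apply: cptP_if.
- by apply: cpt_leq; [apply: cpt_succn; apply: cpt_size|]; cpt_auto.
- exact: cptP_cons.
- by apply: (cptP_sub (cpt_snd0 _ _)).
Qed.

Definition iotaB B N := down (tcons B) (minn N B) [::].

Lemma iotaBE B N : iotaB B N = iota 0 (minn N B).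
Proof.
suff H n m : n + m <= B -> down (tcons B) n (iota n m) = iota 0 (n + m).
  by have := H (minn N B) 0; rewrite addn0; apply; apply: geq_minr.
elim: n m => //= n IH m hm.
rewrite /tcons size_iota (leq_trans _ hm) ?addSn ?ltnS ?leq_addl//.
by rewrite -[n :: iota n.+1 m]/(iota n m.+1) IH addnS// -addSn.
Qed.

Lemma iotaB_id B N : N <= B -> iotaB B N = iota 0 N.
Proof. by move=> h; rewrite iotaBE (minn_idPl h). Qed.

Section More.
Context {G X : Type} {rG : rtype R G} {rX : rtype R X}.

Lemma cpt_iotaB (N : ctx -> G -> nat) : cpt N -> cpt (fun g x => iotaB (cB g) (N g x)).
Proof. by move=> h; apply: cpt_down => //; [apply: cpt_tcons|]; cpt_auto. Qed.

Lemma cpt_rev (s : ctx -> G -> seq X) : cpt s -> cpt (fun g x => rev (s g x)).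
Proof.
move=> h; apply: (cpt_comp (h := fun _ => rev)) => //.
apply: (cptP_ext (f := fun g s => foldl (fun z x => tcons (cB g) x z) [::] s)).
  by apply: cpt_foldl; [apply: cpt_tcons| |]; cpt_auto.
move=> g _ _ a _ [hs _] _; rewrite /rev.
have : size a + size ([::] : seq X) <= cB g by rewrite addn0.
elim: a [::] {hs} => //= x l IH z hz.
by rewrite /tcons (leq_trans _ hz) ?addSn ?ltnS ?leq_addl// IH//= addnS -addSn.
Qed.

End More.

Section Seqs.
Context {G X : Type} {rG : rtype R G} {rX : rtype R X}.

(** The result is accumulated in reverse by [tcons] and then reversed. Nothing is truncated, since
    it is no longer than the given list, whose representation bounds its length by [B]. *)
Lemma cpt_pmap Y (rY : rtype R Y) (f : ctx -> G -> X -> Y) (b : ctx -> G -> X -> bool)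
    (s : ctx -> G -> seq X) :
  cpt (fun g (v : G * X) => f g v.1 v.2) -> cpt (fun g (v : G * X) => b g v.1 v.2) ->
  cpt s -> cpt (fun g x => [seq f g x y | y <- s g x & b g x y]).
Proof.
move=> h1 h2 h3.
apply: (cpt_comp (h := fun g (v : G * seq X) => [seq f g v.1 y | y <- v.2 & b g v.1 y])
  (f := fun g x => (x, s g x))); last by cpt_auto.
apply: (cptP_ext (f := fun g (v : G * seq X) =>
  rev (foldl (fun z x => if b g v.1 x then tcons (cB g) (f g v.1 x) z else z) [::] v.2))).
  apply: cpt_rev; apply: cpt_foldl; [apply: cpt_if; [|apply: cpt_tcons|] | |]; last first.
  - by cpt_auto.
  - by cpt_auto.
  - by cpt_auto.
  - by cpt_auto.
  - by apply: (cpt_comp h1 (f := fun g v => (v.1.1.1, v.2))); cpt_auto.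
  - by apply: (cpt_comp h2 (f := fun g v => (v.1.1.1, v.2))); cpt_auto.
move=> g _ _ [a l] _ [_ _ [/= hs _]] _.
have : size l + size ([::] : seq Y) <= cB g by rewrite addn0.
rewrite -[RHS](cat0s) -[X in _ = X ++ _]/(rev (@nil Y)).
elim: l [::] {hs} => [|x l IH] z /= hz; first by rewrite cats0.
case: ifP => hb; last by apply: IH; apply: leq_trans hz; rewrite addSn.
rewrite /tcons (leq_trans _ hz) ?addSn ?ltnS ?leq_addl// IH//=.
  by rewrite rev_cons cat_rcons.
by rewrite addnS -addSn.
Qed.

Lemma cpt_map Y (rY : rtype R Y) (f : ctx -> G -> X -> Y) (s : ctx -> G -> seq X) :
  cpt (fun g (v : G * X) => f g v.1 v.2) -> cpt s -> cpt (fun g x => [seq f g x y | y <- s g x]).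
Proof.
move=> h1 h2.
apply: (cptP_ext (f := fun g x => [seq f g x y | y <- s g x & (fun _ _ _ => true) g x y])).
  by apply: cpt_pmap => //; cpt_auto.
by move=> g _ _ a _ _ _; rewrite filter_predT.
Qed.

Lemma cpt_filter (b : ctx -> G -> X -> bool) (s : ctx -> G -> seq X) :
  cpt (fun g (v : G * X) => b g v.1 v.2) -> cpt s -> cpt (fun g x => [seq y <- s g x | b g x y]).
Proof.
move=> h1 h2.
apply: (cptP_ext (f := fun g x => [seq (fun _ _ z => z) g x y | y <- s g x & b g x y])).
  by apply: cpt_pmap => //; cpt_auto.
by move=> g _ _ a _ _ _; rewrite map_id.
Qed.

Lemma cpt_all (b : ctx -> G -> X -> bool) (s : ctx -> G -> seq X) :
  cpt (fun g (v : G * X) => b g v.1 v.2) -> cpt s -> cpt (fun g x => all (b g x) (s g x)).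
Proof.
move=> h1 h2.
apply: (cptP_ext (f := fun g x => foldl (fun z y => z && b g x y) true (s g x))).
  apply: cpt_foldl => //; last by cpt_auto.
  apply: cpt_andb; first by cpt_auto.
  by apply: (cpt_comp h1 (f := fun g v => (v.1.1, v.2))); cpt_auto.
move=> g _ _ a _ _ _; rewrite -[RHS]andTb; elim: (s g a) true => /= [|x l IH] z.
  by rewrite andbT.
by rewrite IH andbA.
Qed.

Lemma cpt_has (b : ctx -> G -> X -> bool) (s : ctx -> G -> seq X) :
  cpt (fun g (v : G * X) => b g v.1 v.2) -> cpt s -> cpt (fun g x => has (b g x) (s g x)).
Proof.
move=> h1 h2.
apply: (cptP_ext (f := fun g x => ~~ all (fun y => ~~ b g x y) (s g x))).
  by apply: cpt_negb; apply: cpt_all => //; apply: cpt_negb.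
by move=> g _ _ a _ _ _; rewrite -has_predC; apply: eq_has => y; rewrite /= negbK.
Qed.

Lemma cpt_nth (d : ctx -> G -> X) (s : ctx -> G -> seq X) (i : ctx -> G -> nat) :
  cpt d -> cpt s -> cpt i -> cpt (fun g x => nth (d g x) (s g x) (i g x)).
Proof.
move=> h1 h2 h3.
apply: (cptP_ext (f := fun g x => (foldl (fun z y => (z.1.+1, if z.1 == i g x then y else z.2))
  (0, d g x) (s g x)).2)).
  apply: cpt_snd; apply: cpt_foldl => //; last by cpt_auto.
  cpt_auto.
  by apply: (cpt_comp h3 (f := fun g v => v.1.1)); cpt_auto.
move=> g _ _ a _ _ _; set F := fun _ _ => _.
have FE n z x : F (n, z) x = (n.+1, if n == i g a then x else z) by [].
have H l n z : i g a < n -> (foldl F (n, z) l).2 = z.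
  by elim: l n z => //= x l IH n z hn; rewrite FE IH ?(leqW hn)// gtn_eqF.
rewrite -[i g a in RHS]subn0; have : 0 <= i g a by [].
elim: (s g a) 0 => [|x l IH] n hn /=; first by rewrite nth_nil.
rewrite FE; move: hn; rewrite leq_eqVlt => /orP[/eqP hn|hn].
  by rewrite -hn eqxx subnn H//= hn.
rewrite ltn_eqF// IH//; have -> : i g a - n = (i g a - n.+1).+1 by lia.
by [].
Qed.

End Seqs.

End Lists.

(** * Access to the input *)

Section Input.
Variable R : realType.
Notation ctx := (ctx R).

Lemma cptP_cim : cptP (fun g a => a < base g) (fun (g : ctx) a => cim g a).
Proof.
apply: (@cptP_straight _ _ _ _ _ _ _ [:: ILoad 10 10]) => // g s a hg hi ha hP.
split; first by apply: post_scratch => //=; do 20?case=> //.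
by rewrite /rp /= (ha : _ = _); case: hi => _ _ _ h; case: (h _ hP).
Qed.

Lemma cptP_crm : cptP (fun g a => a < base g) (fun (g : ctx) a => crm g a).
Proof.
apply: (@cptP_straight _ _ _ _ _ _ _ (RLoad 0 10 :: allocR)) => // g s a hg hi ha hP.
rewrite -cat1s exs_cat; set s2 := exs s _.
have h4 : forall k, post g k s s2 by move=> k; apply: post_scratch.
have [i2 _ _] := h4 0; have [h5 h6] := allocRP i2.
split; first by move=> k; apply: post_trans (h4 k) (h5 k).
suff -> : crm g a = rreg s2 0 :> R by exact: h6.
by rewrite /= (ha : _ = _); case: hi => _ _ _ h; case: (h _ hP).
Qed.

(* Zero outside of the input, so that every read stays below [base]. *)
Definition gcode (g : ctx) x := if x < cn g then cim g x else 0.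
Definition gfac (g : ctx) x := if x < cn g then cim g (cn g + x) else 0.
Definition galpha (g : ctx) i : R := if i < cl g then crm g i else 0%R.
Definition gbeta (g : ctx) i : R := if i < cl g then crm g (cl g + i) else 0%R.
Definition gd (g : ctx) x y : R :=
  if (x < cn g) && (y < cn g) then crm g (cl g + cl g + (x * cn g + y)) else 0%R.

Section G.
Context {G : Type} {rG : rtype R G}.
Implicit Types (f h : ctx -> G -> nat) (b : ctx -> G -> bool).

Lemma cpt_cim b f : cpt b -> cpt f -> (forall g x, okg g -> b g x -> f g x < base g) ->
  cpt (fun g x => if b g x then cim g (f g x) else 0).
Proof.
move=> hb hf H.
apply: (cptP_ext (f := fun g x => if b g x then cim g (if b g x then f g x else 0) else 0));
  last by move=> g _ _ a _ _ _; case: (b g a).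
apply: cpt_if; [exact: hb| |by cpt_auto].
apply: (cptP_comp cptP_cim); first by cpt_auto.
by move=> g a hg; case: ifP => // hba; [apply: H | case: hg].
Qed.

Lemma cpt_crm b f : cpt b -> cpt f -> (forall g x, okg g -> b g x -> f g x < base g) ->
  cpt (fun g x => if b g x then crm g (f g x) else 0%R).
Proof.
move=> hb hf H.
apply: (cptP_ext (f := fun g x => if b g x then crm g (if b g x then f g x else 0) else 0%R));
  last by move=> g _ _ a _ _ _; case: (b g a).
apply: cpt_if; [exact: hb| |by cpt_auto].
apply: (cptP_comp cptP_crm); first by cpt_auto.
by move=> g a hg; case: ifP => // hba; [apply: H | case: hg].
Qed.

Lemma cpt_gcode f : cpt f -> cpt (fun g x => gcode g (f g x)).
Proof. by move=> h; apply: cpt_cim; cpt_auto => g x [h1 h2 h3 h4 [h5 h6 h7 h8 h9]] hb; lia. Qed.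

Lemma cpt_gfac f : cpt f -> cpt (fun g x => gfac g (f g x)).
Proof. by move=> h; apply: cpt_cim; cpt_auto => g x [h1 h2 h3 h4 [h5 h6 h7 h8 h9]] hb; lia. Qed.

Lemma cpt_galpha f : cpt f -> cpt (fun g x => galpha g (f g x)).
Proof. by move=> h; apply: cpt_crm; cpt_auto => g x [h1 h2 h3 h4 [h5 h6 h7 h8 h9]] hb; lia. Qed.

Lemma cpt_gbeta f : cpt f -> cpt (fun g x => gbeta g (f g x)).
Proof. by move=> h; apply: cpt_crm; cpt_auto => g x [h1 h2 h3 h4 [h5 h6 h7 h8 h9]] hb; lia. Qed.

(** The machine has no integer multiplication, but the first factor is below [n < B], so repeated
    addition is affordable. *)
Lemma cpt_muln f h : cpt f -> cpt h ->
  cpt (fun g x => if f g x < cn g then f g x * h g x else 0).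
Proof.
move=> h1 h2.
apply: (cptP_ext (f := fun g x => if f g x < cn g then
  foldl (fun z _ => z + h g x) 0 (iotaB (cB g) (f g x)) else 0)).
  apply: cpt_if; [by cpt_auto| |by cpt_auto].
  apply: cpt_foldl; [apply: cpt_addn; first by cpt_auto| by cpt_auto |exact: cpt_iotaB].
  by apply: (cpt_comp h2 (f := fun g v => v.1.1)); cpt_auto.
move=> g _ _ a [_ _ hn _ _] _ _; case: ifP => // hx.
rewrite iotaB_id ?(ltnW (ltn_trans hx _))//.
suff H (s : seq nat) z : foldl (fun z _ => z + h g a) z s = z + size s * h g a.
  by rewrite H size_iota add0n.
by elim: s z => [|y s IH] z /=; rewrite ?mul0n ?addn0// IH mulSn addnA.
Qed.

Lemma cpt_gd f h : cpt f -> cpt h -> cpt (fun g x => gd g (f g x) (h g x)).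
Proof.
move=> h1 h2.
apply: (cptP_ext (f := fun g x => if (f g x < cn g) && (h g x < cn g) then
  crm g (cl g + cl g + ((if f g x < cn g then f g x * cn g else 0) + h g x)) else 0%R)).
  apply: cpt_crm; first by cpt_auto.
    apply: cpt_addn; first by cpt_auto.
    by apply: cpt_addn => //; apply: cpt_muln => //; cpt_auto.
  move=> g x [_ _ _ h3 _] /andP[h4 h5]; rewrite h4; apply: leq_trans h3.
  rewrite ltn_add2l; move: h4 h5; set n := cn g; set a := f g x; set c := h g x => h4 h5.
  by apply: (@leq_trans (a.+1 * n)); rewrite ?leq_mul2r ?h4 ?orbT// mulSn addnC ltn_add2r.
by move=> g _ _ a _ _ _; rewrite /gd; case: ifP => // /andP[->].
Qed.

End G.
End Input.

(** * The algorithm *)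

Section Algorithm.
Variable R : realType.
Notation ctx := (ctx R).

(* An entry [(((s, t), (k, raw)), (l, v))] describes a partial solution of cost at most [v] on the
   points at the positions [s, ..., t - 1] of an ordering, with at most [k] open facilities.  Row [n]
   of [l] tells where the clients are, and row [f] where the demands of the facility [f] are, one for
   each client of a prototype cluster: 0 means absent, [p.+1] a token located at the point [p] that
   still has to be connected.  Beyond [n] stand the tokens already connected, with [n.+1 + f] for a
   client connected to [f].  As long as [raw] holds, the single point of the entry is a facility whose
   prototype is under construction. *)
Definition entry := ((nat * nat) * (nat * bool) * (seq (seq nat) * R))%type.

Definition iot (g : ctx) N := iotaB (cB g) N.
Definition sumB (g : ctx) (f : nat -> nat) N := foldl (fun z i => z + f i) 0 (iot g N).

Definition net (g : ctx) (r : R) : seq nat :=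
  foldl (fun N x => if all (fun u => r < gd g u x + gd g u x)%R N then tcons (cB g) x N else N)
    [::] (iot g (cn g)).

(** [tcons] leaves the net in reverse order of insertion, so the fold, which keeps the last suitable
    member of the list, selects the first one of the greedy order. *)
Definition lab (g : ctx) (r s : R) x : nat :=
  foldl (fun z u => if (gd g u x <= s)%R then u else z) (cn g) (net g r).

(* One step of a radix sort: once it has been done for all radii in increasing order, the cells of
   each level are intervals. *)
Definition pass (g : ctx) (r s : R) (l : seq nat) : seq nat :=
  rev (foldl (fun z u =>
    foldl (fun z x => if lab g r s x == u then tcons (cB g) x z else z) z l) [::] (iot g (cn g))).

Definition rho (g : ctx) m : R := ((1 + m%:R / (cM g)%:R) / 2%:R)%R.

(** The inner fold computes [L / 2^z] by halving, as there is no power of reals; the radius then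
    doubles at each pass. With [cD = 3 z + 1] passes the last radius is [L 4^z]. *)
Definition order (g : ctx) (L : R) m : seq nat :=
  (foldl (fun st _ => (st.1 + st.1, pass g st.1 (rho g m * st.1) st.2)%R)
    (foldl (fun r _ => r / 2%:R)%R L (iot g (cz g)), iot g (cn g)) (iot g (cD g))).2.

Definition get (l : seq (seq nat)) a c := nth 0 (nth [::] l a) c.
Definition mk (g : ctx) (F : nat -> nat -> nat) : seq (seq nat) :=
  [seq [seq F a c | c <- iot g (cn g)] | a <- iot g (cn g).+1].
Definition upd (g : ctx) l a c v := mk g (fun a' c' => if (a' == a) && (c' == c) then v else get l a' c').

(* Tokens with the same key are interchangeable: this is what makes the table small. *)
Definition key (g : ctx) a c := gcode g c + (if a == cn g then 0 else (cl g).+1).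
Definition cnt (g : ctx) l k p :=
  sumB g (fun a => sumB g (fun c => if (get l a c == p.+1) && (key g a c == k) then 1 else 0)
    (cn g)) (cn g).+1.
Definition nkeys (g : ctx) := (cl g).+1 + (cl g).+1.
Definition same (g : ctx) (e f : entry) :=
  [&& e.1.1.1 == f.1.1.1, e.1.1.2 == f.1.1.2, e.1.2.1 == f.1.2.1, e.1.2.2 == f.1.2.2 &
   all (fun k => all (fun p => cnt g e.2.1 k p == cnt g f.2.1 k p) (iot g (cn g)))
     (iot g (nkeys g))].
Definition supp (g : ctx) l :=
  size [seq p <- iot g (cn g) | has (fun k => 0 < cnt g l k p) (iot g (nkeys g))].
(* The table keeps at most one entry for each signature, one of minimal cost, and only those whose
   unconnected tokens occupy at most [cQ g] points. *)
Definition ins (g : ctx) (T : seq entry) (be : bool * entry) : seq entry :=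
  if [&& be.1, supp g be.2.2.1 <= cQ g &
       all (fun x => ~~ same g be.2 x || (be.2.2.2 < x.2.2)%R) T]
  then tcons (cB g) be.2 [seq x <- T | ~~ same g be.2 x] else T.

Definition leafE (g : ctx) (o : seq nat) i (b : bool) : bool * entry :=
  (~~ b || (gfac g (nth 0 o i) != 0), (((i, i.+1), (nat_of_bool b, b)),
   (mk g (fun a c => if [&& a == cn g, c == nth 0 o i & gcode g c != 0] then (nth 0 o i).+1 else 0),
    0%R))).

(** A prototype is a set of clients of which only the types matter; the column [c] may be any client
    of the desired type, wherever it lies. Requiring a free column keeps the number of demands of a
    type within the number of clients of that type. *)
Definition addE (g : ctx) (o : seq nat) (e : entry) c : bool * entry :=
  ([&& e.1.2.2, get e.2.1 (nth 0 o e.1.1.1) c == 0 & gcode g c != 0],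
   (e.1, (upd g e.2.1 (nth 0 o e.1.1.1) c (nth 0 o e.1.1.1).+1, e.2.2))).

(** Applied to a raw entry, whose tokens are all at the facility [p], so the counts at [p] are those
    of the prototype. An empty prototype gives the quotient 0 and may be refused; nothing is lost,
    since a facility without clients can stay closed. *)
Definition fair (g : ctx) l p :=
  all (fun i => (galpha g i <= (cnt g l (i.+1 + (cl g).+1) p)%:R /
       (sumB g (fun j => cnt g l (j.+1 + (cl g).+1) p) (cl g))%:R)%R &&
     ((cnt g l (i.+1 + (cl g).+1) p)%:R /
       (sumB g (fun j => cnt g l (j.+1 + (cl g).+1) p) (cl g))%:R <= gbeta g i)%R) (iot g (cl g)).

Definition sealE (g : ctx) (o : seq nat) (e : entry) : bool * entry :=
  (e.1.2.2 && fair g e.2.1 (nth 0 o e.1.1.1), ((e.1.1, (e.1.2.1, false)), e.2)).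

Definition act (g : ctx) l a c := (0 < get l a c) && (get l a c <= cn g).

Definition moveE (g : ctx) (e : entry) a c y : bool * entry :=
  (~~ e.1.2.2 && act g e.2.1 a c,
   (e.1, (upd g e.2.1 a c y.+1, (e.2.2 + gd g (get e.2.1 a c).-1 y)%R))).

(* The facility of the demand need not be known to the signature: any token of the same type will do. *)
Definition connE (g : ctx) (e : entry) c f c' : bool * entry :=
  ([&& ~~ e.1.2.2, act g e.2.1 (cn g) c, act g e.2.1 f c' & gcode g c == gcode g c'],
   (e.1, (upd g (upd g e.2.1 (cn g) c ((cn g).+1 + f)) f c' (cn g).+1,
    (e.2.2 + gd g (get e.2.1 (cn g) c).-1 (get e.2.1 f c').-1)%R))).

Definition unionE (g : ctx) (e f : entry) : bool * entry :=
  ([&& ~~ e.1.2.2, ~~ f.1.2.2 & e.1.1.2 == f.1.1.1],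
   (((e.1.1.1, f.1.1.2), (e.1.2.1 + f.1.2.1, false)),
    (mk g (fun a c => get e.2.1 a c + get f.2.1 a c), (e.2.2 + f.2.2)%R))).

Definition for3 (g : ctx) (T : seq entry) N (F : nat -> nat -> nat -> bool * entry) :=
  foldl (fun T a => foldl (fun T c => foldl (fun T y => ins g T (F a c y))
    T (iot g (cn g))) T (iot g (cn g))) T (iot g N).

Definition step1 (g : ctx) o (T0 T : seq entry) (e : entry) :=
  foldl (fun T f => ins g T (unionE g e f))
    (for3 g (for3 g (foldl (fun T c => ins g T (addE g o e c)) (ins g T (sealE g o e)) (iot g (cn g)))
       (cn g).+1 (moveE g e)) (cn g) (connE g e)) T0.

Definition round (g : ctx) o T := foldl (step1 g o T) T T.

(** Each round applies every rule to every entry of the previous table. The closure argument uses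
    [rnds * (cD + 1)] rounds, and [cB] is at least that. *)
Definition close (g : ctx) o :=
  foldl (fun T _ => round g o T)
    (foldl (fun T i => ins g (ins g T (leafE g o i false)) (leafE g o i true)) [::] (iot g (cn g)))
    (iot g (cB g)).

Definition accept (g : ctx) (e : entry) :=
  [&& e.1.1.1 == 0, e.1.1.2 == cn g, e.1.2.1 <= ck g, ~~ e.1.2.2 &
   all (fun k => all (fun p => cnt g e.2.1 k p == 0) (iot g (cn g))) (iot g (nkeys g))].

Definition better (g : ctx) (b : bool * entry) (e : entry) :=
  if accept g e && (~~ b.1 || (e.2.2 < b.2.2.2)%R) then (true, e) else b.

Definition best (g : ctx) : bool * entry :=
  foldl (fun b x => foldl (fun b y => foldl (fun b m =>
      foldl (better g) b (close g (order g (gd g x y) m)))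
    b (iot g (cM g))) b (iot g (cn g)))
  (false, (((0, 0), (0, false)), ([::], 0%R))) (iot g (cn g)).

Definition answer (g : ctx) (e : entry) : seq nat :=
  [seq (if i < cn g then nat_of_bool (has (fun c => get e.2.1 i c != 0) (iot g (cn g)))
        else get e.2.1 (cn g) (i - cn g) - (cn g).+1) | i <- iot g (cn g + cn g)].

Definition main (g : ctx) := answer g (best g).2.

End Algorithm.

(** A hook that is redefined after each function of the algorithm, so that [cpt_go] treats the
    functions already handled as primitives. *)
Ltac cpt_user := fail.
Ltac cpt_step2 := cbv beta; first
  [ assumption | cpt_proj | cpt_user
  | lazymatch goal with
    | |- @cpt _ _ _ _ _ (fun g x => foldl (@?a1 g x) (@?a2 g x) (@?a3 g x)) => refine (cpt_foldl _ _ _)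
    | |- @cpt _ _ _ _ _ (fun g x => map (@?a1 g x) (@?a2 g x)) => refine (cpt_map _ _)
    | |- @cpt _ _ _ _ _ (fun g x => filter (@?a1 g x) (@?a2 g x)) => refine (cpt_filter _ _)
    | |- @cpt _ _ _ _ _ (fun g x => all (@?a1 g x) (@?a2 g x)) => refine (cpt_all _ _)
    | |- @cpt _ _ _ _ _ (fun g x => has (@?a1 g x) (@?a2 g x)) => refine (cpt_has _ _)
    | |- @cpt _ _ _ _ _ (fun g x => nth (@?a1 g x) (@?a2 g x) (@?a3 g x)) => refine (cpt_nth _ _ _)
    | |- @cpt _ _ _ _ _ (fun g x => size (@?a1 g x)) => refine (cpt_size _)
    | |- @cpt _ _ _ _ _ (fun g x => rev (@?a1 g x)) => refine (cpt_rev _)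
    | |- @cpt _ _ _ _ _ (fun g x => iot (@?a1 g x) (@?a2 g x)) => refine (cpt_iotaB _)
    | |- @cpt _ _ _ _ _ (fun g x => tcons (@?a1 g x) (@?a2 g x) (@?a3 g x)) => refine (cpt_tcons _ _)
    | |- @cpt _ _ _ _ _ (fun g x => gcode (@?a1 g x) (@?a2 g x)) => refine (cpt_gcode _)
    | |- @cpt _ _ _ _ _ (fun g x => gfac (@?a1 g x) (@?a2 g x)) => refine (cpt_gfac _)
    | |- @cpt _ _ _ _ _ (fun g x => galpha (@?a1 g x) (@?a2 g x)) => refine (cpt_galpha _)
    | |- @cpt _ _ _ _ _ (fun g x => gbeta (@?a1 g x) (@?a2 g x)) => refine (cpt_gbeta _)
    | |- @cpt _ _ _ _ _ (fun g x => gd (@?a1 g x) (@?a2 g x) (@?a3 g x)) => refine (cpt_gd _ _)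
    end
  | cpt_step ].
Ltac cpt_go := repeat cpt_step2.

Section Apply.
Variable R : realType.
Notation ctx := (ctx R).
Context {G : Type} {rG : rtype R G}.

Lemma cpt_op3 A B C D (rA : rtype R A) (rB : rtype R B) (rC : rtype R C) (rD : rtype R D)
    (h : ctx -> A -> B -> C -> D) (f1 : ctx -> G -> A) (f2 : ctx -> G -> B) (f3 : ctx -> G -> C) :
  cpt (fun g (a : (A * B) * C) => h g a.1.1 a.1.2 a.2) -> cpt f1 -> cpt f2 -> cpt f3 ->
  cpt (fun g x => h g (f1 g x) (f2 g x) (f3 g x)).
Proof.
move=> h0 h1 h2 h3.
by apply: (cpt_comp h0 (f := fun g x => (f1 g x, f2 g x, f3 g x))); cpt_auto.
Qed.

Lemma cpt_op4 A B C D E (rA : rtype R A) (rB : rtype R B) (rC : rtype R C) (rD : rtype R D)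
    (rE : rtype R E) (h : ctx -> A -> B -> C -> D -> E)
    (f1 : ctx -> G -> A) (f2 : ctx -> G -> B) (f3 : ctx -> G -> C) (f4 : ctx -> G -> D) :
  cpt (fun g (a : ((A * B) * C) * D) => h g a.1.1.1 a.1.1.2 a.1.2 a.2) ->
  cpt f1 -> cpt f2 -> cpt f3 -> cpt f4 ->
  cpt (fun g x => h g (f1 g x) (f2 g x) (f3 g x) (f4 g x)).
Proof.
move=> h0 h1 h2 h3 h4.
by apply: (cpt_comp h0 (f := fun g x => (f1 g x, f2 g x, f3 g x, f4 g x))); cpt_auto.
Qed.

End Apply.

(** * The algorithm as a function computed in time [B^O(1)] *)

Section Main.
Variable R : realType.
Notation ctx := (ctx R).
Notation entry := (entry R).

Lemma cpt_net G (rG : rtype R G) (f1 : ctx -> G -> R) : cpt f1 -> cpt (fun g x => net g (f1 g x)).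
Proof. move=> h1; apply: (cpt_comp (h := @net R)) => //; rewrite /net; cpt_go. Qed.

Ltac cpt_net_step := lazymatch goal with
    | |- @cpt _ _ _ _ _ (fun g x => net g (@?a1 g x)) => refine (cpt_net _)
    end.
Ltac cpt_user ::= cpt_net_step.

Lemma cpt_lab G (rG : rtype R G) (f1 : ctx -> G -> R) (f2 : ctx -> G -> R) (f3 : ctx -> G -> nat) : cpt f1 -> cpt f2 -> cpt f3 -> cpt (fun g x => lab g (f1 g x) (f2 g x) (f3 g x)).
Proof. move=> h1 h2 h3; apply: (cpt_op3 (h := @lab R)) => //; rewrite /lab; cpt_go. Qed.

Ltac cpt_lab_step := lazymatch goal with
    | |- @cpt _ _ _ _ _ (fun g x => lab g (@?a1 g x) (@?a2 g x) (@?a3 g x)) => refine (cpt_lab _ _ _)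
    | _ => cpt_net_step
    end.
Ltac cpt_user ::= cpt_lab_step.

Lemma cpt_pass G (rG : rtype R G) (f1 : ctx -> G -> R) (f2 : ctx -> G -> R) (f3 : ctx -> G -> (seq nat)) : cpt f1 -> cpt f2 -> cpt f3 -> cpt (fun g x => pass g (f1 g x) (f2 g x) (f3 g x)).
Proof. move=> h1 h2 h3; apply: (cpt_op3 (h := @pass R)) => //; rewrite /pass; cpt_go. Qed.

Ltac cpt_pass_step := lazymatch goal with
    | |- @cpt _ _ _ _ _ (fun g x => pass g (@?a1 g x) (@?a2 g x) (@?a3 g x)) => refine (cpt_pass _ _ _)
    | _ => cpt_lab_step
    end.
Ltac cpt_user ::= cpt_pass_step.

Lemma cpt_rho G (rG : rtype R G) (f1 : ctx -> G -> nat) : cpt f1 -> cpt (fun g x => rho g (f1 g x)).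
Proof. move=> h1; apply: (cpt_comp (h := @rho R)) => //; rewrite /rho; cpt_go. Qed.

Ltac cpt_rho_step := lazymatch goal with
    | |- @cpt _ _ _ _ _ (fun g x => rho g (@?a1 g x)) => refine (cpt_rho _)
    | _ => cpt_pass_step
    end.
Ltac cpt_user ::= cpt_rho_step.

Lemma cpt_order G (rG : rtype R G) (f1 : ctx -> G -> R) (f2 : ctx -> G -> nat) : cpt f1 -> cpt f2 -> cpt (fun g x => order g (f1 g x) (f2 g x)).
Proof. move=> h1 h2; apply: (cpt_op2 (h := @order R)) => //; rewrite /order; cpt_go. Qed.

Ltac cpt_order_step := lazymatch goal with
    | |- @cpt _ _ _ _ _ (fun g x => order g (@?a1 g x) (@?a2 g x)) => refine (cpt_order _ _)
    | _ => cpt_rho_step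
    end.
Ltac cpt_user ::= cpt_order_step.

Lemma cpt_key G (rG : rtype R G) (f1 : ctx -> G -> nat) (f2 : ctx -> G -> nat) : cpt f1 -> cpt f2 -> cpt (fun g x => key g (f1 g x) (f2 g x)).
Proof. move=> h1 h2; apply: (cpt_op2 (h := @key R)) => //; rewrite /key; cpt_go. Qed.

Ltac cpt_key_step := lazymatch goal with
    | |- @cpt _ _ _ _ _ (fun g x => key g (@?a1 g x) (@?a2 g x)) => refine (cpt_key _ _)
    | _ => cpt_order_step
    end.
Ltac cpt_user ::= cpt_key_step.

Lemma cpt_cnt G (rG : rtype R G) (f1 : ctx -> G -> (seq (seq nat))) (f2 : ctx -> G -> nat) (f3 : ctx -> G -> nat) : cpt f1 -> cpt f2 -> cpt f3 -> cpt (fun g x => cnt g (f1 g x) (f2 g x) (f3 g x)).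
Proof. move=> h1 h2 h3; apply: (cpt_op3 (h := @cnt R)) => //; rewrite /cnt /sumB /get; cpt_go. Qed.

Ltac cpt_cnt_step := lazymatch goal with
    | |- @cpt _ _ _ _ _ (fun g x => cnt g (@?a1 g x) (@?a2 g x) (@?a3 g x)) => refine (cpt_cnt _ _ _)
    | _ => cpt_key_step
    end.
Ltac cpt_user ::= cpt_cnt_step.

Lemma cpt_same G (rG : rtype R G) (f1 : ctx -> G -> entry) (f2 : ctx -> G -> entry) : cpt f1 -> cpt f2 -> cpt (fun g x => same g (f1 g x) (f2 g x)).
Proof. move=> h1 h2; apply: (cpt_op2 (h := @same R)) => //; rewrite /same /nkeys; cpt_go. Qed.

Ltac cpt_same_step := lazymatch goal with
    | |- @cpt _ _ _ _ _ (fun g x => same g (@?a1 g x) (@?a2 g x)) => refine (cpt_same _ _)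
    | _ => cpt_cnt_step
    end.
Ltac cpt_user ::= cpt_same_step.

Lemma cpt_supp G (rG : rtype R G) (f1 : ctx -> G -> (seq (seq nat))) : cpt f1 -> cpt (fun g x => supp g (f1 g x)).
Proof. move=> h1; apply: (cpt_comp (h := @supp R)) => //; rewrite /supp /nkeys; cpt_go. Qed.

Ltac cpt_supp_step := lazymatch goal with
    | |- @cpt _ _ _ _ _ (fun g x => supp g (@?a1 g x)) => refine (cpt_supp _)
    | _ => cpt_same_step
    end.
Ltac cpt_user ::= cpt_supp_step.

Lemma cpt_ins G (rG : rtype R G) (f1 : ctx -> G -> (seq entry)) (f2 : ctx -> G -> (bool * entry)) : cpt f1 -> cpt f2 -> cpt (fun g x => ins g (f1 g x) (f2 g x)).
Proof. move=> h1 h2; apply: (cpt_op2 (h := @ins R)) => //; rewrite /ins; cpt_go. Qed.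

Ltac cpt_ins_step := lazymatch goal with
    | |- @cpt _ _ _ _ _ (fun g x => ins g (@?a1 g x) (@?a2 g x)) => refine (cpt_ins _ _)
    | _ => cpt_supp_step
    end.
Ltac cpt_user ::= cpt_ins_step.

Lemma cpt_leafE G (rG : rtype R G) (f1 : ctx -> G -> (seq nat)) (f2 : ctx -> G -> nat) (f3 : ctx -> G -> bool) : cpt f1 -> cpt f2 -> cpt f3 -> cpt (fun g x => leafE g (f1 g x) (f2 g x) (f3 g x)).
Proof. move=> h1 h2 h3; apply: (cpt_op3 (h := @leafE R)) => //; rewrite /leafE /mk; cpt_go. Qed.

Ltac cpt_leafE_step := lazymatch goal with
    | |- @cpt _ _ _ _ _ (fun g x => leafE g (@?a1 g x) (@?a2 g x) (@?a3 g x)) => refine (cpt_leafE _ _ _)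
    | _ => cpt_ins_step
    end.
Ltac cpt_user ::= cpt_leafE_step.

Lemma cpt_addE G (rG : rtype R G) (f1 : ctx -> G -> (seq nat)) (f2 : ctx -> G -> entry) (f3 : ctx -> G -> nat) : cpt f1 -> cpt f2 -> cpt f3 -> cpt (fun g x => addE g (f1 g x) (f2 g x) (f3 g x)).
Proof. move=> h1 h2 h3; apply: (cpt_op3 (h := @addE R)) => //; rewrite /addE /upd /mk /get; cpt_go. Qed.

Ltac cpt_addE_step := lazymatch goal with
    | |- @cpt _ _ _ _ _ (fun g x => addE g (@?a1 g x) (@?a2 g x) (@?a3 g x)) => refine (cpt_addE _ _ _)
    | _ => cpt_leafE_step
    end.
Ltac cpt_user ::= cpt_addE_step.

Lemma cpt_fair G (rG : rtype R G) (f1 : ctx -> G -> (seq (seq nat))) (f2 : ctx -> G -> nat) : cpt f1 -> cpt f2 -> cpt (fun g x => fair g (f1 g x) (f2 g x)).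
Proof. move=> h1 h2; apply: (cpt_op2 (h := @fair R)) => //; rewrite /fair /sumB; cpt_go. Qed.

Ltac cpt_fair_step := lazymatch goal with
    | |- @cpt _ _ _ _ _ (fun g x => fair g (@?a1 g x) (@?a2 g x)) => refine (cpt_fair _ _)
    | _ => cpt_addE_step
    end.
Ltac cpt_user ::= cpt_fair_step.

Lemma cpt_sealE G (rG : rtype R G) (f1 : ctx -> G -> (seq nat)) (f2 : ctx -> G -> entry) : cpt f1 -> cpt f2 -> cpt (fun g x => sealE g (f1 g x) (f2 g x)).
Proof. move=> h1 h2; apply: (cpt_op2 (h := @sealE R)) => //; rewrite /sealE; cpt_go. Qed.

Ltac cpt_sealE_step := lazymatch goal with
    | |- @cpt _ _ _ _ _ (fun g x => sealE g (@?a1 g x) (@?a2 g x)) => refine (cpt_sealE _ _)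
    | _ => cpt_fair_step
    end.
Ltac cpt_user ::= cpt_sealE_step.

Lemma cpt_moveE G (rG : rtype R G) (f1 : ctx -> G -> entry) (f2 : ctx -> G -> nat) (f3 : ctx -> G -> nat) (f4 : ctx -> G -> nat) : cpt f1 -> cpt f2 -> cpt f3 -> cpt f4 -> cpt (fun g x => moveE g (f1 g x) (f2 g x) (f3 g x) (f4 g x)).
Proof. move=> h1 h2 h3 h4; apply: (cpt_op4 (h := @moveE R)) => //; rewrite /moveE /act /upd /mk /get; cpt_go. Qed.

Ltac cpt_moveE_step := lazymatch goal with
    | |- @cpt _ _ _ _ _ (fun g x => moveE g (@?a1 g x) (@?a2 g x) (@?a3 g x) (@?a4 g x)) => refine (cpt_moveE _ _ _ _)
    | _ => cpt_sealE_step
    end.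
Ltac cpt_user ::= cpt_moveE_step.

Lemma cpt_connE G (rG : rtype R G) (f1 : ctx -> G -> entry) (f2 : ctx -> G -> nat) (f3 : ctx -> G -> nat) (f4 : ctx -> G -> nat) : cpt f1 -> cpt f2 -> cpt f3 -> cpt f4 -> cpt (fun g x => connE g (f1 g x) (f2 g x) (f3 g x) (f4 g x)).
Proof. move=> h1 h2 h3 h4; apply: (cpt_op4 (h := @connE R)) => //; rewrite /connE /act /upd /mk /get; cpt_go. Qed.

Ltac cpt_connE_step := lazymatch goal with
    | |- @cpt _ _ _ _ _ (fun g x => connE g (@?a1 g x) (@?a2 g x) (@?a3 g x) (@?a4 g x)) => refine (cpt_connE _ _ _ _)
    | _ => cpt_moveE_step
    end.
Ltac cpt_user ::= cpt_connE_step.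

Lemma cpt_unionE G (rG : rtype R G) (f1 : ctx -> G -> entry) (f2 : ctx -> G -> entry) : cpt f1 -> cpt f2 -> cpt (fun g x => unionE g (f1 g x) (f2 g x)).
Proof. move=> h1 h2; apply: (cpt_op2 (h := @unionE R)) => //; rewrite /unionE /mk /get; cpt_go. Qed.

Ltac cpt_unionE_step := lazymatch goal with
    | |- @cpt _ _ _ _ _ (fun g x => unionE g (@?a1 g x) (@?a2 g x)) => refine (cpt_unionE _ _)
    | _ => cpt_connE_step
    end.
Ltac cpt_user ::= cpt_unionE_step.

Lemma cpt_step1 G (rG : rtype R G) (f1 : ctx -> G -> (seq nat)) (f2 : ctx -> G -> (seq entry)) (f3 : ctx -> G -> (seq entry)) (f4 : ctx -> G -> entry) : cpt f1 -> cpt f2 -> cpt f3 -> cpt f4 -> cpt (fun g x => step1 g (f1 g x) (f2 g x) (f3 g x) (f4 g x)).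
Proof. move=> h1 h2 h3 h4; apply: (cpt_op4 (h := @step1 R)) => //; rewrite /step1 /for3; cpt_go. Qed.

Ltac cpt_step1_step := lazymatch goal with
    | |- @cpt _ _ _ _ _ (fun g x => step1 g (@?a1 g x) (@?a2 g x) (@?a3 g x) (@?a4 g x)) => refine (cpt_step1 _ _ _ _)
    | _ => cpt_unionE_step
    end.
Ltac cpt_user ::= cpt_step1_step.

Lemma cpt_round G (rG : rtype R G) (f1 : ctx -> G -> (seq nat)) (f2 : ctx -> G -> (seq entry)) : cpt f1 -> cpt f2 -> cpt (fun g x => round g (f1 g x) (f2 g x)).
Proof. move=> h1 h2; apply: (cpt_op2 (h := @round R)) => //; rewrite /round; cpt_go. Qed.

Ltac cpt_round_step := lazymatch goal with
    | |- @cpt _ _ _ _ _ (fun g x => round g (@?a1 g x) (@?a2 g x)) => refine (cpt_round _ _)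
    | _ => cpt_step1_step
    end.
Ltac cpt_user ::= cpt_round_step.

Lemma cpt_close G (rG : rtype R G) (f1 : ctx -> G -> (seq nat)) : cpt f1 -> cpt (fun g x => close g (f1 g x)).
Proof. move=> h1; apply: (cpt_comp (h := @close R)) => //; rewrite /close; cpt_go. Qed.

Ltac cpt_close_step := lazymatch goal with
    | |- @cpt _ _ _ _ _ (fun g x => close g (@?a1 g x)) => refine (cpt_close _)
    | _ => cpt_round_step
    end.
Ltac cpt_user ::= cpt_close_step.

Lemma cpt_accept G (rG : rtype R G) (f1 : ctx -> G -> entry) : cpt f1 -> cpt (fun g x => accept g (f1 g x)).
Proof. move=> h1; apply: (cpt_comp (h := @accept R)) => //; rewrite /accept /nkeys; cpt_go. Qed.

Ltac cpt_accept_step := lazymatch goal with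
    | |- @cpt _ _ _ _ _ (fun g x => accept g (@?a1 g x)) => refine (cpt_accept _)
    | _ => cpt_close_step
    end.
Ltac cpt_user ::= cpt_accept_step.

Lemma cpt_better G (rG : rtype R G) (f1 : ctx -> G -> (bool * entry)) (f2 : ctx -> G -> entry) : cpt f1 -> cpt f2 -> cpt (fun g x => better g (f1 g x) (f2 g x)).
Proof. move=> h1 h2; apply: (cpt_op2 (h := @better R)) => //; rewrite /better; cpt_go. Qed.

Ltac cpt_better_step := lazymatch goal with
    | |- @cpt _ _ _ _ _ (fun g x => better g (@?a1 g x) (@?a2 g x)) => refine (cpt_better _ _)
    | _ => cpt_accept_step
    end.
Ltac cpt_user ::= cpt_better_step.

Lemma cpt_best G (rG : rtype R G) : cpt (fun g x => best g ).
Proof. rewrite /best; cpt_go. Qed.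

Ltac cpt_best_step := lazymatch goal with
    | |- @cpt _ _ _ _ _ (fun g x => best g ) => apply cpt_best
    | _ => cpt_better_step
    end.
Ltac cpt_user ::= cpt_best_step.

Lemma cpt_answer G (rG : rtype R G) (f1 : ctx -> G -> entry) : cpt f1 -> cpt (fun g x => answer g (f1 g x)).
Proof. move=> h1; apply: (cpt_comp (h := @answer R)) => //; rewrite /answer /get; cpt_go. Qed.

Ltac cpt_answer_step := lazymatch goal with
    | |- @cpt _ _ _ _ _ (fun g x => answer g (@?a1 g x)) => refine (cpt_answer _)
    | _ => cpt_best_step
    end.
Ltac cpt_user ::= cpt_answer_step.

Lemma cpt_main G (rG : rtype R G) : cpt (fun g x => main g ).
Proof. rewrite /main; cpt_go. Qed.

End Main.
(** * Tokens and signatures *)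

Section CellSums.
Variables (V : Type) (idx : V) (op : Monoid.com_law idx).
Variable n : nat.

Definition SF (h : nat -> nat -> nat -> V) (F : nat -> nat -> nat) : V :=
  \big[op/idx]_(a <- iota 0 n.+1) \big[op/idx]_(c <- iota 0 n) h a c (F a c).

Definition updF (F : nat -> nat -> nat) a c v a' c' := if (a' == a) && (c' == c) then v else F a' c'.

Lemma SF_eq h h' F F' : (forall a c, a <= n -> c < n -> h a c (F a c) = h' a c (F' a c)) ->
  SF h F = SF h' F'.
Proof.
move=> e; rewrite /SF; apply: eq_big_seq => a; rewrite mem_iota ltnS => ha.
by apply: eq_big_seq => c; rewrite mem_iota => hc; apply: e.
Qed.

Lemma SF_ext h F F' : (forall a c, a <= n -> c < n -> h a c (F a c) = h a c (F' a c)) ->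
  SF h F = SF h F'.
Proof. exact: SF_eq. Qed.

(** The replaced summand is added on the other side, because a general commutative monoid has no
    subtraction. *)
Lemma SF_upd h F a c v : a <= n -> c < n ->
  op (SF h (updF F a c v)) (h a c (F a c)) = op (SF h F) (h a c v).
Proof.
move=> ha hc; have ia : a \in iota 0 n.+1 by rewrite mem_iota.
have ic : c \in iota 0 n by rewrite mem_iota.
rewrite /SF !(bigD1_seq a ia (iota_uniq _ _)) /= !(bigD1_seq c ic (iota_uniq _ _)) /=.
have -> : \big[op/idx]_(i <- iota 0 n.+1 | i != a) \big[op/idx]_(c0 <- iota 0 n) h i c0 (updF F a c v i c0)
   = \big[op/idx]_(i <- iota 0 n.+1 | i != a) \big[op/idx]_(c0 <- iota 0 n) h i c0 (F i c0).
  by apply: eq_bigr => i hi; apply: eq_bigr => j _; rewrite /updF (negbTE hi).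
have -> : \big[op/idx]_(i <- iota 0 n | i != c) h a i (updF F a c v a i)
   = \big[op/idx]_(i <- iota 0 n | i != c) h a i (F a i).
  by apply: eq_bigr => i hi; rewrite /updF (negbTE hi) andbF.
rewrite {1}/updF !eqxx /=.
have AC x y u w : op (op (op x u) w) y = op (op (op y u) w) x.
  by rewrite (Monoid.mulmAC op _ w y) (Monoid.mulmAC op x u y) (Monoid.mulmC op x y)
    (Monoid.mulmAC op y x u) (Monoid.mulmAC op _ x w).
exact: AC.
Qed.

Lemma SF_add h F F' : (forall a c, h a c 0 = idx) ->
  (forall a c, a <= n -> c < n -> F a c = 0 \/ F' a c = 0) ->
  SF h (fun a c => F a c + F' a c) = op (SF h F) (SF h F').
Proof.
move=> h0 e; rewrite /SF -big_split; apply: eq_big_seq => a; rewrite mem_iota ltnS => ha.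
rewrite -big_split; apply: eq_big_seq => c; rewrite mem_iota => hc.
by case: (e a c ha hc) => ->; rewrite ?addn0 h0 ?Monoid.mulm1 ?Monoid.mul1m.
Qed.

Lemma SF_idx h F : (forall a c, a <= n -> c < n -> h a c (F a c) = idx) -> SF h F = idx.
Proof.
move=> e; apply: big1_seq => a /andP[_]; rewrite mem_iota ltnS => ha.
by apply: big1_seq => c /andP[_]; rewrite mem_iota => hc; apply: e.
Qed.

End CellSums.

Lemma SF_gt0 n h F : 0 < SF addn n h F -> exists a c, [/\ a <= n, c < n & 0 < h a c (F a c)].
Proof.
rewrite lt0n => /negP hh; apply: contrapT => hn; apply: hh; apply/eqP.
apply: SF_idx => a c ha hc; apply/eqP; rewrite -leqn0 leqNgt; apply/negP => hp.
by apply: hn; exists a, c.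
Qed.

Lemma SF_leq n h F a c : a <= n -> c < n -> h a c (F a c) <= SF addn n h F.
Proof.
move=> ha hc; rewrite /SF (bigD1_seq a) ?mem_iota ?iota_uniq//= (bigD1_seq c) ?mem_iota ?iota_uniq//=.
exact: leq_trans (leq_addr _ _) (leq_addr _ _).
Qed.

Section Simplify.
Variable R : realType.
Variable g : ctx R.
Hypothesis hg : okg g.
Notation n := (cn g).
Notation B := (cB g).

Lemma n_ltB : n < B. Proof. by case: hg. Qed.

Lemma iotE N : N <= B -> iot g N = iota 0 N. Proof. exact: iotaB_id. Qed.

Lemma iotnE : iot g n = iota 0 n. Proof. by rewrite iotE// ltnW// n_ltB. Qed.
Lemma iotSE : iot g n.+1 = iota 0 n.+1. Proof. by rewrite iotE// n_ltB. Qed.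

Lemma foldl_sum (f : nat -> nat) s z : foldl (fun z i => z + f i) z s = z + \sum_(i <- s) f i.
Proof. by elim: s z => [|x s IH] z /=; rewrite ?big_nil ?addn0// IH big_cons addnA. Qed.

Lemma sumBE f N : N <= B -> sumB g f N = \sum_(i <- iota 0 N) f i.
Proof. by move=> h; rewrite /sumB foldl_sum iotE. Qed.

Definition cntF (F : nat -> nat -> nat) k p :=
  SF addn n (fun a c v => nat_of_bool ((v == p.+1) && (key g a c == k))) F.

Lemma cntE l k p : cnt g l k p = cntF (get l) k p.
Proof.
rewrite /cnt /cntF /SF sumBE ?n_ltB//; apply: eq_bigr => a _.
by rewrite sumBE ?(ltnW n_ltB)//; apply: eq_bigr => c _; case: ifP.
Qed.

Lemma get_mk F a c : get (mk g F) a c = if (a <= n) && (c < n) then F a c else 0.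
Proof.
rewrite /get /mk iotSE iotnE; case: (leqP a n) => ha; last first.
  by rewrite (@nth_default _ [::]) ?nth_nil// size_map size_iota.
rewrite (nth_map 0) ?size_iota// nth_iota//; case: (ltnP c n) => hc; last first.
  by rewrite nth_default// size_map size_iota.
by rewrite (nth_map 0) ?size_iota// nth_iota.
Qed.

Lemma get_mkE F a c : a <= n -> c < n -> get (mk g F) a c = F a c.
Proof. by move=> ha hc; rewrite get_mk ha hc. Qed.

Lemma cntF_ext F F' k p : (forall a c, a <= n -> c < n -> F a c = F' a c) -> cntF F k p = cntF F' k p.
Proof. by move=> e; apply: SF_ext => a c ha hc; rewrite e. Qed.

Lemma nkeys_leB : nkeys g <= B. Proof. by case: hg => _ _ _ _ [h _ _ _ _]; rewrite /nkeys addnn. Qed.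

(* Equality of signatures. *)
Definition eqc (F F' : nat -> nat -> nat) := forall k p, k < nkeys g -> p < n -> cntF F k p = cntF F' k p.

Lemma sameP e f : reflect (e.1 = f.1 /\ eqc (get e.2.1) (get f.2.1)) (same g e f).
Proof.
rewrite /same iotnE (iotE nkeys_leB).
case: e f => [[[s t] [k b]] [l v]] [[[s' t'] [k' b']] [l' v']]; rewrite -/(nkeys g); cbn [fst snd].
apply: (iffP and5P).
  move=> [/eqP-> /eqP-> /eqP-> /eqP-> h0]; have h := allP h0; split=> // i p hi hp.
  have hi' : i \in iota 0 (nkeys g) by rewrite mem_iota.
  have h1 := allP (h i hi'); have := h1 p; rewrite mem_iota => /(_ hp)/eqP.
  by rewrite !cntE.
move=> [[-> -> -> ->] h]; split=> //; apply/allP => i; rewrite mem_iota => hi.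
by apply/allP => p; rewrite mem_iota => hp; rewrite !cntE h.
Qed.

Definition suppF F := size [seq p <- iota 0 n | has (fun k => 0 < cntF F k p) (iota 0 (nkeys g))].

Lemma suppE l : supp g l = suppF (get l).
Proof.
rewrite /supp /suppF iotnE (iotE nkeys_leB); congr size; apply: eq_filter => p.
by apply: eq_has => k; rewrite cntE.
Qed.

Lemma suppF_eqc F F' : eqc F F' -> suppF F = suppF F'.
Proof.
move=> h; rewrite /suppF; congr size; apply: eq_in_filter => p; rewrite mem_iota => hp.
by apply: eq_in_has => k; rewrite mem_iota => hk; rewrite h.
Qed.

Lemma eqc_refl F : eqc F F. Proof. by []. Qed.
Lemma eqc_sym F F' : eqc F F' -> eqc F' F. Proof. by move=> h k p hk hp; rewrite h. Qed.
Lemma eqc_trans F F' F'' : eqc F F' -> eqc F' F'' -> eqc F F''.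
Proof. by move=> h h' k p hk hp; rewrite h// h'. Qed.

Lemma eqc_ext F F' : (forall a c, a <= n -> c < n -> F a c = F' a c) -> eqc F F'.
Proof. by move=> e k p _ _; apply: cntF_ext. Qed.

Lemma cntF_upd F a c v k p : a <= n -> c < n ->
  cntF (updF F a c v) k p + ((F a c == p.+1) && (key g a c == k)) =
  cntF F k p + ((v == p.+1) && (key g a c == k)).
Proof. by move=> ha hc; apply: (@SF_upd _ _ addn n (fun a c v => _) F a c v ha hc). Qed.

Lemma eqc_upd F F' a c v a' c' v' : a <= n -> c < n -> a' <= n -> c' < n ->
  key g a c = key g a' c' -> F a c = F' a' c' -> v = v' -> eqc F F' ->
  eqc (updF F a c v) (updF F' a' c' v').
Proof.
move=> ha hc ha' hc' hk hF <- h k p hk' hp.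
have := cntF_upd F v k p ha hc; have := cntF_upd F' v k p ha' hc'.
by rewrite h// hF hk => <- /addIn.
Qed.

(* Only the active positions, 1 to n, are counted. *)
Lemma eqc_updv F a c v v' : a <= n -> c < n -> n < v \/ v = 0 -> n < v' \/ v' = 0 ->
  eqc (updF F a c v) (updF F a c v').
Proof.
move=> ha hc hv hv' k p hk hp.
have := cntF_upd F v k p ha hc; have := cntF_upd F v' k p ha hc.
have -> : v == p.+1 = false by apply/eqP => e; case: hv; lia.
have -> : v' == p.+1 = false by apply/eqP => e; case: hv'; lia.
by move=> <- /addIn.
Qed.

Lemma cntF_gt0 F k p : 0 < cntF F k p -> exists a c, [/\ a <= n, c < n, F a c = p.+1 & key g a c = k].
Proof.
move=> /SF_gt0[a [c [ha hc]]]; rewrite lt0b => /andP[/eqP h1 /eqP h2].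
by exists a, c.
Qed.

Lemma cntF_pos F a c p : a <= n -> c < n -> F a c = p.+1 -> 0 < cntF F (key g a c) p.
Proof.
move=> ha hc e.
apply: leq_trans (@SF_leq n (fun a' c' v => nat_of_bool ((v == p.+1) && (key g a' c' == key g a c))) F a c ha hc).
by rewrite e !eqxx.
Qed.

(** Equal positive counts yield a token of the same key at the same point. Thus a rule planned for
    one configuration can be applied to any entry with the same signature. *)
Lemma eqc_find F F' a c p : a <= n -> c < n -> F a c = p.+1 -> p < n -> key g a c < nkeys g ->
  eqc F' F -> exists a' c', [/\ a' <= n, c' < n, F' a' c' = p.+1 & key g a' c' = key g a c].
Proof. by move=> ha hc e hp hk h; apply: cntF_gt0; rewrite h//; apply: cntF_pos. Qed.

Lemma suppF_le F (P : seq nat) :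
  (forall a c p, a <= n -> c < n -> F a c = p.+1 -> p < n -> p \in P) -> suppF F <= size P.
Proof.
move=> h; apply: uniq_leq_size; first by rewrite filter_uniq ?iota_uniq.
move=> p; rewrite mem_filter mem_iota => /andP[/hasP[k _ /cntF_gt0[a [c [ha hc e _]]]] hp].
exact: h e hp.
Qed.

End Simplify.
(** * Tables *)

Lemma foldl_hit A (X : eqType) (P Q : A -> Prop) (f : A -> X -> A) s z x0 :
  (forall z x, x \in s -> P z -> P (f z x)) -> (forall z, P z -> Q (f z x0)) ->
  (forall z x, x \in s -> P z -> Q z -> Q (f z x)) -> x0 \in s -> P z -> Q (foldl f z s).
Proof.
move=> hP h0 hQ.
suff H (s' : seq X) z' : {subset s' <= s} -> P z' -> (x0 \in s') \/ Q z' -> Q (foldl f z' s').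
  by move=> hx hz; apply: H => //; left.
elim: s' z' => [|x l IH] z' hs pz /=; first by case.
have hx : x \in s by apply: hs; rewrite mem_head.
have hl : {subset l <= s} by move=> y hy; apply: hs; rewrite in_cons hy orbT.
case=> [|qz]; last by apply: IH => //; [apply: hP|right; apply: hQ].
rewrite in_cons => /orP[/eqP e|hin]; last by apply: IH => //; [apply: hP|left].
by apply: IH => //; [apply: hP|right; rewrite -e; apply: h0].
Qed.

Lemma foldl_inv A (X : eqType) (P : A -> Prop) (f : A -> X -> A) s z :
  (forall z x, x \in s -> P z -> P (f z x)) -> P z -> P (foldl f z s).
Proof.
elim: s z => //= x l IH z hP pz; apply: IH => [z' y hy hz|].
  by apply: hP => //; rewrite in_cons hy orbT.
by apply: hP => //; rewrite mem_head.
Qed.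

Section Table.
Variable R : realType.
Variable g : ctx R.
Hypothesis hg : okg g.
Notation n := (cn g).
Notation B := (cB g).
Notation entry := (entry R).
Notation eqc := (eqc g).
Notation suppF := (suppF g).
Notation Q := (cQ g).

Lemma same_refl (e : entry) : same g e e. Proof. exact/(sameP hg). Qed.

Lemma same_sym (e f : entry) : same g e f = same g f e.
Proof.
by apply/(sameP hg)/(sameP hg) => -[h1 h2]; split=> //; apply: eqc_sym.
Qed.

Lemma same_trans (e f h : entry) : same g e f -> same g f h -> same g e h.
Proof.
move=> /(sameP hg)[h1 h2] /(sameP hg)[h3 h4]; apply/(sameP hg); split.
  by rewrite h1.
exact: eqc_trans h2 h4.
Qed.

(** The factors count the two ends and the number of facilities, the flag [raw], a list of at most
    [Q] points padded with [n], and a number of tokens, at most [(n + 1) n], for each of these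
    points and each key. *)
Definition sigs := (n.+1 ^ 3 * 2 * n.+1 ^ Q * (n.+1 * n).+1 ^ (Q * nkeys g))%N.
Hypothesis hsig : (sigs < B)%N.

Variable Inv : entry -> Prop.
Hypothesis Inv_hdr : forall e, Inv e -> [/\ e.1.1.1 <= n, e.1.1.2 <= n & e.1.2.1 <= n]%N.

Definition Clean (T : seq entry) := pairwise (fun e f => ~~ same g e f) T /\
  forall e, e \in T -> Inv e /\ (suppF (get e.2.1) <= Q)%N.

Definition supl (e : entry) := [seq p <- iota 0 n | has (fun k => 0 < cntF g (get e.2.1) k p) (iota 0 (nkeys g))].

Definition sigt := ('I_n.+1 * 'I_n.+1 * 'I_n.+1 * bool * {ffun 'I_Q -> 'I_n.+1} *
  {ffun 'I_Q * 'I_(nkeys g) -> 'I_(n.+1 * n).+1})%type.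

Definition sig (e : entry) : sigt :=
  (inord e.1.1.1, inord e.1.1.2, inord e.1.2.1, e.1.2.2,
   [ffun i : 'I_Q => inord (nth n (supl e) i)],
   [ffun ij : 'I_Q * 'I_(nkeys g) => inord (cntF g (get e.2.1) ij.2 (nth n (supl e) ij.1))]).

Lemma cntF_le F k p : cntF g F k p <= n.+1 * n.
Proof.
rewrite /cntF /SF; apply: (@leq_trans (\sum_(a <- iota 0 n.+1) \sum_(c <- iota 0 n) 1)).
  by apply: leq_sum => a _; apply: leq_sum => c _; case: (_ && _).
by rewrite sum1_size size_iota big_const_seq count_predT size_iota iter_addn_0 mulnC.
Qed.

(** All counts vanish outside of the supported points, so the list of these points and the counts
    along it determine the signature. The padding [n] cannot be confused with a point. *)
Lemma sig_inj e f : Inv e -> Inv f -> suppF (get e.2.1) <= Q -> suppF (get f.2.1) <= Q ->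
  sig e = sig f -> same g e f.
Proof.
move=> /Inv_hdr[h1 h2 h3] /Inv_hdr[h4 h5 h6] he hf.
rewrite /sig => -[/(congr1 val) /= e1 /(congr1 val) /= e2 /(congr1 val) /= e3 e4 e5 e6].
rewrite !inordK ?ltnS// in e1 e2 e3.
apply/(sameP hg); split.
  by case: e f h1 h2 h3 h4 h5 h6 he hf e1 e2 e3 e4 e5 e6 =>
    [[[s t] [k b]] l] [[[s' t'] [k' b']] l'] /= *; congr (_, _, (_, _)).
have snth (x : entry) i : nth n (supl x) i <= n.
  case: (ltnP i (size (supl x))) => hi; last by rewrite nth_default.
  have := mem_nth n hi; rewrite mem_filter mem_iota => /andP[_]; exact: ltnW.
have en i : i < Q -> nth n (supl e) i = nth n (supl f) i.
  move=> hi; have := congr1 (fun F : {ffun 'I_Q -> 'I_n.+1} => val (F (Ordinal hi))) e5.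
  by rewrite !ffunE /= !inordK ?ltnS.
have H (x : entry) p : p < n -> p \notin supl x -> forall k, k < nkeys g -> cntF g (get x.2.1) k p = 0.
  move=> hp; rewrite mem_filter mem_iota leq0n add0n hp !andbT -all_predC => /allP hx k hk.
  by apply/eqP; rewrite -leqn0 leqNgt; apply: hx; rewrite mem_iota.
move=> k p hk hp.
have Hn i : i < Q -> cntF g (get e.2.1) k (nth n (supl e) i) = cntF g (get f.2.1) k (nth n (supl f) i).
  move=> hi; have := congr1 (fun F : {ffun 'I_Q * 'I_(nkeys g) -> 'I_(n.+1 * n).+1} =>
     val (F (Ordinal hi, Ordinal hk))) e6.
  by rewrite !ffunE /= !inordK ?ltnS ?cntF_le.
have H2 (x y : entry) : size (supl x) <= Q -> (forall i, i < Q -> nth n (supl x) i = nth n (supl y) i) ->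
    p \in supl x -> p \in supl y /\ (index p (supl x) < Q /\ nth n (supl y) (index p (supl x)) = p).
  move=> hs hxy hpx; have hi : index p (supl x) < Q by apply: leq_trans hs; rewrite index_mem.
  have hh : nth n (supl y) (index p (supl x)) = p by rewrite -hxy// nth_index.
  split=> //; rewrite -hh mem_nth// ltnNge; apply/negP => hd.
  by move: hh; rewrite nth_default// => hh; rewrite hh ltnn in hp.
case: (boolP (p \in supl e)) => hpe.
  have [_ [hi hh]] := H2 _ _ he en hpe.
  by have := Hn _ hi; rewrite hh nth_index.
rewrite (H _ _ hp hpe _ hk) H//; apply/negP => hpf.
have [|hh _] := H2 _ e hf _ hpf; first by move=> i hi; rewrite en.
by rewrite hh in hpe.
Qed.

(** Entries of a clean table have distinct codes, so it is shorter than [B]; consequently [tcons]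
    never discards an inserted entry. *)
Lemma Clean_size T : Clean T -> size T < B.
Proof.
move=> [hp hi]; apply: leq_ltn_trans hsig.
rewrite -(size_map sig); have hu : uniq [seq sig e | e <- T].
  rewrite uniq_pairwise pairwise_map.
  apply: (@sub_in_pairwise _ (mem T)) hp; last by apply/allP.
  move=> e f he hf; apply: contra => /eqP h.
  by have [i1 s1] := hi _ he; have [i2 s2] := hi _ hf; apply: sig_inj.
rewrite -(card_uniqP hu); apply: leq_trans (max_card _) _.
rewrite !card_prod !card_ffun !card_prod !card_ord card_bool /sigs.
by rewrite !expnS expn0 muln1 !mulnA.
Qed.

Lemma insE T (be : bool * entry) : Clean T -> ins g T be =
  if [&& be.1, suppF (get be.2.2.1) <= Q & all (fun x => ~~ same g be.2 x || (be.2.2.2 < x.2.2)%R) T]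
  then be.2 :: [seq x <- T | ~~ same g be.2 x] else T.
Proof.
move=> hT; rewrite /ins (suppE hg); case: ifP => // _.
by rewrite /tcons (leq_ltn_trans _ (Clean_size hT))// size_filter count_size.
Qed.

Lemma ins_clean T (be : bool * entry) : Clean T -> (be.1 -> Inv be.2) -> Clean (ins g T be).
Proof.
move=> hT hi; rewrite insE//; case: ifP => // /and3P[h1 h2 h3].
case: hT => hp hT; split.
  rewrite /= pairwise_filter// andbT; apply/allP => x; rewrite mem_filter => /andP[//].
move=> e; rewrite in_cons => /orP[/eqP->|]; first by split=> //; apply: hi.
by rewrite mem_filter => /andP[_]; apply: hT.
Qed.

(** An insertion may replace an entry by a cheaper one of the same signature. Hence membership does
    not persist, but this relation does. *)
Definition cov (T : seq entry) (e : entry) :=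
  exists2 f, f \in T & same g f e /\ (f.2.2 <= e.2.2)%R.

Lemma ins_cov T (be : bool * entry) e : Clean T -> cov T e -> cov (ins g T be) e.
Proof.
move=> hT [f hf [h1 h2]]; rewrite insE//; case: ifP => [/and3P[h3 h4 h5]|_]; last by exists f.
case: (boolP (same g be.2 f)) => hs; last first.
  by exists f => //; rewrite in_cons mem_filter hs hf orbT.
exists be.2; first by rewrite mem_head.
split; first exact: same_trans hs h1.
have /allP/(_ f hf) := h5; rewrite hs /= => h6.
exact: le_trans (ltW h6) h2.
Qed.

Lemma ins_hit T (be : bool * entry) : Clean T -> be.1 -> suppF (get be.2.2.1) <= Q -> cov (ins g T be) be.2.
Proof.
move=> hT h1 h2; rewrite insE// h1 h2 /=; case: ifP => h3.
  by exists be.2; rewrite ?mem_head//; split=> //; apply: same_refl.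
move/negbT: h3; rewrite -has_predC => /hasP[f hf]; rewrite /= negb_or negbK -leNgt => /andP[h3 h4].
by exists f => //; split=> //; rewrite same_sym.
Qed.

End Table.
(** * Soundness *)

Section Soundness.
Variable R : realType.
Variable g : ctx R.
Hypothesis hg : okg g.
Notation n := (cn g).
Notation B := (cB g).
Notation l0 := (cl g).
Notation entry := (entry R).
Notation code := (gcode g).
Hypothesis d_ge0 : forall x y, (0 <= gd g x y)%R.
Hypothesis d_sym : forall x y, gd g x y = gd g y x.
Hypothesis d_xx : forall x, gd g x x = 0%R.
Hypothesis d_tri : forall x y z, x < n -> y < n -> z < n -> (gd g x z <= gd g x y + gd g y z)%R.
Hypothesis code_le : forall c, code c <= l0.
Variable o : seq nat.
Hypothesis o_perm : perm_eq o (iota 0 n).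

Definition inV (e : entry) x := (e.1.1.1 <= index x o) && (index x o < e.1.1.2).

(* What a token has paid for is at least its distance from home. *)
Definition pot (a c v : nat) : R :=
  if a == n then
    if 0 < v <= n then gd g c v.-1 else if n < v then gd g c (v - n.+1) else 0%R
  else if 0 < v <= n then gd g a v.-1 else 0%R.
(** Summands of three counts of tokens of type [k]: clients connected to [f], connected demands of
    [f], and all demands of [f]. *)
Definition mA (f k a c v : nat) := nat_of_bool [&& a == n, v == n.+1 + f & code c == k].
Definition mB (f k a c v : nat) := nat_of_bool [&& a == f, v == n.+1 & code c == k].
Definition dc (f k a c v : nat) := nat_of_bool [&& a == f, v != 0 & code c == k].
Definition rowne l f := has (fun c => get l f c != 0) (iota 0 n).
Definition nopen l := count (rowne l) (iota 0 n).
Definition dcs l f k := SF addn n (dc f k) (get l).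
Definition fairF l f := forall i, i < l0 ->
  let q := ((dcs l f i.+1)%:R / (\sum_(j <- iota 0 l0) dcs l f j.+1)%:R)%R in
  (galpha g i <= q)%R /\ (q <= gbeta g i)%R.

Record Inv0 (e : entry) : Prop := MkInv0 {
  I_rng : e.1.1.1 < e.1.1.2 <= n;
  I_k : e.1.2.1 <= e.1.1.2 - e.1.1.1;
  I_cell : forall a c, get e.2.1 a c != 0 ->
    [/\ a <= n, c < n & code c != 0];
  I_cli : forall c, get e.2.1 n c != 0 -> inV e c /\ get e.2.1 n c <= n + n;
  I_dem : forall a c, a < n -> get e.2.1 a c != 0 ->
    [/\ inV e a, gfac g a != 0 & get e.2.1 a c <= n.+1];
  I_cov : forall c, c < n -> inV e c -> code c != 0 -> get e.2.1 n c != 0;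
  I_open : nopen e.2.1 <= e.1.2.1;
  I_fair : ~~ e.1.2.2 -> forall f, f < n -> rowne e.2.1 f -> fairF e.2.1 f;
  I_raw : e.1.2.2 -> [/\ e.1.1.2 = e.1.1.1.+1, e.1.2.1 = 1, gfac g (nth 0 o e.1.1.1) != 0 &
    forall a c, get e.2.1 a c != 0 -> get e.2.1 a c = (nth 0 o e.1.1.1).+1 /\
      (a < n -> a = nth 0 o e.1.1.1)] }.

(* Only the numbers of tokens match: a client connected to [f] and a demand of [f] of the same type
   may have been connected in different steps. *)
Definition matched l := forall f k, f < n -> SF addn n (mA f k) (get l) = SF addn n (mB f k) (get l).

Definition Inv (e : entry) :=
  [/\ Inv0 e, matched e.2.1 & (SF +%R n pot (get e.2.1) <= e.2.2)%R].

Lemma o_size : size o = n. Proof. by rewrite (perm_size o_perm) size_iota. Qed.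
Lemma o_uniq : uniq o. Proof. by rewrite (perm_uniq o_perm) iota_uniq. Qed.
Lemma o_mem x : (x \in o) = (x < n). Proof. by rewrite (perm_mem o_perm) mem_iota. Qed.
Lemma o_nth i : i < n -> nth 0 o i < n.
Proof. by move=> hi; rewrite -o_mem mem_nth// o_size. Qed.
Lemma o_index i : i < n -> index (nth 0 o i) o = i.
Proof. by move=> hi; rewrite index_uniq ?o_size// o_uniq. Qed.

Lemma get_upd l a c v : (forall a c, get l a c != 0 -> [/\ a <= n, c < n & code c != 0]) ->
  a <= n -> c < n -> forall a' c', get (upd g l a c v) a' c' = updF (get l) a c v a' c'.
Proof.
move=> hl ha hc a' c'; rewrite get_mk// /updF.
case: ifP => // hn; case: ifP => [/andP[/eqP e1 /eqP e2]|_].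
  by rewrite e1 e2 ha hc in hn.
by apply/esym/eqP; apply/negPn/negP => /hl[h1 h2 _]; rewrite h1 h2 in hn.
Qed.

Lemma SF_get_upd V (idx : V) (op : Monoid.com_law idx) (h : nat -> nat -> nat -> V) l a c v :
  a <= n -> c < n ->
  op (SF op n h (get (upd g l a c v))) (h a c (get l a c)) = op (SF op n h (get l)) (h a c v).
Proof.
move=> ha hc; rewrite -(SF_upd op h (get l) v ha hc); congr (op _ _).
by apply: SF_ext => a' c' ha' hc'; rewrite get_mkE.
Qed.

Lemma SFn_upd (h : nat -> nat -> nat -> nat) l a c v : a <= n -> c < n ->
  h a c (get l a c) = h a c v -> SF addn n h (get (upd g l a c v)) = SF addn n h (get l).
Proof. by move=> ha hc e; have := SF_get_upd addn h l v ha hc; rewrite e => /addIn. Qed.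

Lemma rowne_upd l a c v f :
  (forall a c, get l a c != 0 -> [/\ a <= n, c < n & code c != 0]) ->
  a <= n -> c < n -> get l a c != 0 -> v != 0 -> rowne (upd g l a c v) f = rowne l f.
Proof.
move=> hl ha hc h1 h2; apply: eq_has => c'; rewrite get_upd// /updF.
by case: ifP => // /andP[/eqP-> /eqP->]; rewrite h1 h2.
Qed.

Lemma dcs_upd l a c v f k : a <= n -> c < n -> get l a c != 0 -> v != 0 ->
  dcs (upd g l a c v) f k = dcs l f k.
Proof. by move=> ha hc h1 h2; apply: SFn_upd => //; rewrite /dc h1 h2. Qed.

Lemma fairF_ext l l' f : (forall k, dcs l f k = dcs l' f k) -> fairF l f -> fairF l' f.
Proof.
move=> e h i hi; have := h i hi; rewrite /= e.
by rewrite (eq_bigr (fun j => dcs l' f j.+1)).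
Qed.

Lemma pot_upd l a c v : a <= n -> c < n ->
  SF +%R n pot (get (upd g l a c v)) = (SF +%R n pot (get l) - pot a c (get l a c) + pot a c v)%R.
Proof. by move=> ha hc; have h := SF_get_upd +%R pot l v ha hc; rewrite addrAC -[(_ + pot a c v)%R]h addrK. Qed.

Lemma potn c v : 0 < v <= n -> pot n c v = gd g c v.-1.
Proof. by rewrite /pot eqxx => ->. Qed.

Lemma potf f c v : f < n -> 0 < v <= n -> pot f c v = gd g f v.-1.
Proof. by move=> hf; rewrite /pot ltn_eqF// => ->. Qed.

Lemma Inv0_upd e a c v w : Inv0 e -> ~~ e.1.2.2 -> a <= n -> c < n -> get e.2.1 a c != 0 -> v != 0 ->
  (a = n -> v <= n + n) -> (a < n -> v <= n.+1) -> Inv0 (e.1, (upd g e.2.1 a c v, w)).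
Proof.
move=> [q1 q2 q3 q4 q5 q6 q8 q9 q10] hfl ha hc hne hv hvn hvf; split=> //=.
- move=> a' c'; rewrite get_upd// /updF; case: ifP => [/andP[/eqP-> /eqP->] _|_]; exact: q3.
- move=> c'; rewrite get_upd// /updF; case: ifP => [/andP[/eqP hna /eqP->] _|_]; last exact: q4.
  split; last exact: hvn.
  by have [] := q4 c; rewrite // hna.
- move=> a' c' ha'; rewrite get_upd// /updF; case: ifP => [/andP[/eqP e1 _] _|_]; last exact: q5.
  by rewrite e1 in ha' *; have [] := q5 a c ha' hne => *; split=> //; apply: hvf.
- move=> c' hc' hin hcc; rewrite get_upd// /updF; case: ifP => // _; exact: q6.
- rewrite (leq_trans _ q8)//; apply: eq_leq; apply: eq_count => f; exact: rowne_upd.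
- move=> _ f hf; rewrite rowne_upd// => hr; apply: fairF_ext (q9 hfl f hf hr) => k.
  by rewrite dcs_upd.
- by move=> h; rewrite h in hfl.
Qed.

Lemma sound_move e a c y : Inv e -> a <= n -> c < n -> y < n -> (moveE g e a c y).1 -> Inv (moveE g e a c y).2.
Proof.
move=> [he hm hp] ha hc hy /andP[hfl /andP[h1 h2]]; have hne : get e.2.1 a c != 0 by rewrite -lt0n.
split.
- by apply: Inv0_upd => //; lia.
- move=> f k hf; rewrite /= !SFn_upd//; first exact: hm.
    by rewrite /mB; do 2?[rewrite (_ : _ == n.+1 = false); last by apply/eqP; lia]; rewrite !andbF.
  by rewrite /mA; do 2?[rewrite (_ : _ == n.+1 + f = false); last by apply/eqP; lia]; rewrite !andbF.
rewrite /= pot_upd//.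
have hpn : (get e.2.1 a c).-1 < n by lia.
suff : (pot a c y.+1 <= pot a c (get e.2.1 a c) + gd g (get e.2.1 a c).-1 y)%R by move: hp; lra.
move: ha; rewrite leq_eqVlt => /orP[/eqP ha|ha].
  by rewrite ha in h1 h2 hpn *; rewrite !potn ?h1//; apply: d_tri.
by rewrite !potf ?h1//; apply: d_tri.
Qed.

(** The client takes over what the demand has paid: by the triangle inequality its distance to [f]
    is at most the two payments plus the length of the connection, and the potential of the demand
    becomes 0. Both sides of [matched] grow by one, for the facility [f] of the chosen demand and
    the common type. *)
Lemma sound_conn e c f c' : Inv e -> c < n -> f < n -> c' < n -> (connE g e c f c').1 ->
  Inv (connE g e c f c').2.
Proof.
move=> [he hm hp] hc hf hc' /and4P[hfl /andP[h1 h2] /andP[h3 h4] /eqP hcc].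
have hne1 : get e.2.1 n c != 0 by rewrite -lt0n.
have hne2 : get e.2.1 f c' != 0 by rewrite -lt0n.
have hq : get (upd g e.2.1 n c (n.+1 + f)) f c' = get e.2.1 f c'.
  rewrite get_upd//; last by case: he.
  by rewrite /updF ltn_eqF.
have he1 : Inv0 (e.1, (upd g e.2.1 n c (n.+1 + f), 0%R)) by apply: Inv0_upd => //; lia.
split.
- by apply: (Inv0_upd _ he1) => //=; rewrite ?hq//; lia.
- move=> f1 k hf1 /=.
  have := SF_get_upd addn (mA f1 k) (upd g e.2.1 n c (n.+1 + f)) n.+1 (ltnW hf) hc'.
  have := SF_get_upd addn (mA f1 k) e.2.1 (n.+1 + f) (leqnn n) hc.
  have := SF_get_upd addn (mB f1 k) (upd g e.2.1 n c (n.+1 + f)) n.+1 (ltnW hf) hc'.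
  have := SF_get_upd addn (mB f1 k) e.2.1 (n.+1 + f) (leqnn n) hc.
  have -> : mA f1 k n c (get e.2.1 n c) = 0.
    by rewrite /mA (_ : _ == n.+1 + f1 = false) ?andbF//; apply/eqP; lia.
  have -> : mA f1 k n c (n.+1 + f) = (f == f1) && (code c == k) by rewrite /mA eqxx eqn_add2l.
  have z1 v : mA f1 k f c' v = 0 by rewrite /mA ltn_eqF.
  have z2 v : mB f1 k n c v = 0 by rewrite /mB gtn_eqF.
  have -> : mB f1 k f c' (get (upd g e.2.1 n c (n.+1 + f)) f c') = 0.
    by rewrite hq /mB (_ : _ == n.+1 = false) ?andbF//; apply/eqP; lia.
  have -> : mB f1 k f c' n.+1 = (f == f1) && (code c == k) by rewrite /mB eqxx hcc.
  rewrite !z1 !z2 /= (hm _ _ hf1) !addn0 => -> -> -> ->; lia.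
rewrite /= pot_upd ?(ltnW hf)// hq pot_upd//.
have hp1 : (get e.2.1 n c).-1 < n by lia.
have hp2 : (get e.2.1 f c').-1 < n by lia.
rewrite (potn c) ?h1// (potf c') ?h3//.
have -> : pot n c (n.+1 + f) = gd g c f.
  by rewrite /pot eqxx; do 2?[case: ifP => ?]; rewrite ?addKn//; lia.
have -> : pot f c' n.+1 = 0%R by rewrite /pot ltn_eqF// ltnn.
have := d_tri hc hp1 hf; have := d_tri hp1 hp2 hf; rewrite (d_sym (get e.2.1 f c').-1 f); move: hp; lra.
Qed.

Lemma get_leaf i b a c : get (leafE g o i b).2.2.1 a c =
  if [&& a == n, c == nth 0 o i & c < n] && (code c != 0) then (nth 0 o i).+1 else 0.
Proof.
rewrite /leafE /= get_mk//; case: (ltnP c n) => hc; rewrite ?andbF ?andbT//= -andbA.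
by case: (leqP a n) => // ha; rewrite gtn_eqF.
Qed.

Lemma sound_leaf i b : i < n -> (leafE g o i b).1 -> Inv (leafE g o i b).2.
Proof.
move=> hi hb; set x := nth 0 o i.
have hx : x < n by apply: o_nth.
have hg' a c : get (leafE g o i b).2.2.1 a c != 0 -> [/\ a = n, c = x, code c != 0 & 
    get (leafE g o i b).2.2.1 a c = x.+1].
  by rewrite get_leaf -/x; case: ifP => // /andP[/and3P[/eqP-> /eqP-> _] ->].
have hno a c : a < n -> get (leafE g o i b).2.2.1 a c = 0.
  by move=> ha; apply/eqP/negPn/negP => /hg'[e1]; rewrite e1 ltnn in ha.
split.
- split; rewrite -/x.
  + by rewrite /= ltnSn.
  + by rewrite /= subSnn; case: (b).
  + by move=> a c /hg'[-> -> ? _].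
  + move=> c /[dup] /hg'[_ -> _ ->] _; split; last by lia.
    by rewrite /inV /= o_index// leqnn ltnSn.
  + by move=> a c ha; rewrite hno.
  + move=> c hc /andP[h1 h2] hcc; rewrite /= in h1 h2; rewrite get_leaf hc hcc eqxx !andbT.
    have -> : c = nth 0 o i by rewrite -[LHS](@nth_index _ 0 c o) ?o_mem//; congr nth; lia.
    by rewrite eqxx.
  + rewrite (_ : nopen _ = 0)//; apply/eqP; rewrite eqn0Ngt -has_count; apply/hasPn => f.
    rewrite mem_iota => hf; apply/hasPn => c _; by rewrite hno.
  + by move=> _ f hf /hasP[c _]; rewrite hno.
  + rewrite /= => hb'; split=> //; [by rewrite hb'|by move: hb; rewrite /= hb'|].
    move=> a c /[dup] /hg'[-> _ _ ->] _; split=> //; by rewrite ltnn.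
- move=> f k hf; rewrite /= !SF_idx// => a c ha hc; rewrite /mB /mA.
    rewrite (_ : (_ == n.+1) = false) ?andbF//; apply/eqP => h.
    have [|_ _ _ h2] := hg' a c; first by rewrite [X in X != _]h.
    by have := h2; rewrite [LHS]h => -[e]; rewrite e ltnn in hx.
  rewrite (_ : (_ == n.+1 + f) = false) ?andbF//; apply/eqP => h.
  have [|_ _ _ h2] := hg' a c; first by rewrite [X in X != _]h addSn.
  by have := h2; rewrite [LHS]h; lia.
rewrite SF_idx// => a c ha hc.
case: (eqVneq (get (leafE g o i b).2.2.1 a c) 0) => [->|/hg'[-> -> _ ->]].
  by rewrite /pot /=; case: ifP.
by rewrite potn /=.
Qed.

Lemma rawrow e f : Inv0 e -> e.1.2.2 -> f < n -> rowne e.2.1 f -> f = nth 0 o e.1.1.1.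
Proof. by move=> he hr hf /hasP[c _ hc]; have [_ _ _ h] := I_raw he hr; apply: (h _ _ hc).2. Qed.

Lemma nopen_raw (e : entry) : (forall f, f < n -> rowne e.2.1 f -> f = nth 0 o e.1.1.1) -> nopen e.2.1 <= 1.
Proof.
move=> h; rewrite /nopen -size_filter.
apply: (@leq_trans (size [:: nth 0 o e.1.1.1])) => //; apply: uniq_leq_size.
  by rewrite filter_uniq ?iota_uniq.
by move=> f; rewrite mem_filter mem_iota inE => /andP[h1 h2]; apply/eqP/h.
Qed.

Lemma sound_add e c : Inv e -> c < n -> (addE g o e c).1 -> Inv (addE g o e c).2.
Proof.
move=> [he hm hp] hc /and3P[hfl /eqP h1 h2]; rewrite /addE /=.
set x := nth 0 o e.1.1.1 in h1 *.
have [q1 q2 q3 q4 q5 q6 q8 q9 q10] := he.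
have hx : x < n by apply: o_nth; case/andP: q1 => a b; apply: leq_trans a b.
have [r1 r2 hfac r3] := q10 hfl; rewrite -/x in hfac r3.
have gU a c' : get (upd g e.2.1 x c x.+1) a c' = updF (get e.2.1) x c x.+1 a c'.
  by rewrite get_upd// ltnW.
have r3' a c' : updF (get e.2.1) x c x.+1 a c' != 0 ->
   updF (get e.2.1) x c x.+1 a c' = x.+1 /\ (a < n -> a = x).
  by rewrite /updF; case: ifP => [/andP[/eqP-> _]|_] //; apply: r3.
split.
- split=> //=.
  + move=> a c'; rewrite gU /updF; case: ifP => [/andP[/eqP-> /eqP->] _|_]; last exact: q3.
    by split=> //; apply: ltnW.
  + move=> c'; rewrite gU /updF (gtn_eqF hx) /=; exact: q4.
  + move=> a c' ha; rewrite gU /updF; case: ifP => [/andP[/eqP e1 _] _|_]; last exact: q5.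
    rewrite e1; split=> //; last by lia.
    by rewrite /inV o_index// ?leqnn; case/andP: q1 => // a1 b1; apply: leq_trans a1 b1.
  + by move=> c' hc' hin hcc; rewrite gU /updF; case: ifP => // _; apply: q6.
  + rewrite r2; apply: (@nopen_raw (e.1, (upd g e.2.1 x c x.+1, 0%R))) => f hf /hasP[c' _] /=.
    by rewrite gU => /r3'[_]; apply.
  + by rewrite hfl.
  + by move=> _; split=> // a c'; rewrite gU; apply: r3'.
- move=> f k hf; rewrite /= !SFn_upd ?(ltnW hx)//; first exact: hm.
    rewrite /mB -/(get _ _ _) h1 (_ : x.+1 == n.+1 = false) ?andbF//; apply/eqP; lia.
  by rewrite /mA ltn_eqF.
rewrite /= pot_upd ?(ltnW hx)// h1.
have -> : pot x c 0 = 0%R by rewrite /pot ltn_eqF.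
by rewrite potf//= d_xx addr0 subr0.
Qed.

Lemma key_dem a c i : a <= n -> i < l0 -> (key g a c == i.+1 + l0.+1) = (a != n) && (code c == i.+1).
Proof.
move=> ha hi; rewrite /key; case: (eqVneq a n) => [_|h] /=; first by apply/eqP; have := code_le c; lia.
by rewrite eqn_add2r.
Qed.

(** In a raw entry every token is still at the facility and every demand belongs to it. The counts
    tested by [fair] are therefore the row counts required by [fairF]. *)
Lemma sound_seal e : Inv e -> (sealE g o e).1 -> Inv (sealE g o e).2.
Proof.
move=> [he hm hp] /andP[hfl hf]; split=> //.
have [q1 q2 q3 q4 q5 q6 q8 q9 q10] := he; split=> //= _ f hfn hr.
have ef := rawrow he hfl hfn hr.
have [r1 r2 _ r3] := q10 hfl.
set x := nth 0 o e.1.1.1 in ef hf r3.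
have hc i : i < l0 -> cnt g e.2.1 (i.+1 + l0.+1) x = dcs e.2.1 f i.+1.
  move=> hi; rewrite cntE//; apply: SF_eq => a c ha hcn; rewrite /dc key_dem//.
  case: (eqVneq (get e.2.1 a c) 0) => [->|hne] /=; first by rewrite andbF.
  have [-> h2] := r3 _ _ hne; rewrite eqxx /= ef.
  by move: ha; rewrite leq_eqVlt => /orP[/eqP->|ha]; 
    [rewrite eqxx /= gtn_eqF// -ef|rewrite (h2 ha) eqxx ltn_eqF// -ef].
have hB : l0 <= B by case: hg => _ _ _ _ [h _ _ _ _]; lia.
have hs : sumB g (fun j => cnt g e.2.1 (j.+1 + l0.+1) x) l0 = \sum_(j <- iota 0 l0) dcs e.2.1 f j.+1.
  by rewrite sumBE//; apply: eq_big_seq => j; rewrite mem_iota => hj; rewrite hc.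
move=> i hi; move: hf; rewrite /fair -/x hs (iotE hB) => /allP/(_ i).
by rewrite mem_iota => /(_ hi)/andP; rewrite hc.
Qed.

Lemma disU e f : Inv0 e -> Inv0 f -> e.1.1.2 = f.1.1.1 ->
  forall a c, get e.2.1 a c = 0 \/ get f.2.1 a c = 0.
Proof.
move=> he hf hst a c.
have dV x : inV e x -> inV f x -> False by rewrite /inV hst => /andP[_ h1] /andP[h2 _]; lia.
case: (eqVneq (get e.2.1 a c) 0) => [|h1]; first by left.
case: (eqVneq (get f.2.1 a c) 0) => [|h2]; first by right.
have [ha hc _] := I_cell he h1; move: ha; rewrite leq_eqVlt => /orP[/eqP ha|ha].
  by rewrite ha in h1 h2; case: (dV c); [case: (I_cli he h1)|case: (I_cli hf h2)].
by case: (dV a); [case: (I_dem he ha h1)|case: (I_dem hf ha h2)].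
Qed.

(** Client tokens are recorded under the client and demands under the facility, both inside the
    interval of the entry. For disjoint intervals the tables have disjoint supports and their
    entrywise sum is a union. *)
Lemma sound_union e f : Inv e -> Inv f -> (unionE g e f).1 -> Inv (unionE g e f).2.
Proof.
move=> [he hm hp] [hf hm' hp'] /and3P[b1 b2 /eqP hst].
have [q1 q2 q3 q4 q5 q6 q8 q9 q10] := he; have [p1 p2 p3 p4 p5 p6 p8 p9 p10] := hf.
set l := mk g (fun a c => get e.2.1 a c + get f.2.1 a c).
have gU a c : get l a c = get e.2.1 a c + get f.2.1 a c.
  rewrite get_mk//; case: ifP => // h; apply/esym/eqP; rewrite addn_eq0.
  by apply/andP; split; apply/negPn/negP => hh;
    [have [h1 h2 _] := q3 _ _ hh | have [h1 h2 _] := p3 _ _ hh]; rewrite h1 h2 in h.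
have dV x : inV e x -> inV f x -> False by rewrite /inV hst => /andP[_ h1] /andP[h2 _]; lia.
have dis := disU he hf hst.
have uV x : inV (unionE g e f).2 x = inV e x || inV f x.
  by rewrite /inV /= -hst; case/andP: q1 => ? ?; case/andP: p1; rewrite -hst => ? ?; lia.
have orne a c : (get l a c != 0) = (get e.2.1 a c != 0) || (get f.2.1 a c != 0).
  by rewrite gU addn_eq0 negb_and.
have gor a c : get l a c = get e.2.1 a c /\ get f.2.1 a c = 0 \/ get l a c = get f.2.1 a c /\ get e.2.1 a c = 0.
  by rewrite gU; case: (dis a c) => h; rewrite h ?addn0; [right|left].
have SFa V (idx : V) (op : Monoid.com_law idx) h : (forall a c, h a c 0 = idx) -> SF op n h (get l) = op (SF op n h (get e.2.1)) (SF op n h (get f.2.1)).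
  move=> h0; rewrite -SF_add//; apply: SF_ext => a c _ _; by rewrite gU.
have rowor x : rowne l x = rowne e.2.1 x || rowne f.2.1 x.
  rewrite /rowne -has_predU; apply: eq_has => c /=; exact: orne.
split.
- split.
  + by rewrite /=; case/andP: q1 => ? ?; case/andP: p1; rewrite -hst => ? ?; lia.
  + by rewrite /=; case/andP: q1 => ? ?; case/andP: p1; move: q2 p2; rewrite -hst => ? ? ? ?; lia.
  + by move=> a c; rewrite orne => /orP[/q3|/p3].
  + move=> c; rewrite uV; case: (gor n c) => -[-> _] => [/q4|/p4] [-> ->]; by rewrite ?orbT.
  + move=> a c ha; rewrite uV; case: (gor a c) => -[-> _] => [/(q5 _ _ ha)|/(p5 _ _ ha)] [-> -> ->];
      by rewrite ?orbT.
  + move=> c hc; rewrite uV orne => /orP[h|h] hcc; first by rewrite q6.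
    by rewrite p6// orbT.
  + rewrite /= (leq_trans _ (leq_add q8 p8))// /nopen -!sum1_count.
    rewrite (big_mkcond (rowne l)) (big_mkcond (rowne e.2.1)) (big_mkcond (rowne f.2.1)) -big_split.
    by apply: leq_sum => x _; rewrite rowor; case: (rowne _ x); case: (rowne _ x).
  + move=> _ x hx; rewrite rowor.
    have dA k : dcs l x k = dcs e.2.1 x k + dcs f.2.1 x k by apply: SFa => a c; rewrite /dc andbF.
    have d0 (l' : seq (seq nat)) k : ~~ rowne l' x -> dcs l' x k = 0.
      move=> /hasPn h; apply: SF_idx => a c ha hc; rewrite /dc; case: eqP => //= ->.
      by have := h c; rewrite mem_iota negbK => -> //.
    have xV (e' : entry) : Inv0 e' -> rowne e'.2.1 x -> inV e' x.
      by move=> h /hasP[c _ hc]; case: (I_dem h hx hc).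
    move=> /orP[h|h].
      apply: fairF_ext (q9 b1 x hx h) => k; rewrite dA (d0 f.2.1) ?addn0//.
      by apply/negP => h'; apply: (dV x); apply: xV.
    apply: fairF_ext (p9 b2 x hx h) => k; rewrite dA (d0 e.2.1) ?add0n//.
    by apply/negP => h'; apply: (dV x); apply: xV.
  + by [].
- move=> x k hx; rewrite !SFa; first by rewrite hm// hm'.
    by move=> a c; rewrite /mB andbF.
  by move=> a c; rewrite /mA andbF.
rewrite SFa; first by apply: lerD.
by move=> a c; rewrite /pot /=; case: ifP.
Qed.

Lemma Inv_hdr e : Inv e -> [/\ e.1.1.1 <= n, e.1.1.2 <= n & e.1.2.1 <= n].
Proof. by move=> [[/andP[h1 h2] h3 _ _ _ _ _ _ _] _ _]; split=> //; lia. Qed.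

End Soundness.
(** * Closure of the table *)

Section Rules.
Variable R : realType.
Variable g : ctx R.
Hypothesis hg : okg g.
Notation n := (cn g).
Notation B := (cB g).
Notation l0 := (cl g).
Notation Q := (cQ g).
Notation entry := (entry R).
Notation code := (gcode g).
Hypothesis d_ge0 : forall x y, (0 <= gd g x y)%R.
Hypothesis d_sym : forall x y, gd g x y = gd g y x.
Hypothesis d_xx : forall x, gd g x x = 0%R.
Hypothesis d_tri : forall x y z, x < n -> y < n -> z < n -> (gd g x z <= gd g x y + gd g y z)%R.
Hypothesis code_le : forall c, code c <= l0.
Variable o : seq nat.
Hypothesis o_perm : perm_eq o (iota 0 n).
Hypothesis hsig : sigs g < B.
Hypothesis hQ : 0 < Q.
Notation Inv := (Inv g o).
Notation Clean := (Clean g Inv).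
Notation ins_clean := (@ins_clean R g hg hsig _ (@Inv_hdr R g o o_perm)).
Notation ins_cov := (@ins_cov R g hg hsig _ (@Inv_hdr R g o o_perm)).
Notation ins_hit := (@ins_hit R g hg hsig _ (@Inv_hdr R g o o_perm)).

(** The two properties shared by all parts of a round and inherited by folds: the table stays clean,
    and an entry that is covered stays covered. *)
Definition CC (E : entry) (f : seq entry -> seq entry) :=
  (forall z, Clean z -> Clean (f z)) /\ (forall z, Clean z -> cov g z E -> cov g (f z) E).

Lemma CC_ins E (be : bool * entry) : (be.1 -> Inv be.2) -> CC E (fun z => ins g z be).
Proof. by move=> h; split=> z hz; [apply: ins_clean|apply: ins_cov]. Qed.

Lemma CC_foldl E (X : eqType) (f : seq entry -> X -> seq entry) s :
  (forall x, x \in s -> CC E (f^~ x)) -> CC E (fun z => foldl f z s).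
Proof.
move=> h; split=> z hz.
  by apply: foldl_inv => // z' x hx hz'; apply: (h x hx).1.
move=> hc; suff [] : Clean (foldl f z s) /\ cov g (foldl f z s) E by [].
apply: (@foldl_inv _ _ (fun z => Clean z /\ cov g z E)) => // z' x hx [h1 h2].
by split; [apply: (h x hx).1|apply: (h x hx).2].
Qed.

Lemma hit_foldl E (X : eqType) (f : seq entry -> X -> seq entry) s x0 :
  (forall x, x \in s -> CC E (f^~ x)) -> x0 \in s ->
  (forall z, Clean z -> cov g (f z x0) E) -> forall z, Clean z -> cov g (foldl f z s) E.
Proof.
move=> h hx h0 z hz; apply: (@foldl_hit _ _ Clean (cov g ^~ E) f s z x0) => //.
  by move=> z' x hx'; apply: (h x hx').1.
by move=> z' x hx'; apply: (h x hx').2.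
Qed.

Lemma CC_for3 E N (F : nat -> nat -> nat -> bool * entry) : N <= n.+1 ->
  (forall a c y, a < N -> c < n -> y < n -> (F a c y).1 -> Inv (F a c y).2) ->
  CC E (fun z => for3 g z N F).
Proof.
move=> hN h; rewrite /for3 (iotnE hg) iotE; last by apply: leq_trans hN (n_ltB hg).
apply: CC_foldl => a; rewrite mem_iota => ha; apply: CC_foldl => c; rewrite mem_iota => hc.
by apply: CC_foldl => y; rewrite mem_iota => hy; apply: CC_ins; apply: h.
Qed.

Lemma hit_for3 (E : entry) N (F : nat -> nat -> nat -> bool * entry) a c y : N <= n.+1 ->
  (forall a c y, a < N -> c < n -> y < n -> (F a c y).1 -> Inv (F a c y).2) ->
  a < N -> c < n -> y < n -> (F a c y).1 -> suppF g (get (F a c y).2.2.1) <= Q -> E = (F a c y).2 ->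
  forall z, Clean z -> cov g (for3 g z N F) E.
Proof.
move=> hN h ha hc hy h1 h2 ->; rewrite /for3 (iotnE hg) iotE; last by apply: leq_trans hN (n_ltB hg).
apply: (@hit_foldl _ _ _ _ a); [move=> a'; rewrite mem_iota => ha'|by rewrite mem_iota|].
  apply: CC_foldl => c'; rewrite mem_iota => hc'.
  by apply: CC_foldl => y'; rewrite mem_iota => hy'; apply: CC_ins; apply: h.
apply: (@hit_foldl _ _ _ _ c); [move=> c'; rewrite mem_iota => hc'|by rewrite mem_iota|].
  by apply: CC_foldl => y'; rewrite mem_iota => hy'; apply: CC_ins; apply: h.
apply: (@hit_foldl _ _ _ _ y); [move=> y'; rewrite mem_iota => hy'|by rewrite mem_iota|].
  by apply: CC_ins; apply: h.
by move=> z hz; apply: ins_hit.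
Qed.

Section Step.
Variables (T : seq entry) (e : entry).
Hypotheses (hT : Clean T) (he : e \in T).
Let ie : Inv e. Proof. by case: hT => _ h; case: (h _ he). Qed.

Let CCseal E : CC E (fun z => ins g z (sealE g o e)).
Proof. by apply: CC_ins => h; apply: sound_seal. Qed.
Let CCadd E : CC E (fun z => foldl (fun T c => ins g T (addE g o e c)) z (iot g n)).
Proof.
apply: CC_foldl => c; rewrite (iotnE hg) mem_iota => hc.
by apply: CC_ins => h; apply: sound_add.
Qed.
Let smove : forall a c y, a < n.+1 -> c < n -> y < n -> (moveE g e a c y).1 -> Inv (moveE g e a c y).2.
Proof. by move=> *; apply: sound_move. Qed.
Let sconn : forall a c y, a < n -> c < n -> y < n -> (connE g e a c y).1 -> Inv (connE g e a c y).2.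
Proof. by move=> *; apply: sound_conn. Qed.
Let CCmove E : CC E (fun z => for3 g z n.+1 (moveE g e)).
Proof. exact: CC_for3. Qed.
Let CCconn E : CC E (fun z => for3 g z n (connE g e)).
Proof. exact: CC_for3. Qed.
Let CCunion E : CC E (fun z => foldl (fun T f => ins g T (unionE g e f)) z T).
Proof.
by apply: CC_foldl => f hf; apply: CC_ins => h; apply: sound_union => //; case: hT => _ H; case: (H _ hf).
Qed.

Lemma CC_step1 E : CC E (fun z => step1 g o T z e).
Proof.
have [a1 b1] := CCseal E; have [a2 b2] := CCadd E; have [a3 b3] := CCmove E.
have [a4 b4] := CCconn E; have [a5 b5] := CCunion E.
split=> z hz; have z1 := a1 _ hz; have z2 := a2 _ z1; have z3 := a3 _ z2; have z4 := a4 _ z3.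
  exact: (a5 _ z4).
by move=> hc; exact: (b5 _ z4 (b4 _ z3 (b3 _ z2 (b2 _ z1 (b1 _ hz hc))))).
Qed.

(** The parts of [step1] run one after the other: the one that generates [E] makes it covered and
    the later ones keep it so. *)
Lemma hit_step1 (E : entry) : suppF g (get E.2.1) <= Q ->
  [\/ (true, E) = sealE g o e, exists2 c, c < n & (true, E) = addE g o e c,
    exists a c y, [/\ a <= n, c < n, y < n & (true, E) = moveE g e a c y] |
    (exists c f c', [/\ c < n, f < n, c' < n & (true, E) = connE g e c f c']) \/
    exists2 f, f \in T & (true, E) = unionE g e f] ->
  forall z, Clean z -> cov g (step1 g o T z e) E.
Proof.
have [a1 b1] := CCseal E; have [a2 b2] := CCadd E; have [a3 b3] := CCmove E.
have [a4 b4] := CCconn E; have [a5 b5] := CCunion E.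
move=> hs H z hz.
have z1 := a1 _ hz; have z2 := a2 _ z1; have z3 := a3 _ z2; have z4 := a4 _ z3.
case: H => [h|[c hc h]|[a [c [y [ha hc hy h]]]]|[[c [f [c' [hc hf hc' h]]]]|[f hf h]]].
- apply: (b5 _ z4); apply: (b4 _ z3); apply: (b3 _ z2); apply: (b2 _ z1).
  have -> : E = (sealE g o e).2 by rewrite -h.
  by apply: ins_hit; rewrite -?h.
- apply: (b5 _ z4); apply: (b4 _ z3); apply: (b3 _ z2).
  apply: (@hit_foldl _ _ _ _ c); rewrite ?(iotnE hg) ?mem_iota//.
    by move=> c'; rewrite mem_iota => hc'; apply: CC_ins => h'; apply: sound_add.
  move=> z' hz'; have -> : E = (addE g o e c).2 by rewrite -h.
  by apply: ins_hit; rewrite -?h.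
- apply: (b5 _ z4); apply: (b4 _ z3).
  by apply: (@hit_for3 _ _ _ a c y); rewrite -?h.
- by apply: (b5 _ z4); apply: (@hit_for3 _ _ _ c f c'); rewrite -?h.
apply: (@hit_foldl _ _ _ _ f) => // [f' hf'|].
  by apply: CC_ins => h'; apply: sound_union => //; case: hT => _ HH; case: (HH _ hf').
move=> z' hz'; have -> : E = (unionE g e f).2 by rewrite -h.
by apply: ins_hit; rewrite -?h.
Qed.

End Step.

Definition tab0 := foldl (fun T i => ins g (ins g T (leafE g o i false)) (leafE g o i true)) [::] (iota 0 n).
Definition tab N := iter N (round g o) tab0.

Lemma closeE : close g o = tab B.
Proof.
rewrite /close (iotnE hg) -/tab0 (iotE (leqnn B)) /tab.
suff H m k z : foldl (fun T _ => round g o T) z (iota k m) = iter m (round g o) z by [].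
by elim: m k z => //= m IH k z; rewrite IH -iterSr.
Qed.

Lemma clean_nil : Clean [::]. Proof. by split. Qed.

Let CCleaf E i : i < n -> CC E (fun T => ins g (ins g T (leafE g o i false)) (leafE g o i true)).
Proof.
move=> hi; have [a1 b1] : CC E (fun T => ins g T (leafE g o i false)).
  by apply: CC_ins; apply: sound_leaf.
have [a2 b2] : CC E (fun T => ins g T (leafE g o i true)).
  by apply: CC_ins; apply: sound_leaf.
split=> z hz; first by apply: a2; apply: a1.
by move=> h; apply: b2; [apply: a1|apply: b1].
Qed.

Lemma clean_tab N : Clean (tab N).
Proof.
elim: N => [|N IH].
  have [h _] : CC (((0, 0), (0, false)), ([::], 0%R))
      (fun z => foldl (fun T i => ins g (ins g T (leafE g o i false)) (leafE g o i true)) z (iota 0 n)).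
    by apply: CC_foldl => i; rewrite mem_iota => hi; apply: CCleaf.
  by apply: h; apply: clean_nil.
have [h _] : CC (((0, 0), (0, false)), ([::], 0%R)) (fun z => foldl (step1 g o (tab N)) z (tab N)).
  by apply: CC_foldl => e he; apply: CC_step1.
by apply: h.
Qed.

Lemma inv_tab N e : e \in tab N -> Inv e.
Proof. by move=> he; case: (clean_tab N) => _ h; case: (h _ he). Qed.

Lemma cov_tab N E : cov g (tab N) E -> cov g (tab N.+1) E.
Proof.
have [_ h] : CC E (fun z => foldl (step1 g o (tab N)) z (tab N)).
  by apply: CC_foldl => e he; apply: CC_step1 => //; apply: clean_tab.
by apply: h; apply: clean_tab.
Qed.

Lemma cov_round N e E : e \in tab N -> suppF g (get E.2.1) <= Q ->
  [\/ (true, E) = sealE g o e, exists2 c, c < n & (true, E) = addE g o e c,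
    exists a c y, [/\ a <= n, c < n, y < n & (true, E) = moveE g e a c y] |
    (exists c f c', [/\ c < n, f < n, c' < n & (true, E) = connE g e c f c']) \/
    exists2 f, f \in tab N & (true, E) = unionE g e f] ->
  cov g (tab N.+1) E.
Proof.
move=> he hs H; apply: (@hit_foldl _ _ _ _ e) => //; last exact: clean_tab.
  by move=> e' he'; apply: CC_step1 => //; apply: clean_tab.
by apply: hit_step1 => //; apply: clean_tab.
Qed.

(** Completeness is argued with an intended configuration [F]. After [N] rounds the table need not
    contain [F], only some entry with the same header and signature and cost at most [v]. *)
Definition Dom N h F v := exists2 e, e \in tab N & [/\ e.1 = h, eqc g (get e.2.1) F & (e.2.2 <= v)%R].

Lemma Dom_cov N E : cov g (tab N) E -> Dom N E.1 (get E.2.1) E.2.2.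
Proof. by move=> [e he [/(sameP hg)[h1 h2] h3]]; exists e. Qed.

Lemma Dom_le N N' h F F' v v' : Dom N h F v -> N <= N' -> (v <= v')%R -> eqc g F F' ->
  Dom N' h F' v'.
Proof.
move=> H hN hv hF; have {}H : Dom N' h F v.
  elim: N' hN => [|N' IH]; first by rewrite leqn0 => /eqP <-.
  rewrite leq_eqVlt => /orP[/eqP<- //|/IH [e he [<- h2 h3]]].
  have /cov_tab/Dom_cov : cov g (tab N') e by exists e => //; split=> //; apply: same_refl.
  by move=> [e' he' [h4 h5 h6]]; exists e' => //; split=> //;
    [apply: eqc_trans h5 h2|apply: le_trans h6 h3].
case: H => e he [h1 h2 h3]; exists e => //; split=> //; first exact: eqc_trans h2 hF.
exact: le_trans h3 hv.
Qed.

Lemma key_lt a c : key g a c < nkeys g.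
Proof. by rewrite /key /nkeys; have := code_le c; case: (a == n); lia. Qed.

Lemma key_n a c c' : a <= n -> key g a c = key g n c' -> a = n /\ code c = code c'.
Proof. by rewrite /key eqxx => ha; have := code_le c'; case: eqP => // ? ?; lia. Qed.

Lemma key_f a c a' c' : a' < n -> a <= n -> key g a c = key g a' c' -> a < n /\ code c = code c'.
Proof.
rewrite /key => ha' ha; rewrite (ltn_eqF ha'); have := code_le c.
case: eqP => [_|h] h1; first by lia.
by move=> /addIn ->; split=> //; rewrite ltn_neqAle ha andbT; apply/eqP.
Qed.

Lemma get_updE l a c v : eqc g (get (upd g l a c v)) (updF (get l) a c v).
Proof. by apply: eqc_ext => a' c' ha hc; rewrite get_mkE. Qed.

(** The entry at hand has a token with the key of [(a, c)] at [p], possibly another one; moving that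
    one leads to the desired signature. *)
Lemma dom_move N st k F v a c p y : Dom N (st, (k, false)) F v -> a <= n -> c < n -> p < n -> y < n ->
  F a c = p.+1 -> suppF g (updF F a c y.+1) <= Q ->
  Dom N.+1 (st, (k, false)) (updF F a c y.+1) (v + gd g p y)%R.
Proof.
move=> [e he [h1 h2 h3]] ha hc hp hy hF hs.
have [a' [c' [ha' hc' hg' hk]]] := eqc_find ha hc hF hp (key_lt a c) h2.
have hE : eqc g (get (moveE g e a' c' y).2.2.1) (updF F a c y.+1).
  apply: eqc_trans (get_updE _ _ _ _) _.
  by apply: eqc_upd => //; rewrite hg' hF.
have hc0 : cov g (tab N.+1) (moveE g e a' c' y).2.
  apply: (cov_round he); first by rewrite (suppF_eqc hE).
  constructor 3; exists a', c', y; split=> //.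
  by rewrite /moveE h1 /act hg' /= hp.
have H : Dom N.+1 e.1 (get (moveE g e a' c' y).2.2.1) (moveE g e a' c' y).2.2.2 by exact: Dom_cov hc0.
rewrite h1 in H; apply: (Dom_le H) => //=.
  by rewrite hg' /= lerD2r.
Qed.

(** The intended configuration simply erases the two tokens: connected tokens have positions beyond
    [n], which no count sees. The client of the entry may thus be joined to a facility different
    from [f]. *)
Lemma dom_conn N st k F v c f c' p q : Dom N (st, (k, false)) F v ->
  c < n -> f < n -> c' < n -> p < n -> q < n -> F n c = p.+1 -> F f c' = q.+1 -> code c = code c' ->
  suppF g (updF (updF F n c 0) f c' 0) <= Q ->
  Dom N.+1 (st, (k, false)) (updF (updF F n c 0) f c' 0) (v + gd g p q)%R.
Proof.
move=> [e he [h1 h2 h3]] hc hf hc' hp hq hF hF' hcc hs.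
have [a1 [c1 [ha1 hc1 hg1 hk1]]] := eqc_find (leqnn n) hc hF hp (key_lt n c) h2.
have [a2 [c2 [ha2 hc2 hg2 hk2]]] := eqc_find (ltnW hf) hc' hF' hq (key_lt f c') h2.
have [ea hcc1] := key_n ha1 hk1; rewrite {}ea in hg1 hk1 {ha1}.
have [hf2 hcc2] := key_f hf ha2 hk2.
have hE : eqc g (get (connE g e c1 a2 c2).2.2.1) (updF (updF F n c 0) f c' 0).
  apply: eqc_trans (get_updE _ _ _ _) _.
  apply: (@eqc_trans _ _ _ (updF (updF (get e.2.1) n c1 (n.+1 + a2)) a2 c2 n.+1)).
    by apply: eqc_upd => //; [rewrite get_mkE// ltnW|apply: get_updE].
  apply: (@eqc_trans _ _ _ (updF (updF (get e.2.1) n c1 (n.+1 + a2)) a2 c2 0)).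
    by apply: eqc_updv => //; [left|right].
  apply: eqc_upd => //; first by exact: ltnW.
    by rewrite /updF (ltn_eqF hf2) (ltn_eqF hf) /= hg2 hF'.
  apply: (@eqc_trans _ _ _ (updF (get e.2.1) n c1 0)).
    by apply: eqc_updv => //; [left; lia|right].
  by apply: eqc_upd => //; rewrite hg1 hF.
have hc0 : cov g (tab N.+1) (connE g e c1 a2 c2).2.
  apply: (cov_round he); first by rewrite (suppF_eqc hE).
  constructor 4; left; exists c1, a2, c2; split=> //.
  by rewrite /connE h1 /act hg1 hg2 /= hp hq hcc1 hcc2 hcc eqxx.
have H : Dom N.+1 e.1 (get (connE g e c1 a2 c2).2.2.1) (connE g e c1 a2 c2).2.2.2 by exact: Dom_cov hc0.
rewrite h1 in H; apply: (Dom_le H) => //=.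
  by rewrite hg1 hg2 /= lerD2r.
Qed.

Lemma dom_union N s t u k1 k2 F1 F2 v1 v2 : Dom N ((s, t), (k1, false)) F1 v1 ->
  Dom N ((t, u), (k2, false)) F2 v2 ->
  (forall a c, a <= n -> c < n -> F1 a c = 0 \/ F2 a c = 0) ->
  suppF g (fun a c => F1 a c + F2 a c) <= Q ->
  Dom N.+1 ((s, u), (k1 + k2, false)) (fun a c => F1 a c + F2 a c) (v1 + v2)%R.
Proof.
move=> [e he [h1 h2 h3]] [f hf [h4 h5 h6]] hd hs.
have [ie _ _] := inv_tab he; have [jf _ _] := inv_tab hf.
have hst : e.1.1.2 = f.1.1.1 by rewrite h1 h4.
have dis a c : get e.2.1 a c = 0 \/ get f.2.1 a c = 0 by eapply disU; eassumption.
have hE : eqc g (get (unionE g e f).2.2.1) (fun a c => F1 a c + F2 a c).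
  apply: (@eqc_trans _ _ _ (fun a c => get e.2.1 a c + get f.2.1 a c)).
    by apply: eqc_ext => a c ha hc; rewrite get_mkE.
  move=> k p hk hp; rewrite /cntF !SF_add//.
  by have := h2 k p hk hp; have := h5 k p hk hp; rewrite /cntF => -> ->.
have hc0 : cov g (tab N.+1) (unionE g e f).2.
  apply: (cov_round he); first by rewrite (suppF_eqc hE).
  constructor 4; right; exists f => //.
  by rewrite /unionE h1 h4 /= eqxx.
have := Dom_cov hc0; rewrite /unionE /= h1 h4 /= => H.
by apply: (Dom_le H) => //; apply: lerD.
Qed.

(** The single point [x]: row [n] holds its own client, and row [x] a demand for each client of [S],
    all waiting at [x]. *)
Definition rawF x (S : seq nat) a c :=
  if ((a == n) || (a == x) && (c \in S)) && ((a == n) ==> (c == x)) && (code c != 0) then x.+1 else 0.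

Lemma rawF_p x S a c p : rawF x S a c = p.+1 -> p = x.
Proof. by rewrite /rawF; case: ifP => // _ []. Qed.

Lemma supp_raw x S : suppF g (rawF x S) <= Q.
Proof.
apply: leq_trans hQ; apply: (@suppF_le _ _ _ [:: x]) => a c p _ _ /rawF_p -> _.
by rewrite inE.
Qed.

Lemma dom_leaf i b : i < n -> (~~ b || (gfac g (nth 0 o i) != 0)) ->
  Dom 0 ((i, i.+1), (nat_of_bool b, b)) (rawF (nth 0 o i) [::]) 0%R.
Proof.
move=> hi hb; set x := nth 0 o i.
have hx : x < n by apply: (o_nth o_perm).
have hE : eqc g (get (leafE g o i b).2.2.1) (rawF x [::]).
  apply: eqc_ext => a c ha hc; rewrite (get_leaf hg) hc /rawF -/x andbF orbF andbT.
  by case: (a == n).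
have hs : suppF g (get (leafE g o i b).2.2.1) <= Q by rewrite (suppF_eqc hE) supp_raw.
have hc0 : cov g (tab 0) (leafE g o i b).2.
  apply: (@hit_foldl _ _ _ _ i); [|by rewrite mem_iota| |exact: clean_nil].
    by move=> j; rewrite mem_iota => hj; apply: CCleaf.
  move=> z hz; have z1 : Clean (ins g z (leafE g o i false)).
    by apply: ins_clean => // h; apply: sound_leaf.
  case: b {hE} hb hs => hb hs; first exact: ins_hit.
  by apply: ins_cov => //; apply: ins_hit.
by apply: (Dom_le (Dom_cov hc0)).
Qed.

Lemma SF_le h F F' : (forall a c, a <= n -> c < n -> h a c (F a c) <= h a c (F' a c)) ->
  SF addn n h F <= SF addn n h F'.
Proof.
move=> H; rewrite /SF big_seq [leqRHS]big_seq; apply: leq_sum => a; rewrite mem_iota ltnS => ha.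
rewrite big_seq [leqRHS]big_seq; apply: leq_sum => c; rewrite mem_iota => hc; exact: H.
Qed.

Lemma dom_addraw i S : i < n -> gfac g (nth 0 o i) != 0 -> uniq S ->
  {subset S <= iota 0 n} ->
  Dom (size S) ((i, i.+1), (1, true)) (rawF (nth 0 o i) S) 0%R.
Proof.
move=> hi hf; have := @dom_leaf i true hi; rewrite hf => /(_ isT); set x := nth 0 o i => H.
have hx : x < n by apply: (o_nth o_perm).
elim: S => //= c S IH /andP[hcS hu] hsub.
have {}IH : Dom (size S) (i, i.+1, (1, true)) (rawF x S) 0%R.
  by apply: IH => // y hy; apply: hsub; rewrite in_cons hy orbT.
have hc : c < n by have := hsub c (mem_head _ _); rewrite mem_iota.
have hE0 : forall a c', rawF x (c :: S) a c' = if code c != 0 then updF (rawF x S) x c x.+1 a c' else rawF x S a c'.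
  move=> a c'; rewrite /rawF /updF in_cons.
  case: (eqVneq (code c) 0) => [h0|h0] /=.
    case: (eqVneq c' c) => [->|hne] //=; first by rewrite h0 !andbF.
  case: (eqVneq a x) => [->|hax] //=; rewrite ?(ltn_eqF hx) //=.
  by case: (eqVneq c' c) => [->|hne] //=; rewrite h0.
case: (eqVneq (code c) 0) => h0.
  by apply: (Dom_le IH) => //; apply: eqc_ext => a c' _ _; rewrite hE0 h0.
have hE1 : eqc g (rawF x (c :: S)) (updF (rawF x S) x c x.+1).
  by apply: eqc_ext => a c' _ _; rewrite hE0 h0.
case: IH => e he [h1 h2 h3].
have [ie _ _] := inv_tab he.
have [_ _ _ hraw] : [/\ e.1.1.2 = e.1.1.1.+1, e.1.2.1 = 1, gfac g (nth 0 o e.1.1.1) != 0 &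
    forall a c, get e.2.1 a c != 0 -> get e.2.1 a c = (nth 0 o e.1.1.1).+1 /\
      (a < n -> a = nth 0 o e.1.1.1)] by apply: I_raw; rewrite ?h1.
rewrite h1 /= -/x in hraw.
(* The column [c] itself may be occupied in the entry that represents [S]. Some column of the same
   type is free: otherwise the entry would have at least as many demands of this type as [c :: S],
   whereas it has exactly those of [S], one less. *)
have [c1 [hc1 hcc1 hz1]] : exists c1, [/\ c1 < n, code c1 = code c & get e.2.1 x c1 = 0].
  apply: contrapT => hno.
  have hall c1 : c1 < n -> code c1 = code c -> get e.2.1 x c1 = x.+1.
    move=> q1 q2; case: (eqVneq (get e.2.1 x c1) 0) => [q3|/hraw[-> //]].
    by case: hno; exists c1.
  have := @cntF_upd _ g (rawF x S) x c x.+1 (key g x c) x (ltnW hx) hc.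
  have -> : rawF x S x c = 0 by rewrite /rawF (ltn_eqF hx) (negbTE hcS) andbF.
  rewrite !eqxx /= addn0 -(h2 _ _ (key_lt x c) hx) => hcnt.
  have : cntF g (updF (rawF x S) x c x.+1) (key g x c) x <= cntF g (get e.2.1) (key g x c) x.
    apply: SF_le => a c' ha hc'; case: andP => // -[/eqP q1 /eqP q2].
    have [han hcc'] := key_f hx ha q2.
    have hax : a = x.
      move: q1; rewrite /updF; case: ifP => [/andP[/eqP-> //]|_].
      by rewrite /rawF (ltn_eqF han) /=; case: (eqVneq a x).
    by rewrite hax hall// eqxx -q2 hax eqxx.
  by rewrite hcnt; lia.
have hE : eqc g (get (addE g o e c1).2.2.1) (updF (rawF x S) x c x.+1).
  rewrite /addE h1 /= -/x; apply: eqc_trans (get_updE _ _ _ _) _.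
  apply: eqc_upd => //; try exact: ltnW.
    by rewrite /key hcc1.
  by rewrite hz1 /rawF (ltn_eqF hx) (negbTE hcS) andbF.
have hc0 : cov g (tab (size S).+1) (addE g o e c1).2.
  apply: (cov_round he).
    by rewrite (suppF_eqc hE) -(suppF_eqc hE1) supp_raw.
  constructor 2; exists c1 => //.
  by rewrite /addE h1 /= -/x hz1 hcc1 h0.
have := Dom_cov hc0; rewrite /addE /= h1 => H1.
apply: (Dom_le H1) => //.
apply: eqc_trans (eqc_sym hE1); move: hE; rewrite /addE /= h1; exact.
Qed.

Definition fairC F x := forall i, i < l0 ->
  let q := ((cntF g F (i.+1 + l0.+1) x)%:R / (\sum_(j <- iota 0 l0) cntF g F (j.+1 + l0.+1) x)%:R)%R in
  (galpha g i <= q)%R /\ (q <= gbeta g i)%R.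

Lemma dom_fac i S : i < n -> gfac g (nth 0 o i) != 0 -> uniq S -> {subset S <= iota 0 n} ->
  fairC (rawF (nth 0 o i) S) (nth 0 o i) ->
  Dom (size S).+1 ((i, i.+1), (1, false)) (rawF (nth 0 o i) S) 0%R.
Proof.
move=> hi hf hu hsub; set x := nth 0 o i => hfair.
have hx : x < n by apply: (o_nth o_perm).
have [e he [h1 h2 h3]] := dom_addraw hi hf hu hsub; rewrite -/x in h2.
have hB : l0 <= B by case: hg => _ _ _ _ [h _ _ _ _]; lia.
have hc0 : cov g (tab (size S).+1) (sealE g o e).2.
  apply: (cov_round he); first by rewrite /= (suppF_eqc h2) supp_raw.
  constructor 1; rewrite /sealE h1 /= -/x; congr (_, _); apply/esym.
  have hk j : j < l0 -> cnt g e.2.1 (j.+1 + l0.+1) x = cntF g (rawF x S) (j.+1 + l0.+1) x.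
    by move=> hj; rewrite cntE// h2// /nkeys; lia.
  rewrite /fair (iotE hB) sumBE//; apply/allP => j; rewrite mem_iota => hj.
  have [q1 q2] := hfair j hj.
  have -> : \sum_(j <- iota 0 l0) cnt g e.2.1 (j.+1 + l0.+1) x =
     \sum_(j <- iota 0 l0) cntF g (rawF x S) (j.+1 + l0.+1) x.
    by apply: eq_big_seq => j'; rewrite mem_iota => hj'; rewrite hk.
  by rewrite hk// q1 q2.
by have := Dom_cov hc0; rewrite /sealE /= h1 /= => H1; apply: (Dom_le H1).
Qed.

End Rules.
(** * Routing a solution through portals *)

Lemma ler_sum_mem (R : realType) (I : eqType) (s : seq I) (F G : I -> R) :
  (forall i, i \in s -> (F i <= G i)%R) -> (\sum_(i <- s) F i <= \sum_(i <- s) G i)%R.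
Proof. by move=> h; rewrite big_seq [leRHS]big_seq; apply: ler_sum. Qed.

Section Completeness.
Variable R : realType.
Variable g : ctx R.
Hypothesis hg : okg g.
Notation n := (cn g).
Notation B := (cB g).
Notation l0 := (cl g).
Notation Q := (cQ g).
Notation entry := (entry R).
Notation code := (gcode g).
Hypothesis d_ge0 : forall x y, (0 <= gd g x y)%R.
Hypothesis d_sym : forall x y, gd g x y = gd g y x.
Hypothesis d_xx : forall x, gd g x x = 0%R.
Hypothesis d_tri : forall x y z, x < n -> y < n -> z < n -> (gd g x z <= gd g x y + gd g y z)%R.
Hypothesis code_le : forall c, code c <= l0.
Variable o : seq nat.
Hypothesis o_perm : perm_eq o (iota 0 n).
Hypothesis hsig : sigs g < B.
Hypothesis hQ : 0 < Q.
Notation Dom := (Dom g o).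
Notation dom_move := (dom_move hg d_sym d_xx d_tri code_le o_perm hsig hQ).
Notation dom_conn := (dom_conn hg d_sym d_xx d_tri code_le o_perm hsig hQ).
Notation dom_union := (dom_union hg d_sym d_xx d_tri code_le o_perm hsig).
Notation dom_leaf := (dom_leaf hg d_sym d_xx d_tri code_le o_perm hsig hQ).
Notation dom_fac := (dom_fac hg d_sym d_xx d_tri code_le o_perm hsig hQ).
Notation Dom_le := (Dom_le hg d_sym d_xx d_tri code_le o_perm hsig).

Definition inP (F : nat -> nat -> nat) (P : seq nat) :=
  forall a c, a <= n -> c < n -> F a c != 0 -> (F a c).-1 \in P /\ (F a c).-1 < n.

Lemma supp_inP F P : inP F P -> size P <= Q -> suppF g F <= Q.
Proof.
move=> h hP; apply: leq_trans hP; apply: suppF_le => a c p ha hc e _.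
by have [] := h a c ha hc; rewrite e.
Qed.

Definition mixF (F F' : nat -> nat -> nat) (L : seq (nat * nat)) a c :=
  if (a, c) \in L then F' a c else F a c.

(** The tokens are moved one at a time. Every intermediate configuration lives on [P], which
    contains the old and the new positions, so none exceeds the support allowed in the table; hence
    [Q] is twice the number of portals of a cell. *)
Lemma relocate L N st k F F' v P : uniq L -> (forall t, t \in L -> t.1 <= n /\ t.2 < n) ->
  (forall t, t \in L -> (F t.1 t.2 == 0) = (F' t.1 t.2 == 0)) ->
  inP F P -> inP F' P -> size P <= Q -> Dom N (st, (k, false)) F v ->
  Dom (N + size L) (st, (k, false)) (mixF F F' L)
    (v + \sum_(t <- L) (if F t.1 t.2 == 0%N then 0 else gd g (F t.1 t.2).-1 (F' t.1 t.2).-1))%R.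
Proof.
move=> hu hr h0 hF hF' hP H; elim: L hu hr h0 => [|[a c] L IH] /=.
  by move=> _ _ _; rewrite addn0 big_nil addr0; apply: (Dom_le H).
move=> /andP[hn hu] hr h0.
have {}IH := IH hu (fun t ht => hr t (mem_behead (s := _ :: _) ht)) (fun t ht => h0 t (mem_behead (s := _ :: _) ht)).
have [/= ha hc] := hr (a, c) (mem_head _ _).
have /= e0 := h0 (a, c) (mem_head _ _).
have inmix L' : inP (mixF F F' L') P.
  by move=> a' c' ha' hc'; rewrite /mixF; case: ifP => _; [apply: hF'|apply: hF].
have hext : forall a' c', mixF F F' ((a, c) :: L) a' c' = updF (mixF F F' L) a c (F' a c) a' c'.
  move=> a' c'; rewrite /mixF /updF in_cons xpair_eqE.
  by case: (eqVneq a' a) => [->|_] //=; case: (eqVneq c' c) => [->|_].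
have hmixac : mixF F F' L a c = F a c by rewrite /mixF (negbTE hn).
rewrite big_cons /=; case: ifP => hFac.
  rewrite add0r; apply: (Dom_le IH) => //; first by rewrite addnS.
  apply: eqc_ext => a' c' _ _; rewrite hext /updF; case: ifP => // /andP[/eqP-> /eqP->].
  by rewrite hmixac (eqP hFac); move: e0; rewrite hFac => /esym/eqP ->.
have hF0 : F a c != 0 by rewrite hFac.
have hF'0 : F' a c != 0 by rewrite -e0 hFac.
have [p1 p2] := hF _ _ ha hc hF0; have [q1 q2] := hF' _ _ ha hc hF'0.
have hS : (F' a c).-1.+1 = F' a c by case: (F' a c) hF'0.
have hs : suppF g (updF (mixF F F' L) a c (F' a c).-1.+1) <= Q.
  apply: (@supp_inP _ P) => //.
  by move=> a' c' ha' hc' h; rewrite hS -hext in h *; apply: (inmix _ _ _ ha' hc' h).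
have e1 : mixF F F' L a c = (F a c).-1.+1 by rewrite hmixac prednK ?lt0n.
have H1 := dom_move IH ha hc p2 q2 e1 hs; apply: (Dom_le H1).
- by rewrite addnS.
- by rewrite -addrA [(gd g _ _ + _)%R]addrC.
- by rewrite hS; apply: eqc_ext => a' c' _ _; rewrite hext.
Qed.

Variable mu : nat -> nat.
Definition cls := [seq c <- iota 0 n | code c != 0].
Hypothesis mu_fac : forall c, c \in cls -> mu c < n /\ gfac g (mu c) != 0.

Lemma in_cls c : (c \in cls) = (c < n) && (code c != 0).
Proof. by rewrite mem_filter mem_iota /= andbC. Qed.

(* The configuration of the set [w] in which the edges of [mu] inside [w] are connected, and both kinds
   of tokens of the edges leaving [w] wait at the portal of their home. *)
Definition canF (w : seq nat) (ga : nat -> nat) a c :=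
  if c \in cls then
    if a == n then if (c \in w) && (mu c \notin w) then (ga c).+1 else 0
    else if [&& a == mu c, mu c \in w & c \notin w] then (ga (mu c)).+1 else 0
  else 0.

(* [A c] pays for moving each of the two tokens of [c], and [E c] for its last move before the
   connection. *)
Definition V (w : seq nat) (A E : nat -> R) : R :=
  (\sum_(c <- cls) ((c \in w)%:R * A c + (mu c \in w)%:R * A c +
    (if (c \in w) && (mu c \in w) then gd g c (mu c) + E c + E c else 0)))%R.

Definition isopen f := has (fun c => mu c == f) cls.
Definition kw (w : seq nat) := count isopen w.

Lemma canF_n w ga c : c \in cls ->
  canF w ga n c = if (c \in w) && (mu c \notin w) then (ga c).+1 else 0.
Proof. by rewrite /canF => ->; rewrite eqxx. Qed.

Lemma canF_mu w ga c : c \in cls ->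
  canF w ga (mu c) c = if (mu c \in w) && (c \notin w) then (ga (mu c)).+1 else 0.
Proof. by move=> hc; have [h _] := mu_fac hc; rewrite /canF hc (ltn_eqF h) eqxx. Qed.

Lemma canF_0 w ga a c : (c \notin cls) || (a != n) && (a != mu c) -> canF w ga a c = 0.
Proof.
by rewrite /canF; case: (c \in cls) => //= /andP[/negbTE-> /negbTE->].
Qed.

Lemma canF_cases (G : nat -> nat -> Prop) : (forall a c, (c \notin cls) || (a != n) && (a != mu c) -> G a c) ->
  (forall c, c \in cls -> G n c) -> (forall c, c \in cls -> G (mu c) c) -> forall a c, G a c.
Proof.
move=> h0 h1 h2 a c; case: (boolP ((c \notin cls) || (a != n) && (a != mu c))) => [|]; first exact: h0.
rewrite negb_or negbK negb_and !negbK => /andP[hc /orP[/eqP->|/eqP->]]; [exact: h1|exact: h2].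
Qed.

Lemma canF_perm w w' ga : w =i w' -> forall a c, canF w ga a c = canF w' ga a c.
Proof. by move=> e a c; rewrite /canF !e. Qed.

Lemma V_perm w w' A E : w =i w' -> V w A E = V w' A E.
Proof. by move=> e; apply: eq_bigr => c _; rewrite !e. Qed.

Lemma V_le w A E A' E' : (forall c, c \in cls -> (A c <= A' c)%R) ->
  (forall c, c \in cls -> c \in w -> mu c \in w -> (A c + E c <= A' c + E' c)%R) -> (V w A E <= V w A' E')%R.
Proof.
move=> h1 h2; apply: ler_sum_mem => c hc; have := h1 c hc; have := h2 c hc.
by case: (c \in w); case: (mu c \in w) => /= h3; [have := h3 isT isT| | |]; rewrite ?mul1r ?mul0r; lra.
Qed.

Definition toks := [seq (n, c) | c <- cls] ++ [seq (mu c, c) | c <- cls].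

Lemma cls_uniq : uniq cls. Proof. by rewrite filter_uniq ?iota_uniq. Qed.

Lemma cls_lt c : c \in cls -> c < n. Proof. by rewrite in_cls => /andP[]. Qed.

Lemma size_cls : size cls <= n.
Proof. by rewrite size_filter (leq_trans (count_size _ _))// size_iota. Qed.

Lemma toks_uniq : uniq toks.
Proof.
rewrite cat_uniq !map_inj_in_uniq ?cls_uniq//= ?andbT; try by move=> c c' _ _ [].
apply/hasPn => t /mapP[c hc ->]; apply/negP => /mapP[c' _ [e _]].
by have [] := mu_fac hc; rewrite e ltnn.
Qed.

Lemma toks_lt t : t \in toks -> t.1 <= n /\ t.2 < n.
Proof.
rewrite mem_cat => /orP[] /mapP[c hc ->] /=; split; rewrite ?cls_lt//.
by apply: ltnW; case: (mu_fac hc).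
Qed.

(** A change of portals from [ga] to [ga'] concerns only edges with exactly one end in [w]. Each
    client contributes at most two tokens, which gives [n + n] rounds. *)
Lemma shift N st k w ga ga' A E eta P :
  Dom N (st, (k, false)) (canF w ga) (V w A E) ->
  (forall c, c \in cls -> (0 <= eta c)%R) -> size P <= Q ->
  (forall c x, c \in cls -> (c \in w) != (mu c \in w) -> x \in w -> (x == c) || (x == mu c) ->
    [/\ ga x \in P, ga' x \in P, ga x < n, ga' x < n & (gd g (ga x) (ga' x) <= eta c)%R]) ->
  Dom (N + (n + n)) (st, (k, false)) (canF w ga') (V w (fun c => A c + eta c)%R E).
Proof.
move=> H he hP hx.
have H0 : inP (canF w ga) P /\ inP (canF w ga') P.
  split; move=> a c _ _; move: a c; apply: canF_cases => [a c /canF_0 -> //|c hc|c hc].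
  - rewrite canF_n//; case: ifP => // /andP[h1 h2] _.
    by have [] := hx c c hc; rewrite ?eqxx ?h1 ?(negbTE h2).
  - rewrite canF_mu//; case: ifP => // /andP[h1 h2] _.
    by have [] := hx c (mu c) hc; rewrite ?eqxx ?orbT ?h1 ?(negbTE h2).
  - rewrite canF_n//; case: ifP => // /andP[h1 h2] _.
    by have [] := hx c c hc; rewrite ?eqxx ?h1 ?(negbTE h2).
  - rewrite canF_mu//; case: ifP => // /andP[h1 h2] _.
    by have [] := hx c (mu c) hc; rewrite ?eqxx ?orbT ?h1 ?(negbTE h2).
have [hp hp'] := H0.
have H1 := relocate toks_uniq toks_lt _ hp hp' hP H.
have {}H1 := H1 _; apply: (Dom_le (H1 _)).
- move=> t; rewrite mem_cat => /orP[] /mapP[c hc ->] /=.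
    by rewrite !canF_n//; case: ifP.
  by rewrite !canF_mu//; case: ifP.
- by rewrite leq_add2l size_cat !size_map leq_add ?size_cls.
- rewrite big_cat !big_map /= -big_split /V -big_split /=.
  apply: ler_sum_mem => c hc; rewrite canF_n// canF_mu// canF_n// canF_mu//.
  have := hx c c hc; have := hx c (mu c) hc; rewrite !eqxx orbT => h1 h2.
  have h0 := he c hc.
  case: (boolP (c \in w)) h1 h2 => hcw; case: (boolP (mu c \in w)) => hmw h1 h2 /=;
    rewrite ?mul1r ?mul0r; try lra.
    by have [_ _ _ _] := h2 isT isT isT; lra.
  by have [_ _ _ _] := h1 isT isT isT; lra.
- apply: eqc_ext => a c _ _; rewrite /mixF; case: ifP => // ht.
  rewrite !canF_0//; move: ht; rewrite mem_cat => /negbT; rewrite negb_or.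
    move=> /andP[h1 h2]; case: (boolP (c \in cls)) => //= hc; apply/andP; split.
      by apply: contra h1 => /eqP->; apply: map_f.
    by apply: contra h2 => /eqP->; apply: (map_f (fun c => (mu c, c))).
  move=> /andP[h1 h2]; case: (boolP (c \in cls)) => //= hc; apply/andP; split.
    by apply: contra h1 => /eqP->; apply: map_f.
  by apply: contra h2 => /eqP->; apply: (map_f (fun c => (mu c, c))).
Qed.

Definition offF (F : nat -> nat -> nat) (L : seq nat) a c :=
  if (c \in L) && ((a == n) || (a == mu c)) then 0 else F a c.

Lemma connect_all L N st k F v P : uniq L -> {subset L <= cls} -> inP F P -> size P <= Q ->
  (forall c, c \in L -> F n c != 0 /\ F (mu c) c != 0) ->
  Dom N (st, (k, false)) F v ->
  Dom (N + size L) (st, (k, false)) (offF F L)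
    (v + \sum_(c <- L) gd g (F n c).-1 (F (mu c) c).-1)%R.
Proof.
move=> hu hs hF hP h0 H; elim: L hu hs h0 => [|c L IH] /=.
  by move=> _ _ _; rewrite addn0 big_nil addr0; apply: (Dom_le H).
move=> /andP[hn hu] hs h0.
have hc : c \in cls by apply: hs; rewrite mem_head.
have {}IH := IH hu (fun t ht => hs t (mem_behead (s := _ :: _) ht)) (fun t ht => h0 t (mem_behead (s := _ :: _) ht)).
have [f1 f2] := h0 c (mem_head _ _).
have [hmu _] := mu_fac hc; have hcn := cls_lt hc.
have [p1 p2] := hF _ _ (leqnn n) hcn f1; have [q1 q2] := hF _ _ (ltnW hmu) hcn f2.
have e1 : offF F L n c = (F n c).-1.+1 by rewrite /offF (negbTE hn) prednK ?lt0n.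
have e2 : offF F L (mu c) c = (F (mu c) c).-1.+1 by rewrite /offF (negbTE hn) prednK ?lt0n.
have hext : forall a c', updF (updF (offF F L) n c 0) (mu c) c 0 a c' = offF F (c :: L) a c'.
  move=> a c'; rewrite /updF /offF in_cons.
  case: (eqVneq c' c) => [->|hne] /=; rewrite ?andbF// ?andbT.
  by case: (eqVneq a (mu c)) => //= _; rewrite ?orbT//; case: (eqVneq a n) => //=; rewrite (negbTE hn).
have hs' : suppF g (updF (updF (offF F L) n c 0) (mu c) c 0) <= Q.
  apply: (@supp_inP _ P) => // a c' ha hc'; rewrite hext /offF; case: ifP => // _; exact: hF.
have H1 := dom_conn IH hcn hmu hcn p2 q2 e1 e2 erefl hs'; apply: (Dom_le H1).
- by rewrite addnS.
- by rewrite big_cons -addrA [(gd g _ _ + _)%R]addrC.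
- by apply: eqc_ext => a c' _ _; rewrite hext.
Qed.

(** One round concatenates the intervals, and at most [n] further ones connect the edges between [W]
    and [w], whose two tokens now wait in the same entry. A connection between portals exceeds the
    length of the edge by at most [E c] for each end. *)
Lemma join N i j k (W w : seq nat) ga A E P :
  uniq (W ++ w) -> size P <= Q ->
  Dom N ((i, j), (kw W, false)) (canF W ga) (V W A E) ->
  Dom N ((j, k), (kw w, false)) (canF w ga) (V w A E) ->
  (forall c x, c \in cls -> ((c \in W) != (mu c \in W)) || ((c \in w) != (mu c \in w)) ->
     x \in W ++ w -> (x == c) || (x == mu c) -> ga x \in P /\ ga x < n) ->
  (forall c, c \in cls -> (c \in W) && (mu c \in w) || (c \in w) && (mu c \in W) ->
     (gd g (ga c) (ga (mu c)) <= gd g c (mu c) + E c + E c)%R) ->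
  Dom (N + n.+1) ((i, k), (kw (W ++ w), false)) (canF (W ++ w) ga) (V (W ++ w) A E).
Proof.
move=> hu hP H1 H2 hpos hE.
have dis x : x \in W -> x \in w -> False.
  by move: hu; rewrite cat_uniq => /and3P[_ /hasPn h _] h1 h2; have := h x h2; rewrite /= h1.
set F := fun a c => canF W ga a c + canF w ga a c.
have hF : inP F P.
  move=> a c _ _; move: a c; apply: canF_cases => [a c h|c hc|c hc]; first by rewrite /F !canF_0.
    rewrite /F !canF_n//; have := hpos c c hc; have := dis c; rewrite mem_cat eqxx.
    by case: (c \in W); case: (c \in w); case: (mu c \in W); case: (mu c \in w);
      rewrite /= ?addn0 ?add0n => // h1 h2 _; first [by case: (h1 isT isT) | by apply: h2].
  rewrite /F !canF_mu//; have := hpos c (mu c) hc; have := dis (mu c); rewrite mem_cat eqxx orbT.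
  by case: (c \in W); case: (c \in w); case: (mu c \in W); case: (mu c \in w);
    rewrite /= ?addn0 ?add0n => // h1 h2 _; first [by case: (h1 isT isT) | by apply: h2].
have H3 : Dom N.+1 ((i, k), (kw W + kw w, false)) F (V W A E + V w A E)%R.
  apply: dom_union H1 H2 _ _; last exact: supp_inP hF hP.
  move=> a c _ _; move: a c; apply: canF_cases => [a c h|c hc|c hc]; first by left; rewrite canF_0.
    rewrite !canF_n//; case: ifP => h1; [right|by left].
    by case: ifP => // /andP[h2 _]; case: (dis c) => //; case/andP: h1.
  rewrite !canF_mu//; case: ifP => h1; [right|by left].
  by case: ifP => // /andP[h2 _]; case: (dis (mu c)) => //; case/andP: h1.
pose X c := (c \in W) && (mu c \in w) || (c \in w) && (mu c \in W).
pose L := [seq c <- cls | X c].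
have hX c : c \in cls -> X c -> F n c = (ga c).+1 /\ F (mu c) c = (ga (mu c)).+1.
  move=> hc; rewrite /X /F !canF_n// !canF_mu//; have := dis c; have := dis (mu c).
  by case: (c \in W); case: (c \in w); case: (mu c \in W); case: (mu c \in w);
    rewrite /= ?addn0 ?add0n => // h1 h2 _;
    first [by case: (h1 isT isT) | by case: (h2 isT isT) | by []].
have H4 : Dom (N.+1 + size L) ((i, k), (kw W + kw w, false)) (offF F L)
    (V W A E + V w A E + \sum_(c <- L) gd g (F n c).-1 (F (mu c) c).-1)%R.
  apply: connect_all hF hP _ H3; first by rewrite filter_uniq ?cls_uniq.
    by move=> c; rewrite mem_filter => /andP[].
  by move=> c; rewrite mem_filter => /andP[h1 h2]; have [-> ->] := hX c h2 h1.
rewrite /kw count_cat -/(kw W) -/(kw w); apply: (Dom_le H4).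
- by rewrite addSnnS leq_add2l ltnS (leq_trans _ size_cls)// size_filter count_size.
- rewrite big_filter big_mkcond /V -!big_split /=; apply: ler_sum_mem => c hc.
  have := hX c hc; have := hE c hc; rewrite -/(X c) !mem_cat /X; have := dis c; have := dis (mu c).
  by case: (c \in W); case: (c \in w); case: (mu c \in W); case: (mu c \in w) => //= h1 h2 h3 h4;
    try (by case: (h1 isT isT)); try (by case: (h2 isT isT)); try (have [-> ->] := h4 isT; have := h3 isT);
    rewrite /= ?mul1r ?mul0r; lra.
apply: eqc_ext => a c _ _; move: a c; apply: canF_cases => [a c h|c hc|c hc].
- by rewrite /offF /F !canF_0//; case: ifP.
- rewrite /offF eqxx /= andbT mem_filter hc andbT /F !canF_n// !mem_cat /X; have := dis c; have := dis (mu c).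
  by case: (c \in W); case: (c \in w); case: (mu c \in W); case: (mu c \in w) => /= h1 h2;
    rewrite ?addn0 ?add0n //; first [by case: (h1 isT isT) | by case: (h2 isT isT)].
rewrite /offF eqxx orbT andbT mem_filter hc andbT /F !canF_mu// !mem_cat /X; have := dis c; have := dis (mu c).
by case: (c \in W); case: (c \in w); case: (mu c \in W); case: (mu c \in w) => /= h1 h2;
  rewrite ?addn0 ?add0n //; first [by case: (h1 isT isT) | by case: (h2 isT isT)].
Qed.

Fixpoint chunks N j ga A E (ws : seq (seq nat)) :=
  if ws is w :: ws' then Dom N ((j, j + size w), (kw w, false)) (canF w ga) (V w A E) /\
    chunks N (j + size w) ga A E ws'
  else True.

(** The predicate [sep] singles out the edges leaving some chunk. The portal map has to be
    controlled on their ends only, because other edges have no waiting tokens. *)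
Lemma merge ws N N' i W ga A E P (sep : nat -> bool) :
  uniq (W ++ flatten ws) -> size P <= Q -> N' <= N ->
  Dom N ((i, i + size W), (kw W, false)) (canF W ga) (V W A E) ->
  chunks N' (i + size W) ga A E ws ->
  (forall c w, c \in cls -> w \in W :: ws -> (c \in w) != (mu c \in w) -> sep c) ->
  (forall c x, c \in cls -> sep c -> x \in W ++ flatten ws -> (x == c) || (x == mu c) ->
     ga x \in P /\ ga x < n) ->
  (forall c, c \in cls -> sep c -> c \in W ++ flatten ws -> mu c \in W ++ flatten ws ->
     (gd g (ga c) (ga (mu c)) <= gd g c (mu c) + E c + E c)%R) ->
  Dom (N + size ws * n.+1) ((i, i + size (W ++ flatten ws)), (kw (W ++ flatten ws), false))
    (canF (W ++ flatten ws) ga) (V (W ++ flatten ws) A E).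
Proof.
move=> hu hP; elim: ws N W hu => [|w ws IH] N W hu hN hW /=.
  by move=> _ _ _ _; rewrite mul0n addn0 cats0.
move=> [hw hws] hsep hpos hE.
have hu1 : uniq (W ++ w) by move: hu; rewrite /= catA cat_uniq => /and3P[].
have sub1 x : x \in W ++ w -> x \in W ++ (w ++ flatten ws) by move=> h; rewrite catA mem_cat h.
have sepw c : c \in cls -> ((c \in W) != (mu c \in W)) || ((c \in w) != (mu c \in w)) -> sep c.
  by move=> hc /orP[]; apply: hsep => //; rewrite !in_cons eqxx ?orbT.
have dis x : x \in W -> x \in w -> False.
  by move: hu1; rewrite cat_uniq => /and3P[_ /hasPn h _] h1 h2; have := h x h2; rewrite /= h1.
have hJ : Dom (N + n.+1) ((i, i + size W + size w), (kw (W ++ w), false)) (canF (W ++ w) ga) (V (W ++ w) A E).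
  apply: (join hu1 hP hW _ _ _).
  - by apply: (Dom_le hw).
  - by move=> c x hc h hx; apply: hpos => //; [apply: sepw|apply: sub1].
  move=> c hc h; apply: hE => //.
  - apply: sepw => //; have := dis c; have := dis (mu c); move: h.
    by case: (c \in W); case: (c \in w); case: (mu c \in W); case: (mu c \in w) => //= _ h1 h2;
      try (by case: (h1 isT isT)); try (by case: (h2 isT isT)).
  - by apply: sub1; rewrite mem_cat; case/orP: h => /andP[-> _]; rewrite ?orbT.
  - by apply: sub1; rewrite mem_cat; case/orP: h => /andP[_ ->]; rewrite ?orbT.
rewrite -addnA -size_cat in hJ; rewrite -addnA -size_cat in hws.
have := IH (N + n.+1) (W ++ w); rewrite -!catA mulSn addnA; apply=> //.
- exact: leq_trans hN (leq_addr _ _).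
- move=> c w' hc; rewrite in_cons => /orP[/eqP->|hw'].
    rewrite !mem_cat => h; apply: sepw => //; move: h.
    by case: (c \in W); case: (c \in w); case: (mu c \in W); case: (mu c \in w).
  by apply: hsep => //; rewrite !in_cons hw' !orbT.
Qed.

Definition ncl i f := count (fun c => (code c == i.+1) && (mu c == f)) (iota 0 n).
Hypothesis mu_fair : forall f, f < n -> isopen f -> forall i, i < l0 ->
  let q := ((ncl i f)%:R / (\sum_(j <- iota 0 l0) ncl j f)%:R)%R in
  (galpha g i <= q)%R /\ (q <= gbeta g i)%R.

Lemma cnt_raw x i : x < n -> i < l0 ->
  cntF g (rawF g x [seq c <- cls | mu c == x]) (i.+1 + l0.+1) x = ncl i x.
Proof.
move=> hx hi; have ix : x \in iota 0 n.+1 by rewrite mem_iota add0n ltnS (ltnW hx).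
rewrite /cntF /SF (bigD1_seq x ix (iota_uniq _ _)) [X in _ + X = _]big1_seq ?addn0; last first.
  move=> a /andP[hax]; rewrite mem_iota ltnS => ha; apply: big1_seq => c /andP[_]; rewrite mem_iota => hc.
  rewrite (key_dem code_le o_perm)//; case: (eqVneq a n) => [|han] /=; first by rewrite andbF.
  by rewrite /rawF (negbTE han) (negbTE hax).
rewrite /ncl -sum1_count [RHS]big_mkcond; apply: eq_big_seq => c; rewrite mem_iota => /andP[_ hc']; have {hc'}hc : c < n := hc'.
rewrite (key_dem code_le o_perm) ?(ltnW hx)// /rawF (ltn_eqF hx) eqxx /= mem_filter in_cls hc /=.
case: (code c =P i.+1) => [->|] /=; last by rewrite !andbF.
by rewrite !andbT; case: (mu c == x); rewrite ?eqxx.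
Qed.

Lemma V_ge0 w A E : (forall c, 0 <= A c)%R -> (forall c, 0 <= E c)%R -> (0 <= V w A E)%R.
Proof.
move=> hA hE; apply: sumr_ge0 => c _; have := hA c; have := hE c; have := d_ge0 c (mu c).
by case: (c \in w); case: (mu c \in w); rewrite /= ?mul1r ?mul0r; lra.
Qed.

(** The prototype of an open [x] is its cluster under [mu], which is fair by assumption. Building
    and sealing it takes at most [n + 1] rounds after the leaf. *)
Lemma single i : i < n ->
  Dom n.+2 ((i, i.+1), (kw [:: nth 0 o i], false)) (canF [:: nth 0 o i] id) 0%R.
Proof.
move=> hi; set x := nth 0 o i; have hx : x < n by apply: (o_nth o_perm).
rewrite /kw /= addn0; case: (boolP (isopen x)) => hop; last first.
  have H := @dom_leaf i false hi isT; apply: (Dom_le H) => //; rewrite -/x.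
  have hno c : c \in cls -> mu c != x by move=> hc; move/hasPn: hop => /(_ c hc).
  apply: eqc_ext => a c _ hc; move: a c hc.
  suff : forall a c, c < n -> rawF g x [::] a c = canF [:: x] id a c by [].
  move=> a c hc; case: (boolP (c \in cls)) => hcl; last first.
    by rewrite canF_0 ?hcl// /rawF; move: hcl; rewrite in_cls hc /= negbK => /eqP->; rewrite andbF.
  have hcc : code c != 0 by move: hcl; rewrite in_cls => /andP[].
  rewrite /rawF /canF hcl hcc andbF orbF andbT !inE (negbTE (hno _ hcl)) andbF andbT.
  by case: (a == n) => //=; case: (eqVneq c x) => [->|].
have hfx : gfac g x != 0.
  by case/hasP: (hop) => c hc /eqP <-; case: (mu_fac hc).
set S := [seq c <- cls | mu c == x].
have hS : {subset S <= iota 0 n} by move=> c; rewrite mem_filter mem_iota => /andP[_ /cls_lt].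
have huS : uniq S by rewrite filter_uniq ?cls_uniq.
have hsS : size S <= n by rewrite size_filter (leq_trans (count_size _ _)) ?size_cls.
have hfair : fairC g (rawF g x S) x.
  move=> j hj; have := mu_fair hx hop hj; rewrite /= cnt_raw//.
  suff -> : \sum_(j0 <- iota 0 l0) cntF g (rawF g x S) (j0.+1 + l0.+1) x = \sum_(j0 <- iota 0 l0) ncl j0 x by [].
  by apply: eq_big_seq => j'; rewrite mem_iota => hj'; rewrite cnt_raw.
have H := dom_fac hi hfx huS hS hfair; rewrite -/x in H.
have hraw a c : c < n -> rawF g x S a c = if c \in cls then
    (if a == n then (if c == x then x.+1 else 0) else if (a == x) && (mu c == x) then x.+1 else 0) else 0.
  move=> hc; rewrite /rawF mem_filter; case: (boolP (c \in cls)) => hcl; last first.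
    by move: hcl; rewrite in_cls hc /= negbK => /eqP->; rewrite eqxx /= !andbF.
  have hcc : code c != 0 by move: hcl; rewrite in_cls => /andP[].
  by rewrite hcc !andbT; case: (a == n) => //=; rewrite andbT.
(* A client assigned to its own point has both tokens at [x], whereas [canF] has neither: they are
   connected at once, at distance 0. *)
case: (boolP ((x \in cls) && (mu x == x))) => [/andP[hxc /eqP hxm]|hnx].
  have e1 : rawF g x S n x = x.+1 by rewrite hraw// hxc !eqxx.
  have e2 : rawF g x S x x = x.+1 by rewrite hraw// hxc (ltn_eqF hx) hxm eqxx.
  have hext a c : c < n -> updF (updF (rawF g x S) n x 0) x x 0 a c = canF [:: x] id a c.
    move=> hc; rewrite /updF hraw// /canF !inE; case: (boolP (c \in cls)) => hcl; last by do 2?case: ifP.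
    case: (eqVneq c x) => [->|hcx]; rewrite ?hxm ?eqxx ?andbF ?andbT /=.
      case: (eqVneq a x) => [->|hax] /=; first by rewrite (ltn_eqF hx).
      by case: (eqVneq a n).
    by case: (a == n) => //; case: (eqVneq (mu c) x) => [->|h]; rewrite ?andbT ?andbF.
  have hs : suppF g (updF (updF (rawF g x S) n x 0) x x 0) <= Q.
    apply: leq_trans hQ; apply: (@suppF_le _ _ _ [:: x]) => a c p _ hc.
    rewrite hext// /canF !inE; case: ifP => // _; case: ifP => _.
      by case: ifP => // /andP[/eqP-> _] [->].
    by case: ifP => // /and3P[_ /eqP-> _] [->].
  have := dom_conn H hx hx hx hx hx e1 e2 erefl hs; rewrite d_xx addr0 => H1.
  by apply: (Dom_le H1) => //; apply: eqc_ext => a c _ hc; apply: hext.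
apply: (Dom_le H) => //; first by rewrite ltnS leqW.
apply: eqc_ext => a c _ hc; rewrite hraw// /canF !inE; case: (boolP (c \in cls)) => hcl //.
case: (eqVneq c x) => [hcx|hcx]; rewrite /= ?andbF ?andbT; last first.
  by case: (a == n) => //; case: (eqVneq (mu c) x) => [->|h]; rewrite ?andbT ?andbF.
have hm : mu c != x by move: hnx; rewrite -hcx hcl /=.
by rewrite (negbTE hm) !andbF /= hcx.
Qed.

Fixpoint chs N j (A : nat -> R) q (eta : R) (ws : seq (seq nat)) : Prop :=
  if ws is w :: ws' then
    (exists ga P, [/\ size P <= q, forall x, x \in w -> [/\ ga x \in P, ga x < n & (gd g x (ga x) <= eta)%R] &
      Dom N ((j, j + size w), (kw w, false)) (canF w ga) (V w A (fun=> 0%R))]) /\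
    chs N (j + size w) A q eta ws'
  else True.

(** Tokens go from the portals of a child to those of the parent, by way of their home in the
    triangle inequality: at most [eta' + eta] each. The other [eta] is the excess of each end of a
    connection made at the portals of the parent. Only edges cut by the children pay. *)
Lemma level ws off N A (sep : nat -> bool) q (eta' eta : R) ga P :
  ws != [::] -> uniq (flatten ws) -> q + size P <= Q -> (0 <= eta')%R -> (0 <= eta)%R ->
  {subset flatten ws <= iota 0 n} ->
  chs N off A q eta' ws ->
  (forall c w, c \in cls -> w \in ws -> (c \in w) != (mu c \in w) -> sep c) ->
  (forall c x, c \in cls -> sep c -> x \in flatten ws -> (x == c) || (x == mu c) ->
     [/\ ga x \in P, ga x < n & (gd g x (ga x) <= eta)%R]) ->
  Dom (N + (n + n) + size ws * n.+1) ((off, off + size (flatten ws)), (kw (flatten ws), false))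
    (canF (flatten ws) ga)
    (V (flatten ws) (fun c => A c + (if sep c then eta' + eta + eta else 0))%R (fun=> 0%R)).
Proof.
move=> hne hu hq he' he hsub hch hsep hga.
pose A' c := (A c + (if sep c then eta' + eta else 0))%R.
pose E c : R := (if sep c then eta else 0)%R.
have {}hch : chunks (N + (n + n)) off ga A' E ws.
  suff G ws' j : {subset ws' <= ws} -> chs N j A q eta' ws' -> chunks (N + (n + n)) j ga A' E ws'.
    exact: G.
  elim: ws' j => //= w ws' IH j hs [[ga' [P' [hP' hga' H]]] hws]; split; last first.
    by apply: IH => // w' hw'; apply: hs; rewrite in_cons hw' orbT.
  have hw : w \in ws by apply: hs; rewrite mem_head.
  have winn x : x \in w -> x \in flatten ws by move=> hx; apply/flattenP; exists w.
  have H1 : Dom (N + (n + n)) ((j, j + size w), (kw w, false)) (canF w ga) (V w A' (fun=> 0%R)).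
    apply: (shift (P := P' ++ P) H).
    - by move=> c _; case: ifP => // _; apply: addr_ge0.
    - by rewrite size_cat (leq_trans _ hq)// leq_add2r.
    move=> c x hc h hx hxc; have hsc := hsep c w hc hw h; rewrite hsc.
    have [a1 a2 a3] := hga' x hx; have [b1 b2 b3] := hga c x hc hsc (winn x hx) hxc.
    split; rewrite ?mem_cat ?a1 ?b1 ?orbT//.
    have hxn : x < n by have := hsub x (winn x hx); rewrite mem_iota.
    by apply: le_trans (d_tri a2 hxn b2) _; rewrite (d_sym (ga' x)); apply: lerD.
  apply: (Dom_le H1) => //; apply: V_le => // c _ _ _; rewrite lerD2l /E.
  by case: ifP.
case: ws hne hu hsub hch hsep hga => // W ws _ hu hsub [hW hws] hsep hga.
have H := merge hu (leq_trans (leq_addl _ _) hq) (leqnn _) hW hws hsep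
   (fun c x hc h hx hxc => let: And3 a b _ := hga c x hc h hx hxc in conj a b) _.
have {}H := H _.
apply: (Dom_le (H _)).
- move=> c hc hs h1 h2; rewrite /E hs.
  have [|a1 a2 a3] := hga c c hc hs h1 _; first by rewrite eqxx.
  have [|b1 b2 b3] := hga c (mu c) hc hs h2 _; first by rewrite eqxx orbT.
  have [hmu _] := mu_fac hc; have hcn := cls_lt hc.
  apply: le_trans (d_tri a2 hcn b2) _; rewrite (d_sym _ c).
  have := d_tri hcn hmu b2; lra.
- by rewrite leq_add2l leq_mul2r /= leqnSn.
- apply: V_le => [c _|c _ _ _]; rewrite /A' /E; case: (sep c); lra.
- exact: eqc_refl.
Qed.

Definition grp (f : nat -> nat) s := flatten [seq [seq x <- s | f x == u] | u <- iota 0 n].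
(* The levels are listed from the coarsest to the finest, as pairs of a labelling and a radius. *)
Fixpoint rad (fs : seq ((nat -> nat) * R)) s := if fs is f :: fs' then grp f.1 (rad fs' s) else s.

Lemma filter_grp f s p : [seq x <- grp f s | p x] = grp f [seq x <- s | p x].
Proof.
rewrite /grp filter_flatten -map_comp; congr flatten; apply: eq_map => u /=.
by rewrite -!filter_predI; apply: eq_filter => x /=; rewrite andbC.
Qed.

Lemma filter_rad fs s p : [seq x <- rad fs s | p x] = rad fs [seq x <- s | p x].
Proof. by elim: fs => //= f fs IH; rewrite filter_grp IH. Qed.

(** Grouping is stable, so it commutes with filtering. Hence each class of the coarsest level is
    contiguous and is itself sorted by the finer levels; recursively, every cell is an interval. *)
Lemma rad_cons f fs s :
  rad (f :: fs) s = flatten [seq rad fs [seq x <- s | f.1 x == u] | u <- iota 0 n].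
Proof. by rewrite /= /grp; congr flatten; apply: eq_map => u; rewrite filter_rad. Qed.

Lemma perm_grp f s : (forall x, x \in s -> f x < n) -> perm_eq (grp f s) s.
Proof.
move=> h; apply/permP => p; rewrite /grp count_flatten -map_comp.
elim: s h => [|x s IH] h.
  rewrite (eq_map (g := fun=> 0)) ?sumn_map_nseq //=.
  by elim: (iota 0 n).
have hx : f x < n by apply: h; rewrite mem_head.
have {}IH := IH (fun y hy => h y (mem_behead (s := _ :: _) hy)); rewrite /= -IH.
rewrite !sumnE !big_map.
rewrite (bigD1_seq (f x)) ?mem_iota ?iota_uniq//= [in RHS](bigD1_seq (f x)) ?mem_iota ?iota_uniq//= eqxx /=.
rewrite addnA; congr (_ + _); apply: eq_bigr => u hu.
by rewrite eq_sym (negbTE hu).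
Qed.

Definition labok (fs : seq ((nat -> nat) * R)) := forall j, j < size fs ->
  let f := nth (id, 0%R) fs j in
  (0 <= f.2)%R /\ forall x, x < n -> f.1 x < n /\ (gd g (f.1 x) x <= f.2)%R.

Lemma labok_cons f fs : labok (f :: fs) ->
  [/\ (0 <= f.2)%R, forall x, x < n -> f.1 x < n /\ (gd g (f.1 x) x <= f.2)%R & labok fs].
Proof. by move=> h; have [h1 h2] := h 0 isT; split=> // j hj; apply: (h j.+1). Qed.

Lemma perm_rad fs s : labok fs -> {subset s <= iota 0 n} -> perm_eq (rad fs s) s.
Proof.
move=> hl hs; elim: fs hl => //= f fs IH /labok_cons[_ h hl].
apply: perm_trans (IH hl); apply: perm_grp => x; rewrite (perm_mem (IH hl)) => /hs.
by rewrite mem_iota => /h[].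
Qed.

Variables (delta : R) (q : nat).
Hypothesis delta_ge0 : (0 <= delta)%R.
Hypothesis q_gt0 : 0 < q.
Hypothesis qQ : q + q <= Q.
Hypothesis cover : forall u (r : R), u < n -> (0 <= r)%R -> exists ga P, size P <= q /\
  forall x, x < n -> (gd g u x <= r)%R -> [/\ ga x \in P, ga x < n & (gd g x (ga x) <= delta * r)%R].

(** What each token of [c] pays in a cell of radius [r] subdivided by [fs], when [out] marks the
    edges leaving the cell. If the edge leaves a child of radius [f.2], the change of portals costs
    [delta * f.2 + delta * r] and a possible connection [delta * r] more. At the bottom the children
    are single points, of radius 0, and every edge is charged. *)
Fixpoint pen (fs : seq ((nat -> nat) * R)) (r : R) (out : nat -> bool) (c : nat) : R :=
  if fs is f :: fs' then
    let out' c := out c || (f.1 c != f.1 (mu c)) in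
    (pen fs' f.2 out' c + (if out' c then delta * f.2 + delta * r + delta * r else 0))%R
  else (0 + (0 + delta * r + delta * r))%R.

Definition loc off w := off + size w <= n /\ forall i, i < size w -> nth 0 o (off + i) = nth 0 w i.

Lemma loc_cat off w w' : loc off (w ++ w') -> loc off w /\ loc (off + size w) w'.
Proof.
rewrite /loc size_cat => -[h1 h]; split; split; try lia; move=> i hi.
  by rewrite h ?(ltn_addr _ hi)// nth_cat hi.
by rewrite -addnA h ?ltn_add2l// nth_cat ltnNge leq_addr /= addKn.
Qed.

Definition cell N j (A : nat -> R) (eta : R) w :=
  exists ga P, [/\ size P <= q, forall x, x \in w -> [/\ ga x \in P, ga x < n & (gd g x (ga x) <= eta)%R] &
      Dom N ((j, j + size w), (kw w, false)) (canF w ga) (V w A (fun=> 0%R))].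

Lemma chs_seq N A eta (I : eqType) (ch rd : I -> seq nat) us off :
  loc off (flatten [seq rd u | u <- us]) ->
  (forall u, u \in us -> size (rd u) = size (ch u)) ->
  (forall u off', u \in us -> ch u != [::] -> loc off' (rd u) -> cell N off' A eta (ch u)) ->
  chs N off A q eta [seq w <- [seq ch u | u <- us] | w != [::]].
Proof.
elim: us off => //= u us IH off /loc_cat[h1 h2] hsz hc.
have hrec j : j = off + size (ch u) -> chs N j A q eta [seq w <- [seq ch u | u <- us] | w != [::]].
  move=> ->; apply: IH; first by rewrite -hsz ?mem_head.
    by move=> v hv; apply: hsz; rewrite in_cons hv orbT.
  by move=> v off' hv; apply: hc; rewrite in_cons hv orbT.
case: (eqVneq (ch u) [::]) => [e|hne] /=; first by apply: hrec; rewrite e addn0.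
by split; [apply: hc => //; apply: mem_head|apply: hrec].
Qed.

Lemma flatten_nonnil (T : eqType) (ws : seq (seq T)) : flatten [seq w <- ws | w != [::]] = flatten ws.
Proof. by elim: ws => //= w ws IH; case: eqVneq => [->|_] /=; rewrite IH. Qed.

Lemma Dom_perm N i j w w' ga A E v : perm_eq w w' -> v = V w' A E ->
  Dom N ((i, j), (kw w, false)) (canF w ga) (V w A E) ->
  Dom N ((i, j), (kw w', false)) (canF w' ga) v.
Proof.
move=> hp ->; rewrite /kw (permP hp) => H; apply: (Dom_le H) => //.
  by rewrite (V_perm _ _ (perm_mem hp)).
by apply: eqc_ext => a c _ _; apply: canF_perm; apply: perm_mem.
Qed.

(** Per level: [2 n] rounds of moves and [n + 1] for each of at most [n] children. The bottom adds
    the [n + 2] rounds of the single points. *)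
Definition rnds := (n + 3) * (n + 3).

Lemma level_cell ws w off N A A' (sep : nat -> bool) (eta' r : R) u :
  perm_eq (flatten ws) w -> ws != [::] -> (forall x, x \in ws -> x != [::]) -> uniq w -> {subset w <= iota 0 n} -> (0 <= eta')%R -> (0 <= r)%R ->
  u < n -> (forall x, x \in w -> (gd g u x <= r)%R) ->
  chs N off A q eta' ws ->
  (forall c v, c \in cls -> v \in ws -> (c \in v) != (mu c \in v) -> sep c) ->
  (forall c, A' c = A c + (if sep c then eta' + delta * r + delta * r else 0))%R ->
  cell (N + (n + n) + n * n.+1) off A' (delta * r)%R w.
Proof.
move=> hp hne hnn hu hs he hr hun hur hch hsep hA.
have [ga [P [hP hga]]] := cover hun hr.
have hga' x : x \in w -> [/\ ga x \in P, ga x < n & (gd g x (ga x) <= delta * r)%R].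
  by move=> hx; apply: hga; [have := hs x hx; rewrite mem_iota|apply: hur].
exists ga, P; split=> //.
rewrite -(perm_size hp); apply: (Dom_perm hp); last first.
  have H := @level ws off N A sep q eta' (delta * r)%R ga P hne.
  have {}H := H _ (leq_trans (leq_add (leqnn q) hP) qQ) he (mulr_ge0 delta_ge0 hr) _ hch hsep _.
  apply: (Dom_le (H _ _ _)) => //.
  - by rewrite (perm_uniq hp).
  - by move=> x; rewrite (perm_mem hp); apply: hs.
  - by move=> c x _ _; rewrite (perm_mem hp) => hx _; apply: hga'.
  rewrite leq_add2l leq_mul2r /=; have : size w <= n.
    by rewrite -(size_iota 0 n); apply: uniq_leq_size.
  rewrite -(perm_size hp); apply: leq_trans; elim: (ws) hnn => //= v ws' IH hnn.
  rewrite size_cat -add1n; apply: leq_add.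
    by have := hnn v (mem_head _ _); case: (v).
  by apply: IH => x hx; apply: hnn; rewrite in_cons hx orbT.
by apply: eq_bigr => c _; rewrite hA.
Qed.

Definition cells_at fs := forall (r : R) (out : nat -> bool) s off u,
  (0 <= r)%R -> u < n -> uniq s -> s != [::] ->
  {subset s <= iota 0 n} -> (forall x, x \in s -> (gd g u x <= r)%R) ->
  (forall c, c \in cls -> (c \in s) != (mu c \in s) -> out c) ->
  loc off (rad fs s) ->
  cell (rnds * (size fs).+1) off (pen fs r out) (delta * r)%R s.

Definition child (f : nat -> nat) s v := [seq x <- s | f x == v].
Definition children f s := [seq w <- [seq child f s v | v <- iota 0 n] | w != [::]].

Lemma child_sep (out : nat -> bool) f s v c : (forall c, c \in cls -> (c \in s) != (mu c \in s) -> out c) ->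
  c \in cls -> (c \in child f s v) != (mu c \in child f s v) -> out c || (f c != f (mu c)).
Proof.
move=> hout hc; rewrite !mem_filter.
case: (boolP (c \in s)) => h1; case: (boolP (mu c \in s)) => h2; rewrite ?andbF ?andbT.
- by move=> h; apply/orP; right; apply: contraNneq h => ->.
- by move=> _; rewrite hout// h1 (negbTE h2).
- by move=> _; rewrite hout// h2 (negbTE h1).
- by rewrite eqxx.
Qed.

Lemma perm_children f s : (forall x, x \in s -> f x < n) -> perm_eq (flatten (children f s)) s.
Proof. by move=> h; rewrite /children flatten_nonnil; apply: perm_grp. Qed.

Lemma chs_children f fs (out : nat -> bool) s off : labok (f :: fs) -> cells_at fs -> uniq s -> {subset s <= iota 0 n} ->
  (forall c, c \in cls -> (c \in s) != (mu c \in s) -> out c) ->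
  loc off (rad (f :: fs) s) ->
  chs (rnds * (size fs).+1) off (pen fs f.2 (fun c => out c || (f.1 c != f.1 (mu c)))) q (delta * f.2)%R
    (children f.1 s).
Proof.
move=> /labok_cons[f1 f2 hl'] IH hu hs hout hloc.
have hsn x : x \in s -> x < n by move=> hx; have := hs x hx; rewrite mem_iota.
have hw v : perm_eq (rad fs (child f.1 s v)) (child f.1 s v).
  by apply: perm_rad => // x; rewrite mem_filter => /andP[_]; apply: hs.
rewrite rad_cons in hloc.
apply: (chs_seq (rd := fun v => rad fs (child f.1 s v))) => //; first by move=> v _; rewrite (perm_size (hw v)).
move=> v off' hv hnv hlv; rewrite mem_iota in hv.
apply: (IH _ _ _ _ v) => //.
- by rewrite filter_uniq.
- by move=> x; rewrite mem_filter => /andP[_]; apply: hs.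
- move=> x; rewrite mem_filter => /andP[/eqP <- hx]; by case: (f2 x (hsn x hx)).
- by move=> c hc; apply: child_sep.
Qed.

(** Induction on the levels. A cell is the intersection of the classes of all coarser levels, and
    its non-empty children by the next labelling are contiguous in the ordering. Below the finest
    level it is split into single points. *)
Lemma cells fs : labok fs -> cells_at fs.
Proof.
elim: fs => [|f fs IH] hl r out s off u hr hun hu hne hs hur hout hloc.
  have hch : chs n.+2 off (fun=> 0%R) q 0%R [seq w <- [seq [:: x] | x <- s] | w != [::]].
    apply: (chs_seq (rd := fun x => [:: x])) => //; first by rewrite flatten_seq1.
    move=> x off' hx _ [ho /(_ 0 isT)] /=; rewrite addn0 => e; rewrite /= addn1 in ho.
    exists id, [:: x]; split; rewrite ?q_gt0//.
      move=> y; rewrite !inE => /eqP->; rewrite eqxx d_xx; split=> //.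
      by have := hs x hx; rewrite mem_iota.
    have H := single ho; rewrite e in H; rewrite addn1; apply: (Dom_le H) => //.
    by apply: V_ge0.
  have hfl : flatten [seq w <- [seq [:: x] | x <- s] | w != [::]] = s.
    by rewrite flatten_nonnil flatten_seq1.
  have [ga [P [h1 h2 h3]]] : cell (n.+2 + (n + n) + n * n.+1) off (pen [::] r out) (delta * r)%R s.
    apply: (@level_cell [seq w <- [seq [:: x] | x <- s] | w != [::]] s off n.+2 (fun=> 0%R) _ (fun=> true) 0%R r u) => //.
    - by rewrite hfl.
    - by case: (s) hne.
    - by move=> x; rewrite mem_filter => /andP[].
  exists ga, P; split=> //; apply: (Dom_le h3) => //.
  by rewrite /rnds /=; nia.
have [f1 f2 hl'] := labok_cons hl.
have hch := chs_children hl (IH hl') hu hs hout hloc.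
have hpf : perm_eq (flatten (children f.1 s)) s.
  by apply: perm_children => x hx; have := hs x hx; rewrite mem_iota => hx'; case: (f2 x hx').
have [ga [P [h1 h2 h3]]] : cell (rnds * (size fs).+1 + (n + n) + n * n.+1) off (pen (f :: fs) r out) (delta * r)%R s.
  apply: (@level_cell _ s off _ _ _ (fun c => out c || (f.1 c != f.1 (mu c))) (delta * f.2)%R r u hpf _ _ _ _ _ _ _ _ hch) => //.
  - by apply: contraNneq hne => e; move: (perm_size hpf); rewrite e => /esym/size0nil->.
  - by move=> x; rewrite mem_filter => /andP[].
  - exact: mulr_ge0.
  - move=> c w hc; rewrite mem_filter => /andP[_ /mapP[v hv ->]]; exact: child_sep.
exists ga, P; split=> //; apply: (Dom_le h3) => //.
by rewrite [in leqRHS]mulnS -addnA addnC leq_add2r /rnds; nia.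
Qed.

(** No edge is cut by the top labelling, so its classes have no waiting tokens. They are
    concatenated without portals and at no further cost, even if there are several of them. *)
Lemma root f fs : labok (f :: fs) -> 0 < n -> loc 0 (rad (f :: fs) (iota 0 n)) ->
  (forall c, c \in cls -> f.1 c = f.1 (mu c)) ->
  Dom (rnds * (size fs).+2) ((0, n), (kw (iota 0 n), false)) (fun _ _ => 0)
    (V (iota 0 n) (pen fs f.2 (fun c => f.1 c != f.1 (mu c))) (fun=> 0%R)).
Proof.
move=> hl hn hloc hcut; have [f1 f2 hl'] := labok_cons hl.
have hs : {subset iota 0 n <= iota 0 n} by [].
have hcls c : c \in cls -> (c \in iota 0 n) && (mu c \in iota 0 n).
  by move=> hc; rewrite !mem_iota cls_lt//; case: (mu_fac hc) => -> .
have hout c : c \in cls -> (c \in iota 0 n) != (mu c \in iota 0 n) -> (fun=> false) c.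
  by move=> /hcls/andP[-> ->].
have hch := chs_children hl (cells hl') (iota_uniq 0 n) hs hout hloc.
have hpf : perm_eq (flatten (children f.1 (iota 0 n))) (iota 0 n).
  by apply: perm_children => x; rewrite mem_iota => hx'; case: (f2 x hx').
have hne : children f.1 (iota 0 n) != [::].
  by apply/eqP => e; move: (perm_size hpf); rewrite e size_iota /= => e'; rewrite -e' in hn.
set ws := children f.1 (iota 0 n) in hch hpf hne.
have hszw : size ws <= n by rewrite size_filter (leq_trans (count_size _ _))// size_map size_iota.
have hsep c : c \in cls -> (f.1 c != f.1 (mu c)) = false by move=> hc; rewrite (hcut c hc) eqxx.
have H : Dom (rnds * (size fs).+1 + (n + n) + size ws * n.+1)
   ((0, 0 + size (flatten ws)), (kw (flatten ws), false)) (canF (flatten ws) id)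
   (V (flatten ws) (fun c => pen fs f.2 (fun c => f.1 c != f.1 (mu c)) c +
      (if f.1 c != f.1 (mu c) then delta * f.2 + 0 + 0 else 0))%R (fun=> 0%R)).
  apply: (@level ws 0 _ _ (fun c => f.1 c != f.1 (mu c)) q (delta * f.2)%R 0%R id [::] hne) => //.
  - by rewrite (perm_uniq hpf) iota_uniq.
  - by rewrite addn0 (leq_trans (leq_addr _ _) qQ).
  - exact: mulr_ge0.
  - by move=> x; rewrite (perm_mem hpf).
  - move=> c w hc; rewrite mem_filter => /andP[_ /mapP[v hv ->]] h.
    by have := child_sep hout hc h.
  - by move=> c x /hsep->.
rewrite (perm_size hpf) size_iota add0n in H.
have {}H := Dom_perm hpf erefl H; apply: (Dom_le H).
- by rewrite [in leqRHS]mulnS -addnA addnC leq_add2r /rnds; nia.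
- by apply: V_le => c hc; rewrite hsep// ?addr0.
apply: eqc_ext; apply: canF_cases => [a c h _ _|c hc _ _|c hc _ _]; first by rewrite canF_0.
  by rewrite canF_n//; have /andP[-> ->] := hcls c hc.
by rewrite canF_mu//; have /andP[-> ->] := hcls c hc.
Qed.

End Completeness.
(** * Nets and cuts *)

(** Distinct integers in a half-open window of length [B - A]: their number exceeds the difference
    between the largest and the smallest by at most 1. *)
Lemma count_window (R : realType) (A B : R) (s : seq nat) : uniq s -> (A <= B)%R ->
  (forall m, m \in s -> (A <= m%:R < B)%R) -> ((size s)%:R <= B - A + 1)%R.
Proof.
move=> hu hAB h; case: (posnP (size s)) => [->|hs]; first by rewrite /=; lra.
have [m0 hm0 hmin] : exists2 m0, m0 \in s & forall m, m \in s -> m0 <= m.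
  have hex : exists m, m \in s by case: (s) hs => // m s' _; exists m; rewrite mem_head.
  by exists (ex_minn hex); case: ex_minnP.
have /hasP[m hm hle] : has (fun m => m0 + (size s).-1 <= m) s.
  apply: contraT => /hasPn hn.
  have : size s <= size (iota m0 (size s).-1).
    apply: uniq_leq_size => // m hm; rewrite mem_iota hmin//= ltnNge; exact: hn.
  by rewrite size_iota; lia.
have /andP[h1 _] := h m0 hm0; have /andP[_ h2] := h m hm.
have : ((m0 + (size s).-1)%:R <= m%:R :> R)%R by rewrite ler_nat.
rewrite natrD -subn1 natrB//; lra.
Qed.

Section Nets.
Variable R : realType.
Variable g : ctx R.
Hypothesis hg : okg g.
Notation n := (cn g).
Notation B := (cB g).
Hypothesis d_ge0 : forall x y, (0 <= gd g x y)%R.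
Hypothesis d_sym : forall x y, gd g x y = gd g y x.
Hypothesis d_xx : forall x, gd g x x = 0%R.
Hypothesis d_tri : forall x y z, x < n -> y < n -> z < n -> (gd g x z <= gd g x y + gd g y z)%R.
Variable dd : nat.
Hypothesis coverk : forall e u (r : R), u < n -> (0 <= r)%R -> exists ga P, size P <= 2 ^ (dd * e) /\
  forall x, x < n -> (gd g u x <= 2 ^+ e * r)%R -> [/\ ga x \in P, ga x < n & (gd g x (ga x) <= r)%R].

Lemma netP (r : R) : (0 <= r)%R -> [/\ uniq (net g r), {subset net g r <= iota 0 n},
  {in net g r &, forall u v, u != v -> (r < gd g u v + gd g u v)%R} &
  forall x, x < n -> exists2 u, u \in net g r & (gd g u x + gd g u x <= r)%R].
Proof.
move=> hr; rewrite /net (iotnE hg).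
set F := fun _ _ => _.
suff H k N : k <= n -> N = foldl F [::] (iota 0 k) -> [/\ uniq N, {subset N <= iota 0 k},
  {in N &, forall u v, u != v -> (r < gd g u v + gd g u v)%R} &
  forall x, x < k -> exists2 u, u \in N & (gd g u x + gd g u x <= r)%R] by exact: H.
elim: k N => [|k IH] N hk; first by move=> ->.
rewrite -addn1 iotaD foldl_cat add0n /= => hN.
have [h1 h2 h3 h4] := IH _ (ltnW hk) erefl; set N0 := foldl F [::] _ in hN h1 h2 h3 h4.
have sub1 : {subset iota 0 k <= iota 0 k ++ [:: k]} by move=> x; rewrite mem_cat => ->.
have hs : size N0 < B.
  apply: leq_trans (n_ltB hg); rewrite ltnS (leq_trans _ (ltnW hk))//.
  by rewrite -[leqRHS](size_iota 0 k); apply: uniq_leq_size.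
move: hN; rewrite /F; case: ifP => hall ->; last first.
  split=> // [x /h2 /sub1 //|x hx].
  have : x < k \/ x = k by lia.
  case=> [/h4//|->]; move/negbT: hall; rewrite -has_predC => /hasP[u hu] /=.
  by rewrite -leNgt => hle; exists u.
rewrite /tcons hs; split.
- rewrite /= h1 andbT; apply/negP => /h2; by rewrite mem_iota add0n ltnn andbF.
- by move=> x; rewrite in_cons => /orP[/eqP->|/h2/sub1//]; rewrite mem_cat mem_head orbT.
- have hk' u : u \in N0 -> (r < gd g u k + gd g u k)%R by move=> hu; apply: (allP hall).
  move=> u v; rewrite !in_cons => /orP[/eqP->|hu] /orP[/eqP->|hv]; first by rewrite eqxx.
  + by move=> _; rewrite d_sym; apply: hk'.
  + by move=> _; apply: hk'.
  + exact: h3.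
move=> x hx; have : x < k \/ x = k by lia.
case=> [/h4[u hu1 hu2]|->]; first by exists u => //; rewrite in_cons hu1 orbT.
by exists k; rewrite ?mem_head// d_xx addr0.
Qed.

(** A label depends only on which net points are within [s]. Thus two points with different labels
    are told apart by the test of some net point. *)
Lemma lab_eq (r s : R) x y : (forall u, u \in net g r -> (gd g u x <= s)%R = (gd g u y <= s)%R) ->
  lab g r s x = lab g r s y.
Proof.
rewrite /lab; elim: (net g r) (cn g) => //= u N IH z h.
by rewrite h ?mem_head// IH// => v hv; apply: h; rewrite in_cons hv orbT.
Qed.

Lemma labP (r s : R) x : (0 <= r)%R -> (r <= s + s)%R -> x < n ->
  lab g r s x < n /\ (gd g (lab g r s x) x <= s)%R.
Proof.
move=> hr hs hx; have [_ h2 _ /(_ x hx)[u hu1 hu2]] := netP hr.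
have hus : (gd g u x <= s)%R by lra.
have h2' : {subset net g r <= net g r} by [].
rewrite /lab.
suff H N z : {subset N <= net g r} -> (u \in N) \/ z < n /\ (gd g z x <= s)%R ->
  foldl (fun z u0 => if (gd g u0 x <= s)%R then u0 else z) z N < n /\
  (gd g (foldl (fun z u0 => if (gd g u0 x <= s)%R then u0 else z) z N) x <= s)%R.
  by apply: H => //; left.
elim: N z => [|v N IH] z hN /=; first by case.
have hN' : {subset N <= net g r} by move=> w hw; apply: hN; rewrite in_cons hw orbT.
have hv : v < n by have := h2 v (hN v (mem_head _ _)); rewrite mem_iota.
case=> [|hz]; last by apply: IH => //; right; case: ifP.
rewrite in_cons => /orP[/eqP e|hin]; last by apply: IH => //; left.
by apply: IH => //; right; rewrite -e hus; split=> //; rewrite e.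
Qed.

Lemma passE (r s : R) l : size l <= n -> (forall x, x \in l -> lab g r s x < n) ->
  pass g r s l = grp g (lab g r s) l.
Proof.
move=> hl hlab; rewrite /pass (iotnE hg) /grp.
have hin u z l' : count (fun x => lab g r s x == u) l' + size z < B ->
  foldl (fun z x => if lab g r s x == u then tcons B x z else z) z l' =
  rev [seq x <- l' | lab g r s x == u] ++ z.
  elim: l' z => //= x l' IH z; case: (lab g r s x == u) => /= hz; last exact: IH.
  rewrite /tcons ifT; last by lia.
  by rewrite IH /= ?rev_cons ?cat_rcons//; lia.
set F := fun z u => _.
suff H k : k <= n -> foldl F [::] (iota 0 k) =
    rev (flatten [seq [seq x <- l | lab g r s x == u] | u <- iota 0 k]) /\
    size (foldl F [::] (iota 0 k)) = count (fun x => lab g r s x < k) l.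
  by have [-> _] := H n (leqnn n); rewrite revK.
elim: k => [|k IH] hk; first by split=> //; rewrite (eq_count (a2 := pred0)) ?count_pred0.
have [IH1 IH2] := IH (ltnW hk).
rewrite -addn1 iotaD foldl_cat map_cat flatten_cat add0n /= cats0.
set z := foldl F [::] _ in IH1 IH2 *.
have hcnt : count (fun x => lab g r s x == k) l + size z = count (fun x => lab g r s x < k + 1) l.
  rewrite IH2 addnC -count_predUI [X in _ + X](_ : _ = 0) ?addn0.
    by apply: eq_count => x /=; lia.
  by rewrite (eq_count (a2 := pred0)) ?count_pred0// => x /=; lia.
rewrite {1 2}/F hin; last first.
  by rewrite hcnt (leq_ltn_trans (count_size _ _))// (leq_ltn_trans hl (n_ltB hg)).
rewrite size_cat size_rev size_filter hcnt; split=> //.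
by rewrite IH1 rev_cat.
Qed.

(** The ball of radius [2 r = 2^3 (r / 4)] is covered by [2^(3 dd)] balls of radius [r / 4], each of
    which contains at most one net point, since net points are more than [r / 2] apart. *)
Lemma packing (r : R) x : (0 <= r)%R -> x < n ->
  size [seq u <- net g r | (gd g u x <= r + r)%R] <= 2 ^ (dd * 3).
Proof.
move=> hr hx; have [h1 h2 h3 _] := netP hr.
have hr4 : (0 <= r / 4%:R)%R by apply: divr_ge0.
have [ga [P [hP hga]]] := coverk 3 hx hr4.
apply: leq_trans hP; set N := [seq u <- _ | _].
have hN u : u \in N -> [/\ u \in net g r, u < n & (gd g u x <= r + r)%R].
  by rewrite mem_filter => /andP[a b]; split=> //; have := h2 u b; rewrite mem_iota.
have hgaN u : u \in N -> [/\ ga u \in P, ga u < n & (gd g u (ga u) <= r / 4%:R)%R].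
  move=> /hN[a b c]; apply: hga => //; rewrite d_sym; lra.
rewrite -(size_map ga); apply: uniq_leq_size; last by move=> y /mapP[u /hgaN[a _ _] ->].
rewrite map_inj_in_uniq ?filter_uniq// => u v hu hv e.
apply/eqP/negPn/negP => huv.
have [a1 a2 a3] := hN u hu; have [b1 b2 b3] := hN v hv.
have [c1 c2 c3] := hgaN u hu; have [e1 e2 e3] := hgaN v hv.
have := h3 u v a1 b1 huv; have := d_tri a2 c2 b2; rewrite {2}e (d_sym (ga v)); lra.
Qed.

(* Over all shifts [rho = (1 + m / M) / 2], a pair at distance [l] is separated at scale [r]
   by a given net point for at most [2 M l / r + 1] values of [m]. *)
Lemma cut_count (r : R) x y : (0 < r)%R -> 0 < cM g -> x < n -> y < n ->
  (\sum_(m <- iota 0 (cM g)) (if lab g r (rho g m * r) x != lab g r (rho g m * r) y then r else 0) <=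
   (2 ^ (dd * 3))%:R * (2%:R * gd g x y * (cM g)%:R + r))%R.
Proof.
move=> hr hM hx hy; set M := cM g in hM *; set l := gd g x y; have hl : (0 <= l)%R by apply: d_ge0.
have hK : (1 <= (2 ^ (dd * 3))%:R :> R)%R by rewrite -[1%R]/(1%:R) ler_nat expn_gt0.
have hMR : (0 < M%:R :> R)%R by rewrite ltr0n.
(* For a pair at distance at least [r] all shifts may cut: [M r <= 2 l M]. *)
case: (lerP r l) => hrl.
  apply: (@le_trans _ _ (\sum_(m <- iota 0 M) r)%R).
    by apply: ler_sum => m _; case: ifP => // _; apply: ltW.
  rewrite big_const_seq count_predT size_iota iter_addr_0 -mulr_natr.
  apply: (@le_trans _ _ (1 * (2 * l * M%:R + r))%R); first by rewrite mul1r; nra.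
  by apply: ler_wpM2r => //; nra.
(* Only these net points can separate the pair: they are within [rho r <= r] of one of the two
   points, which are less than [r] apart. *)
set N := [seq u <- net g r | (gd g u x <= r + r)%R].
have [h1 h2 _ _] := netP (ltW hr).
have hrho m : m < M -> (rho g m <= 1)%R /\ (1 <= rho g m + rho g m)%R.
  move=> hm; rewrite /rho -/M; have : (0 <= m%:R / M%:R :> R)%R by apply: divr_ge0.
  have : (m%:R / M%:R <= 1 :> R)%R by rewrite ler_pdivrMr// mul1r ler_nat ltnW.
  by move=> ? ?; split; lra.
pose b u m := (gd g u x <= rho g m * r)%R != (gd g u y <= rho g m * r)%R.
apply: (@le_trans _ _ (\sum_(m <- iota 0 M) \sum_(u <- N) (if b u m then r else 0))%R).
  apply: ler_sum_mem => m; rewrite mem_iota /= => hm; have [r1 r2] := hrho m hm.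
  case: ifP => [hlab|_]; last by apply: sumr_ge0 => u _; case: ifP => // _; apply: ltW.
  have /hasP[u hu hb] : has (fun u => b u m) (net g r).
    apply: contraT => /hasPn hn; case/negP: hlab; apply/eqP; apply: lab_eq => u hu.
    by apply/eqP; have := hn u hu; rewrite /b negbK.
  have hun : u < n by have := h2 u hu; rewrite mem_iota.
  have hbr : (rho g m * r <= r)%R by nra.
  have huN : u \in N.
    rewrite mem_filter hu andbT; move: hb; rewrite /b; case: (lerP (gd g u x) (rho g m * r)) => h; first by lra.
    case: (lerP (gd g u y) (rho g m * r)) => // h' _.
    by have := d_tri hun hy hx; rewrite (d_sym y x) -/l; lra.
  rewrite (big_rem u huN) /= hb lerDl; apply: sumr_ge0 => v _; case: ifP => // _; exact: ltW.
rewrite exchange_big /=.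
apply: (@le_trans _ _ (\sum_(u <- N) (2%:R * l * M%:R + r))%R); last first.
  rewrite big_const_seq count_predT iter_addr_0 -[X in (X <= _)%R]mulr_natl.
  apply: ler_wpM2r; first by nra.
  by rewrite ler_nat; apply: packing => //; apply: ltW.
apply: ler_sum_mem => u hu.
have hun : u < n by move: hu; rewrite mem_filter => /andP[_ /h2]; rewrite mem_iota.
rewrite -big_mkcond -big_filter big_const_seq count_predT iter_addr_0 -[X in (X <= _)%R]mulr_natr.
set s := [seq m <- _ | _].
(* [rho r >= a] iff [m >= (2 a / r - 1) M] *)
pose th (a : R) := ((2%:R * a / r - 1) * M%:R)%R.
have hth a m : (a <= rho g m * r)%R = (th a <= m%:R)%R.
  have e : (m%:R - th a = (rho g m * r - a) * (2%:R * M%:R / r))%R.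
    rewrite /th /rho -/M; field; rewrite !lt0r_neq0//.
  by rewrite -subr_ge0 -[RHS]subr_ge0 e pmulr_lge0//; apply: divr_gt0 => //; nra.
have htt a c : (th c - th a = 2%:R * (c - a) / r * M%:R)%R by rewrite /th; field; rewrite lt0r_neq0.
(* With [a] and [c] the smaller and the larger distance from [u], the shifts for which [u] separates
   the pair lie in a window of length [2 (c - a) M / r], and [c - a <= l]. *)
have main a c : (a <= c)%R -> (c - a <= l)%R ->
    (forall m, b u m -> (a <= rho g m * r)%R /\ ~~ (c <= rho g m * r)%R) ->
    (r * (size s)%:R <= 2%:R * l * M%:R + r)%R.
  move=> hac hcl hb; have hs : ((size s)%:R <= th c - th a + 1)%R.
    apply: count_window; first by rewrite filter_uniq ?iota_uniq.
      by rewrite -subr_ge0 htt; apply: mulr_ge0 => //; apply: divr_ge0; nra.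
    move=> m; rewrite mem_filter => /andP[/hb[]]; rewrite !hth -ltNge => -> -> //.
  have : (r * (size s)%:R <= r * (th c - th a + 1))%R by rewrite ler_pM2l.
  have -> : (r * (th c - th a + 1) = 2%:R * (c - a) * M%:R + r)%R.
    by rewrite htt; field; rewrite lt0r_neq0.
  nra.
case: (lerP (gd g u x) (gd g u y)) => hxy.
  apply: (main _ _ hxy).
    by have := d_tri hun hx hy; rewrite -/l; lra.
  move=> m; rewrite /b; case: (lerP (gd g u x) _) => h1'; case: (lerP (gd g u y) _) => h2' //= _; lra.
apply: (main _ _ (ltW hxy)).
  by have := d_tri hun hy hx; rewrite (d_sym y x) -/l; lra.
move=> m; rewrite /b; case: (lerP (gd g u x) _) => h1'; case: (lerP (gd g u y) _) => h2' //= _; lra.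
Qed.

End Nets.

(** * Averaging over the shifts and the approximation ratio *)

Lemma iota_rcons k : iota 0 k.+1 = iota 0 k ++ [:: k].
Proof. by rewrite -addn1 iotaD. Qed.

Lemma exists_le_average (R : realType) (F : nat -> R) s X : s != [::] ->
  (\sum_(m <- s) F m <= X *+ size s)%R -> exists2 m, m \in s & (F m <= X)%R.
Proof.
elim: s => // m s IH _; rewrite big_cons /= => h.
case: (lerP (F m) X) => hm; first by exists m; rewrite ?mem_head.
case: (eqVneq s [::]) => [e|hne].
  by move: h; rewrite e big_nil /= mulr1n addr0; lra.
have [|m' h1 h2] := IH hne; first by move: h; rewrite mulrS; lra.
by exists m' => //; rewrite in_cons h1 orbT.
Qed.

Section Approximation.
Variable R : realType.
Variable g : ctx R.
Hypothesis hg : okg g.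
Notation n := (cn g).
Notation B := (cB g).
Notation l0 := (cl g).
Notation Q := (cQ g).
Notation code := (gcode g).
Notation z := (cz g).
Hypothesis d_ge0 : forall x y, (0 <= gd g x y)%R.
Hypothesis d_sym : forall x y, gd g x y = gd g y x.
Hypothesis d_xx : forall x, gd g x x = 0%R.
Hypothesis d_eq0 : forall x y, x < n -> y < n -> gd g x y = 0%R -> x = y.
Hypothesis d_tri : forall x y z, x < n -> y < n -> z < n -> (gd g x z <= gd g x y + gd g y z)%R.
Hypothesis code_le : forall c, code c <= l0.
Variable dd : nat.
Hypothesis coverk : forall e u (r : R), u < n -> (0 <= r)%R -> exists ga P, size P <= 2 ^ (dd * e) /\
  forall x, x < n -> (gd g u x <= 2 ^+ e * r)%R -> [/\ ga x \in P, ga x < n & (gd g x (ga x) <= r)%R].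
Variable e' : nat.
Hypothesis eM : cM g = 2 ^ (z * 3).
Hypothesis eD : cD g = (z * 3).+1.
Hypothesis eQ : Q = 2 ^ (dd * e') + 2 ^ (dd * e').
Hypothesis hzn : n < 2 ^ z.
Hypothesis hzK : 3 * 2 ^ (dd * 3) * cD g < 2 ^ z.
Hypothesis hsig : sigs g < B.
Hypothesis hrounds : rnds g * (cD g).+1 <= B.
Notation M := (cM g).
Notation D := (cD g).

Definition lf (L : R) m i : (nat -> nat) * R :=
  let r := (L / 2 ^+ z * 2 ^+ i)%R in (lab g r (rho g m * r)%R, r).
Fixpoint lfs L m k := if k is k'.+1 then lf L m k' :: lfs L m k' else [::].

Lemma size_lfs L m k : size (lfs L m k) = k.
Proof. by elim: k => //= k ->. Qed.

Lemma rhoP m : m < M -> (rho g m <= 1)%R /\ (1 <= rho g m + rho g m)%R.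
Proof.
move=> hm; have hMR : (0 < M%:R :> R)%R by rewrite ltr0n (leq_trans _ hm).
rewrite /rho; have : (0 <= m%:R / M%:R :> R)%R by apply: divr_ge0.
have : (m%:R / M%:R <= 1 :> R)%R by rewrite ler_pdivrMr// mul1r ler_nat ltnW.
by move=> ? ?; split; lra.
Qed.

Lemma rad_ge0 (L : R) i : (0 <= L)%R -> (0 <= L / 2 ^+ z * 2 ^+ i)%R.
Proof. by move=> hL; apply: mulr_ge0; [apply: divr_ge0|]; rewrite ?exprn_ge0. Qed.

Lemma lfP (L : R) m i x : (0 <= L)%R -> m < M -> x < n ->
  (lf L m i).1 x < n /\ (gd g ((lf L m i).1 x) x <= (lf L m i).2)%R.
Proof.
move=> hL hm hx; have [h1 h2] := rhoP hm; rewrite /lf /=.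
set r := (L / _ * _)%R; have hr : (0 <= r)%R by apply: rad_ge0.
have hrr : (r <= rho g m * r + rho g m * r)%R by nra.
have [h3 h4] := labP hg d_sym d_xx hr hrr hx.
by split=> //; apply: le_trans h4 _; nra.
Qed.

Lemma lfs_ok (L : R) m k : (0 <= L)%R -> m < M -> labok g (lfs L m k).
Proof.
move=> hL hm; elim: k => [|k IH] [|j] //= hj; last exact: IH.
by split; [apply: rad_ge0|move=> x hx; apply: lfP].
Qed.

Lemma hzB : z <= B. Proof. by case: hg => _ _ _ _ [_ _ h _ _]; lia. Qed.

Lemma orderE (L : R) m : (0 <= L)%R -> m < M ->
  order g L m = rad g (lfs L m D) (iota 0 n).
Proof.
move=> hL hm; rewrite /order (iotE hzB) (iotnE hg) iotE; last by case: hg => _ _ _ _ [].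
have -> : foldl (fun r _ => r / 2%:R)%R L (iota 0 z) = (L / 2 ^+ z)%R.
  suff H s (r : R) : foldl (fun (r : R) (_ : nat) => r / 2%:R)%R r s = (r / 2 ^+ size s)%R by rewrite H size_iota.
  elim: s r => [|x s IH] r /=; first by rewrite expr0 divr1.
  by rewrite IH exprS invfM mulrA.
set st := fun _ _ => _.
suff -> k : foldl st (L / 2 ^+ z, iota 0 n)%R (iota 0 k) = ((L / 2 ^+ z * 2 ^+ k)%R, rad g (lfs L m k) (iota 0 n)) by [].
elim: k => [|k IH]; first by rewrite /= expr0 mulr1.
rewrite iota_rcons foldl_cat IH /st /=; congr (_, _).
  by rewrite exprS [(2 * _)%R]mulr_natl mulr2n mulrDr.
have hp := perm_rad (@lfs_ok L m k hL hm) (fun x h => h : x \in iota 0 n).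
rewrite /= (passE hg)//.
  by rewrite (perm_size hp) size_iota.
by move=> x; rewrite (perm_mem hp) mem_iota => hx; case: (@lfP L m k x hL hm hx).
Qed.

Lemma order_perm (L : R) m : (0 <= L)%R -> m < M -> perm_eq (order g L m) (iota 0 n).
Proof. by move=> hL hm; rewrite orderE//; apply: perm_rad => //; apply: lfs_ok. Qed.

Variable mu : nat -> nat.
Notation cls := (cls g).
Hypothesis mu_fac : forall c, c \in cls -> mu c < n /\ gfac g (mu c) != 0.
Hypothesis mu_fair : forall f, f < n -> isopen g mu f -> forall i, i < l0 ->
  let q := ((ncl g mu i f)%:R / (\sum_(j <- iota 0 l0) ncl g mu j f)%:R)%R in
  (galpha g i <= q)%R /\ (q <= gbeta g i)%R.
Hypothesis n_gt0 : 0 < n.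

Definition delta : R := (2 ^+ e')^-1.
Lemma delta_gt0 : (0 < delta)%R. Proof. by rewrite invr_gt0 exprn_gt0. Qed.

(* The edge of [c] is cut at level [i]. *)
Definition sep (L : R) m i c := (lf L m i).1 c != (lf L m i).1 (mu c).

(** A geometric sum over the radii: an edge outside of a cell of radius [2 r] pays
    [delta r + 2 delta (2 r)] there and at most [5 delta r] below, in all [5 delta (2 r)]. *)
Lemma pen_true (L : R) m k (out : nat -> bool) c : (0 <= L)%R -> out c ->
  (pen mu delta (lfs L m k) (L / 2 ^+ z * 2 ^+ k) out c <= 5%:R * delta * (L / 2 ^+ z * 2 ^+ k))%R.
Proof.
move=> hL; have hd := delta_gt0; elim: k out => [|k IH] out hout.
  by rewrite /= expr0 mulr1; have := @rad_ge0 L 0 hL; rewrite expr0 mulr1; nra.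
rewrite /= hout /=; have := IH (fun c => out c || (lab g (L / 2 ^+ z * 2 ^+ k) (rho g m * (L / 2 ^+ z * 2 ^+ k)) c != lab g (L / 2 ^+ z * 2 ^+ k) (rho g m * (L / 2 ^+ z * 2 ^+ k)) (mu c))%R) _.
rewrite hout => /(_ isT); rewrite exprS.
set r := (L / 2 ^+ z * 2 ^+ k)%R => h.
have -> : (L / 2 ^+ z * (2 * 2 ^+ k) = 2 * r)%R by rewrite /r; ring.
lra.
Qed.

(** At the coarsest level that cuts the edge, of radius [r], the payment [5 delta r] is added to at
    most [5 delta r] below, hence the factor 10. An edge cut nowhere pays only at the bottom. *)
Lemma pen_false (L : R) m k (out : nat -> bool) c : (0 <= L)%R -> ~~ out c ->
  (pen mu delta (lfs L m k) (L / 2 ^+ z * 2 ^+ k) out c <= 2%:R * delta * (L / 2 ^+ z) +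
    10%:R * delta * \sum_(i <- iota 0 k) (if sep L m i c then L / 2 ^+ z * 2 ^+ i else 0))%R.
Proof.
move=> hL; have hd := delta_gt0; elim: k out => [|k IH] out hout.
  by rewrite /= expr0 mulr1 big_nil; lra.
rewrite iota_rcons big_cat big_seq1 /= (negbTE hout) /=.
set out' := fun c => _; rewrite -/(sep L m k c).
have hS : (0 <= \sum_(i <- iota 0 k) (if sep L m i c then L / 2 ^+ z * 2 ^+ i else 0))%R.
  by apply: sumr_ge0 => i _; case: ifP => // _; apply: rad_ge0.
have h0 := @rad_ge0 L 0 hL; rewrite expr0 mulr1 in h0.
have hk := @rad_ge0 L k hL.
case: (boolP (sep L m k c)) => hs; last first.
  have := IH out'; rewrite {1}/out' (negbTE hout) /= => /(_ hs); lra.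
have := @pen_true L m k out' c hL; rewrite {1}/out' (negbTE hout) /= => /(_ hs).
have -> : (L / 2 ^+ z * 2 ^+ k.+1 = 2 * (L / 2 ^+ z * 2 ^+ k))%R by rewrite exprS; ring.
move: hS hk h0; set S := (\sum_(i <- _) _)%R; set r := (L / 2 ^+ z * 2 ^+ k)%R; set p := pen _ _ _ _ _ _ => hS hk h0 hp.
nra.
Qed.

Notation ell c := (gd g c (mu c)).
Definition total : R := (\sum_(c <- cls) ell c)%R.

(** Summed over shifts and edges, the level of radius [r] contributes at most [K (2 M total + r n)].
    Here [r n <= M total], because [n <= 2^z], [r <= L M / 2^z] and [L <= total]: this is the reason
    for [M = 2^(3 z)] and the origin of the factor 3. *)
Lemma averaging (L : R) : (0 <= L)%R -> (forall c, c \in cls -> (ell c <= L)%R) -> (L <= total)%R ->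
  exists2 m, m < M & (\sum_(c <- cls) \sum_(i <- iota 0 D) (if sep L m i c then L / 2 ^+ z * 2 ^+ i else 0)
    <= (3 * 2 ^ (dd * 3) * D)%:R * total)%R.
Proof.
move=> hL hLc hLt; have hM : 0 < M by rewrite eM expn_gt0.
have hMR : (0 < M%:R :> R)%R by rewrite ltr0n.
have ht : (0 <= total)%R by apply: sumr_ge0.
set K := 2 ^ (dd * 3); have hK : (1 <= K%:R :> R)%R by rewrite -[1%R]/(1%:R) ler_nat expn_gt0.
have hi : iota 0 M != [::] by case: (M) hM.
have [|m hm h] := @exists_le_average R (fun m => \sum_(c <- cls) \sum_(i <- iota 0 D) (if sep L m i c then L / 2 ^+ z * 2 ^+ i else 0))%R
   (iota 0 M) ((3 * K * D)%:R * total)%R hi; last by exists m => //; move: hm; rewrite mem_iota.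
rewrite exchange_big /= (eq_bigr (fun c => \sum_(i <- iota 0 D) \sum_(m <- iota 0 M)
    (if sep L m i c then L / 2 ^+ z * 2 ^+ i else 0)))%R; last by move=> c _; rewrite exchange_big.
rewrite exchange_big size_iota /=.
apply: (@le_trans _ _ (\sum_(i <- iota 0 D) (3%:R * K%:R * M%:R * total))%R); last first.
  rewrite big_const_seq count_predT size_iota iter_addr_0 -[(_ *+ D)%R]mulr_natr !natrM.
  by rewrite le_eqVlt; apply/orP; left; apply/eqP; ring.
apply: ler_sum_mem => i; rewrite mem_iota /= => hiD.
set r := (L / 2 ^+ z * 2 ^+ i)%R; have hr : (0 <= r)%R by apply: rad_ge0.
apply: (@le_trans _ _ (\sum_(c <- cls) (K%:R * (2%:R * ell c * M%:R + r)))%R).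
  apply: ler_sum_mem => c hc; have [hmu _] := mu_fac hc.
  case: (ltrP 0 r) => hr0.
    exact: (@cut_count R g hg d_ge0 d_sym d_xx d_tri dd coverk r c (mu c) hr0 hM (cls_lt hc) hmu).
  have e : r = 0%R by apply/eqP; rewrite eq_le hr hr0.
  rewrite e big1; last by move=> m _; case: ifP.
  by apply: mulr_ge0 => //; have := d_ge0 c (mu c); nra.
rewrite -big_distrr big_split /= -[X in (_ * (X + _))%R]big_distrl /= -big_distrr /= -/total.
rewrite big_const_seq count_predT iter_addr_0 -[(r *+ _)%R]mulr_natr.
have hcr : (r * (size cls)%:R <= M%:R * total)%R.
  have h1 : ((size cls)%:R <= n%:R :> R)%R by rewrite ler_nat size_cls.
  have h2 : (n%:R <= 2 ^+ z :> R)%R by rewrite -natrX ler_nat ltnW.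
  have h3 : (2 ^+ i <= M%:R :> R)%R by rewrite eM natrX ler_eXn2l ?ltr1n//; rewrite eD in hiD.
  have hz0 : (0 < 2 ^+ z :> R)%R by rewrite exprn_gt0.
  have h4 : (L / 2 ^+ z * (size cls)%:R <= L)%R.
    by rewrite mulrAC ler_pdivrMr//; apply: ler_wpM2l => //; apply: le_trans h1 h2.
  have h5 : (0 <= L / 2 ^+ z * (size cls)%:R)%R by apply: mulr_ge0 => //; apply: divr_ge0 => //; apply: ltW.
  have h6 : (0 <= 2 ^+ i :> R)%R by apply: exprn_ge0.
  rewrite /r mulrAC; nra.
by nra.
Qed.

(** [L] must be a distance between two points, since the algorithm tries exactly those. Without
    clients the pair [(0, 0)] gives [L = 0]. *)
Lemma longest : exists x y, [/\ x < n, y < n, forall c, c \in cls -> (ell c <= gd g x y)%R & (gd g x y <= total)%R].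
Proof.
rewrite /total; have : {subset cls <= cls} by [].
elim: {-2}cls => [|c s IH] hs.
  by exists 0, 0; split=> //; rewrite d_xx big_nil.
have [x [y [hx hy h1 h2]]] := IH (fun c hc => hs c (mem_behead (s := _ :: _) hc)).
have hc : c \in cls by apply: hs; rewrite mem_head.
have hsum : (0 <= \sum_(c <- s) ell c)%R by apply: sumr_ge0.
have hec := d_ge0 c (mu c); rewrite big_cons.
case: (lerP (ell c) (gd g x y)) => h.
  exists x, y; split=> //; last by lra.
  by move=> c'; rewrite in_cons => /orP[/eqP->|/h1].
exists c, (mu c); split; [exact: cls_lt|by case: (mu_fac hc)| |lra].
by move=> c'; rewrite in_cons => /orP[/eqP->//|/h1 h']; lra.
Qed.

Variable eps : R.
Hypothesis heps : ((64 * 2 ^ (dd * 3) * D)%:R * delta <= eps)%R.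

Lemma approx : exists x y m, [/\ x < n, y < n, m < M &
  Dom g (order g (gd g x y) m) B ((0, n), (kw g mu (iota 0 n), false)) (fun _ _ => 0)
    ((1 + eps) * total)%R].
Proof.
have [x [y [hx hy h1 h2]]] := longest; set L := gd g x y in h1 h2.
have hL : (0 <= L)%R by apply: d_ge0.
have [m hm hpsi] := averaging hL h1 h2.
exists x, y, m; split=> //; rewrite -/L; set o := order g L m.
have ho : perm_eq o (iota 0 n) by apply: order_perm.
have ht : (0 <= total)%R by apply: sumr_ge0.
set K := 2 ^ (dd * 3) in hpsi *; set Psi := (\sum_(c <- cls) _)%R in hpsi.
have hz0 : (0 < 2 ^+ z :> R)%R by rewrite exprn_gt0.
have hz1 : (n%:R <= 2 ^+ z :> R)%R by rewrite -natrX ler_nat ltnW.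
have hcl : ((size cls)%:R <= n%:R :> R)%R by rewrite ler_nat size_cls.
(* A cut at the top would contribute [L 4^z] to [Psi], but [Psi <= 3 K D total <= 3 K D n L < 2^z
   2^z L]. If [L = 0] every client sits on its facility and no level cuts its edge. *)
have htop c : c \in cls -> sep L m (z * 3) c = false.
  move=> hc; have [hmu _] := mu_fac hc; case hsep: (sep L m (z * 3) c) => //; exfalso.
  have hLpos : (0 < L)%R.
    rewrite lt_neqAle hL andbT; apply: contraL hsep => /eqP hL0; rewrite /sep negbK.
    suff e : c = mu c :> nat by rewrite -e.
    apply: d_eq0 => //; first exact: cls_lt.
    by apply/eqP; rewrite eq_le d_ge0 andbT hL0 h1.
  have htn : (total <= n%:R * L)%R.
    apply: (@le_trans _ _ (\sum_(c <- cls) L)%R); first exact: ler_sum_mem.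
    by rewrite big_const_seq count_predT iter_addr_0 -[(L *+ _)%R]mulr_natl; apply: ler_wpM2r.
  have hge : (L / 2 ^+ z * 2 ^+ (z * 3) <= Psi)%R.
    rewrite /Psi (big_rem c hc) /= (bigD1_seq (z * 3)) ?mem_iota ?iota_uniq ?eD//= hsep -addrA lerDl.
    apply: addr_ge0; first by apply: sumr_ge0 => i _; case: ifP => // _; apply: rad_ge0.
    by apply: sumr_ge0 => c' _; apply: sumr_ge0 => i _; case: ifP => // _; apply: rad_ge0.
  have e3 : (L / 2 ^+ z * 2 ^+ (z * 3) = L * 2 ^+ z * 2 ^+ z)%R.
    by rewrite exprM; field; rewrite lt0r_neq0.
  have hKz : ((3 * K * D)%:R < 2 ^+ z :> R)%R by rewrite -natrX ltr_nat.
  have hK0 : (0 <= (3 * K * D)%:R :> R)%R by [].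
  move: hge hpsi htn hKz hK0 hz1 hz0; rewrite e3; move: (3 * K * D)%:R (2 ^+ z)%R (n%:R)%R => a b d q1 q2 q3 q4 q5 q6 q7.
  have q8 : (a * total <= a * (b * L))%R by apply: ler_wpM2l => //; nra.
  have q9 : (a * (b * L) < b * (b * L))%R by rewrite ltr_pM2r// mulr_gt0.
  have q10 : (L * b * b = b * (b * L))%R by ring.
  lra.
have hq : 0 < 2 ^ (dd * e') by rewrite expn_gt0.
have cover u r : u < n -> (0 <= r)%R -> exists ga P, size P <= 2 ^ (dd * e') /\
  forall x, x < n -> (gd g u x <= r)%R -> [/\ ga x \in P, ga x < n & (gd g x (ga x) <= delta * r)%R].
  move=> hu hr; have hd := delta_gt0; have hdr : (0 <= delta * r)%R by apply: mulr_ge0 => //; apply: ltW.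
  have [ga [P [h3 h4]]] := coverk e' hu hdr; exists ga, P; split=> // x' hx' hux; apply: h4 => //.
  by rewrite /delta mulrA divff ?mul1r// expf_neq0// pnatr_eq0.
have hQ : 0 < Q by rewrite eQ addn_gt0 hq.
have hqq : 2 ^ (dd * e') + 2 ^ (dd * e') <= Q by rewrite eQ.
have hlok := @lfs_ok L m D hL hm; rewrite eD /= in hlok.
have hloc : loc g o 0 (rad g (lf L m (z * 3) :: lfs L m (z * 3)) (iota 0 n)).
  have eo : o = rad g (lf L m (z * 3) :: lfs L m (z * 3)) (iota 0 n) by rewrite /o orderE// eD.
  by rewrite -eo; split; rewrite ?add0n ?(perm_size ho) ?size_iota.
have H := @root R g hg d_ge0 d_sym d_xx d_tri code_le o ho hsig hQ mu mu_fac mu_fair delta _ (ltW delta_gt0) hq hqq cover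
   (lf L m (z * 3)) (lfs L m (z * 3)) hlok n_gt0 hloc _.
apply: (@Dom_le R g hg d_sym d_xx d_tri code_le o ho hsig _ _ _ _ _ _ _ (H _)) => //.
- by move=> c hc; have := htop c hc; rewrite /sep => /negbFE/eqP.
- by rewrite size_lfs -eD; apply: leq_trans hrounds; rewrite eD.
rewrite /V.
(* Two tokens double the bound of [pen_false]. Since [Psi <= 3 K D total], the sum is at most
   [(1 + 4 delta + 60 K D delta) total], whence the 64 in [heps]. *)
apply: (@le_trans _ _ (\sum_(c <- cls) (ell c + 4%:R * delta * (L / 2 ^+ z) +
  20%:R * delta * \sum_(i <- iota 0 D) (if sep L m i c then L / 2 ^+ z * 2 ^+ i else 0)))%R).
  apply: ler_sum_mem => c hc; have [hmu _] := mu_fac hc.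
  rewrite !mem_iota !add0n (cls_lt hc) hmu /=.
  have hs := htop c hc.
  have := @pen_false L m (z * 3) (fun c => (lf L m (z * 3)).1 c != (lf L m (z * 3)).1 (mu c)) c hL _.
  rewrite -/(sep L m (z * 3) c) hs => /(_ isT).
  rewrite eD iota_rcons big_cat big_seq1 /= hs.
  set S := (\sum_(i <- _) _)%R; set p := pen _ _ _ _ _ _.
  rewrite !mul1r; lra.
have e20 : (\sum_(c <- cls) 20%:R * delta * (\sum_(i <- iota 0 D) (if sep L m i c then L / 2 ^+ z * 2 ^+ i else 0)) = 20%:R * delta * Psi)%R.
  by rewrite /Psi big_distrr.
have e4 : (\sum_(c <- cls) 4%:R * delta * (L / 2 ^+ z) = 4%:R * delta * (L / 2 ^+ z) * (size cls)%:R)%R.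
  by rewrite big_const_seq count_predT iter_addr_0 -[(_ *+ size cls)%R]mulr_natr.
rewrite !big_split /= -/total e20 e4.
have hLs : (L / 2 ^+ z * (size cls)%:R <= L)%R.
  by rewrite mulrAC ler_pdivrMr//; apply: ler_wpM2l => //; apply: le_trans hcl hz1.
have hd := delta_gt0.
have hKD : (1 <= (K * D)%:R :> R)%R by rewrite -[1%R]/(1%:R) ler_nat muln_gt0 expn_gt0 /= eD.
have e64 : ((64 * K * D)%:R = 64%:R * (K * D)%:R :> R)%R by rewrite -natrM mulnA.
have e3 : ((3 * K * D)%:R = 3%:R * (K * D)%:R :> R)%R by rewrite -natrM mulnA.
move: heps hpsi; rewrite -/K e64 e3; move: ((K * D)%:R)%R hKD => a ha hE hP.
have q1 : (4%:R * delta * (L / 2 ^+ z) * (size cls)%:R <= 4%:R * delta * total)%R.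
  by rewrite -mulrA; apply: ler_wpM2l; [nra|lra].
have q2 : (20%:R * delta * Psi <= 20%:R * delta * (3%:R * a * total))%R by apply: ler_wpM2l => //; nra.
have q3 : (4%:R * delta * total <= 4%:R * delta * (a * total))%R by apply: ler_wpM2l; nra.
have q4 : (64%:R * a * delta * total <= eps * total)%R by apply: ler_wpM2r.
nra.
Qed.

End Approximation.
(** * Reading off a solution *)

Section Readout.
Variable R : realType.
Variable g : ctx R.
Hypothesis hg : okg g.
Notation n := (cn g).
Notation B := (cB g).
Notation l0 := (cl g).
Notation Q := (cQ g).
Notation entry := (entry R).
Notation code := (gcode g).
Notation cls := (cls g).

(** A feasible solution in terms of plain numbers. Fairness is asked of the facilities that serve a
    client, in accordance with the convention on empty clusters. *)
Definition solution (F : nat -> bool) (mu : nat -> nat) (v : R) := [/\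
  forall f, f < n -> F f -> gfac g f != 0,
  count F (iota 0 n) <= ck g,
  forall c, c \in cls -> mu c < n /\ F (mu c),
  forall f, f < n -> isopen g mu f -> forall i, i < l0 ->
    let q := ((ncl g mu i f)%:R / (\sum_(j <- iota 0 l0) ncl g mu j f)%:R)%R in
    (galpha g i <= q)%R /\ (q <= gbeta g i)%R
  & (\sum_(c <- cls) gd g c (mu c) <= v)%R].

Definition outF (e : entry) f := rowne g e.2.1 f.
Definition outmu (e : entry) c := get e.2.1 n c - n.+1.

Section Order.
Variable o : seq nat.
Hypothesis o_perm : perm_eq o (iota 0 n).
Hypothesis code_le : forall c, code c <= l0.

(** No token is active, so every client is connected to some [f] and all demands are connected. By
    [matched], the clients of [f] of a type are as many as its demands of that type, so fairness
    carries over from the prototypes; the potential is now the cost of the assignment. *)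
Lemma accept_solution e : Inv g o e -> accept g e -> solution (outF e) (outmu e) e.2.2.
Proof.
move=> [he hm hp] /and5P[/eqP hs /eqP ht hk hb hcnt].
have key_lt a c : key g a c < nkeys g.
  by rewrite /key /nkeys; have := code_le c; case: (a == n); lia.
have hact a c : a <= n -> c < n -> get e.2.1 a c = 0 \/ n < get e.2.1 a c.
  move=> ha hc; case ev: (get e.2.1 a c) => [|p]; [by left|right].
  rewrite ltnNge; apply/negP => hpn.
  have := allP hcnt (key g a c); rewrite (iotE (nkeys_leB hg)) mem_iota key_lt => /(_ isT) /allP /(_ p).
  rewrite (iotnE hg) mem_iota => /(_ hpn); rewrite (cntE hg) => /eqP h0.
  by have := cntF_pos ha hc ev; rewrite h0.
have hcl c : c < n -> code c != 0 -> exists2 f, f < n & get e.2.1 n c = n.+1 + f.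
  move=> hc hcc; have hin : inV o e c by rewrite /inV hs ht /= -(o_size o_perm) index_mem (o_mem o_perm).
  have h0 := I_cov he hc hin hcc; have [_ h1] := I_cli he h0.
  case: (hact n c (leqnn _) hc) => h2; first by rewrite h2 in h0.
  by exists (get e.2.1 n c - n.+1); lia.
have houtmu c f : get e.2.1 n c = n.+1 + f -> outmu e c = f by rewrite /outmu => ->; rewrite addKn.
have hopen c : c < n -> code c != 0 -> outmu e c < n /\ outF e (outmu e c).
  move=> hc hcc; have [f hf ef] := hcl c hc hcc; rewrite (houtmu c f ef); split=> //.
  have : 0 < SF addn n (mA g f (code c)) (get e.2.1).
    apply: leq_trans (@SF_leq n (mA g f (code c)) (get e.2.1) n c (leqnn _) hc).
    by rewrite /mA !eqxx ef eqxx.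
  rewrite hm// => /SF_gt0[a [c' [_ hc']]]; rewrite /mB lt0b => /and3P[/eqP -> /eqP e1 _].
  by apply/hasP; exists c'; rewrite ?mem_iota// e1.
have hmem c : (c \in cls) = (code c != 0) && (c < n) by rewrite mem_filter mem_iota.
have hdc f k : f < n -> dcs g e.2.1 f k.+1 = ncl g (outmu e) k f.
  move=> hf; transitivity (SF addn n (mA g f k.+1) (get e.2.1)).
    rewrite hm//; apply: SF_eq => a c ha hc; rewrite /dc /mB; case: eqP => // ea /=.
    case: (hact a c ha hc) => hv; first by rewrite hv.
    have [_ _ h1] := I_dem he (eq_ind_r (fun a => a < n) hf ea) (lt0n_neq0 (leq_trans (ltn0Sn _) hv)).
    have -> : get e.2.1 a c = n.+1 by lia.
    by rewrite eqxx.
  rewrite /SF iota_rcons big_cat big_seq1 /= big1_seq ?add0n; last first.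
    move=> a; rewrite mem_iota => /andP[_ ha]; rewrite big1// => c _.
    by rewrite /mA ltn_eqF.
  rewrite /ncl -sum1_count [RHS]big_mkcond; apply: eq_big_seq => c; rewrite mem_iota => /= hc.
  rewrite /mA eqxx /= andbC; case: (code c =P k.+1) => //= ec.
  have [|f' hf' ef] := hcl c hc; first by rewrite ec.
  by rewrite (houtmu _ _ ef) ef eqn_add2l; case: eqP.
split.
- move=> f hf /hasP[c _ h]; by have [] := I_dem he hf h.
- exact: leq_trans (I_open he) hk.
- by move=> c; rewrite hmem => /andP[h1 h2]; apply: hopen.
- move=> f hf /hasP[c]; rewrite hmem => /andP[h1 h2] /eqP hmu i hi.
  have hr : rowne g e.2.1 f by have [_] := hopen c h2 h1; rewrite hmu.
  have := I_fair he hb hf hr hi; rewrite /= hdc//.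
  by rewrite (eq_bigr (fun j => ncl g (outmu e) j f)) => // j _; apply: hdc.
apply: le_trans hp.
rewrite /SF iota_rcons big_cat big_seq1 /= [X in (_ <= X + _)%R]big1_seq ?add0r; last first.
  move=> a; rewrite mem_iota => /andP[_ ha]; rewrite big1_seq// => c; rewrite mem_iota => /andP[_ hc].
  rewrite /pot ltn_eqF//; case: ifP => // /andP[h1 h2].
  exfalso; have [h|h] := hact a c (ltnW ha) hc; first by rewrite h in h1.
  by rewrite ltnNge h2 in h.
rewrite big_filter big_mkcond le_eqVlt; apply/orP; left; apply/eqP.
apply: eq_big_seq => c; rewrite mem_iota => /= hc; case: ifP => hcc.
  have [f hf ef] := hcl c hc hcc.
  rewrite /pot eqxx (houtmu _ _ ef) ef.
  have -> : n.+1 + f <= n = false by rewrite leqNgt ltnS leq_addr.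
  have -> : n < n.+1 + f by rewrite ltnS leq_addr.
  by rewrite andbF addKn.
have -> : get e.2.1 n c = 0; last by rewrite /pot eqxx.
by apply/eqP; apply: contraFT hcc => h; have [_ _] := I_cell he h.
Qed.
End Order.

Definition okb (b : bool * entry) := b.1 -> solution (outF b.2) (outmu b.2) b.2.2.2.
Definition beat v (b : bool * entry) := b.1 /\ (b.2.2.2 <= v)%R.

Lemma better_beat v b e : beat v b -> beat v (better g b e).
Proof.
move=> [h1 h2]; rewrite /better h1 /=; case: ifP => // /andP[_ h3].
by split=> //=; apply: le_trans (ltW h3) h2.
Qed.

Lemma better_hit b e : accept g e -> beat e.2.2 (better g b e).
Proof.
move=> h; rewrite /better h /=; case: ifP => [_|]; first by split=> /=.
by move/negbT; rewrite negb_or negbK -leNgt => /andP[].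
Qed.

Section Best.
Variable T : nat -> nat -> nat -> seq entry.
Hypothesis T_ok : forall x y m e, x < n -> y < n -> m < cM g -> e \in T x y m -> accept g e ->
  solution (outF e) (outmu e) e.2.2.

Definition bestT b0 := foldl (fun b x => foldl (fun b y => foldl (fun b m =>
  foldl (better g) b (T x y m)) b (iota 0 (cM g))) b (iota 0 n)) b0 (iota 0 n).

Lemma bestT_ok b0 : okb b0 -> okb (bestT b0).
Proof.
apply: foldl_inv => b1 x; rewrite mem_iota => hx; apply: foldl_inv => b2 y; rewrite mem_iota => hy.
apply: foldl_inv => b3 m; rewrite mem_iota => hm; apply: foldl_inv => b4 e he hb.
rewrite /better; case: ifP => // /andP[ha _] _; exact: T_ok hx hy hm he ha.
Qed.

Lemma bestT_beat b0 x y m e : x < n -> y < n -> m < cM g -> e \in T x y m -> accept g e ->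
  beat e.2.2 (bestT b0).
Proof.
move=> hx hy hm he ha; have hb3 b s : beat e.2.2 b -> beat e.2.2 (foldl (better g) b s).
  by apply: foldl_inv => z e' _; apply: better_beat.
have hb2 x' y' b s : beat e.2.2 b -> beat e.2.2 (foldl (fun b m => foldl (better g) b (T x' y' m)) b s).
  by apply: foldl_inv => z m' _; apply: hb3.
have hb1 x' b s : beat e.2.2 b -> beat e.2.2 (foldl (fun b y => foldl (fun b m =>
  foldl (better g) b (T x' y m)) b (iota 0 (cM g))) b s).
  by apply: foldl_inv => z y' _; apply: hb2.
apply: (@foldl_hit _ _ (fun=> True) (beat e.2.2) _ _ _ x) => //; rewrite ?mem_iota//; last by move=> *; apply: hb1.
move=> b1 _; apply: (@foldl_hit _ _ (fun=> True) (beat e.2.2) _ _ _ y) => //; rewrite ?mem_iota//; last by move=> *; apply: hb2.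
move=> b2 _; apply: (@foldl_hit _ _ (fun=> True) (beat e.2.2) _ _ _ m) => //; rewrite ?mem_iota//; last by move=> *; apply: hb3.
move=> b3 _; apply: (@foldl_hit _ _ (fun=> True) (beat e.2.2) _ _ _ e) => //; last by move=> *; apply: better_beat.
by move=> b4 _; apply: better_hit.
Qed.
End Best.

Lemma bestE : best g = bestT (fun x y m => close g (order g (gd g x y) m))
  (false, (((0, 0), (0, false)), ([::], 0%R))).
Proof. by rewrite /best /bestT (iotnE hg) iotE//; case: hg => _ _ _ _ []. Qed.

Lemma main_fac e f : n + n <= B -> f < n -> (nth 0 (answer g e) f != 0) = outF e f.
Proof.
move=> hB hf; rewrite /answer (iotE hB) (nth_map 0) ?size_iota ?(ltn_addr _ hf)// nth_iota ?(ltn_addr _ hf)// add0n hf.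
by rewrite (iotnE hg) /outF /rowne; case: (has _ _).
Qed.

Lemma main_mu e c : n + n <= B -> c < n -> nth 0 (answer g e) (n + c) = outmu e c.
Proof.
move=> hB hc; rewrite /answer (iotE hB) (nth_map 0) ?size_iota ?ltn_add2l// nth_iota ?ltn_add2l// add0n.
by rewrite ltnNge leq_addr /= addKn.
Qed.
End Readout.

(** * The best entry against an arbitrary solution *)

Section Correctness.
Variable R : realType.
Variable g : ctx R.
Hypothesis hg : okg g.
Notation n := (cn g).
Notation B := (cB g).
Notation l0 := (cl g).
Notation Q := (cQ g).
Notation code := (gcode g).
Notation z := (cz g).
Hypothesis d_ge0 : forall x y, (0 <= gd g x y)%R.
Hypothesis d_sym : forall x y, gd g x y = gd g y x.
Hypothesis d_xx : forall x, gd g x x = 0%R.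
Hypothesis d_eq0 : forall x y, x < n -> y < n -> gd g x y = 0%R -> x = y.
Hypothesis d_tri : forall x y z, x < n -> y < n -> z < n -> (gd g x z <= gd g x y + gd g y z)%R.
Hypothesis code_le : forall c, code c <= l0.
Variable dd : nat.
Hypothesis coverk : forall e u (r : R), u < n -> (0 <= r)%R -> exists ga P, size P <= 2 ^ (dd * e) /\
  forall x, x < n -> (gd g u x <= 2 ^+ e * r)%R -> [/\ ga x \in P, ga x < n & (gd g x (ga x) <= r)%R].
Variable e' : nat.
Hypothesis eM : cM g = 2 ^ (z * 3).
Hypothesis eD : cD g = (z * 3).+1.
Hypothesis eQ : Q = 2 ^ (dd * e') + 2 ^ (dd * e').
Hypothesis hzn : n < 2 ^ z.
Hypothesis hzK : 3 * 2 ^ (dd * 3) * cD g < 2 ^ z.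
Hypothesis hsig : sigs g < B.
Hypothesis hrounds : rnds g * (cD g).+1 <= B.
Hypothesis n_gt0 : 0 < n.
Variable eps : R.
Hypothesis heps : ((64 * 2 ^ (dd * 3) * cD g)%:R * delta R e' <= eps)%R.

Let hQ : 0 < Q. Proof. by rewrite eQ addn_gt0 expn_gt0. Qed.

Lemma best_solution mu : solution g (isopen g mu) mu (total g mu) ->
  exists2 v, (v <= (1 + eps) * total g mu)%R &
    solution g (outF g (best g).2) (outmu g (best g).2) v.
Proof.
move=> [s1 s2 s3 s4 s5].
pose T x y m := close g (order g (gd g x y) m).
have T_ok x y m e : x < n -> y < n -> m < cM g -> e \in T x y m -> accept g e ->
    solution g (outF g e) (outmu g e) e.2.2.
  move=> hx hy hm; have ho := order_perm hg d_sym d_xx eM eD eQ hzn hzK hsig hrounds (d_ge0 x y) hm.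
  rewrite /T (closeE hg) => he ha; apply: (accept_solution hg ho code_le _ ha).
  exact: inv_tab he.
have mu_fac c : c \in cls g -> mu c < n /\ gfac g (mu c) != 0.
  by move=> /s3[h1 h2]; split=> //; apply: s1.
have [x [y [m [hx hy hm [e he [h1 h2 h3]]]]]] :=
  approx hg d_ge0 d_sym d_xx d_eq0 d_tri code_le coverk eM eD eQ hzn hzK hsig hrounds mu_fac s4 n_gt0 heps.
have ha : accept g e.
  rewrite /accept h1 /= !eqxx s2 /=; apply/allP => k; rewrite (iotE (nkeys_leB hg)) mem_iota => hk.
  apply/allP => p; rewrite (iotnE hg) mem_iota => hp; rewrite (cntE hg) h2//.
  by apply/eqP; apply: SF_idx.
have [h4 h5] : beat e.2.2 (best g).
  by rewrite bestE//; apply: (@bestT_beat _ g T _ x y m e) => //; rewrite /T (closeE hg).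
exists (best g).2.2.2; first exact: le_trans h5 h3.
have : okb g (best g) by rewrite bestE//; apply: (@bestT_ok _ g T T_ok).
exact.
Qed.

End Correctness.
(** * Computing the constants *)

Section Triples.
Variable R : realType.
Notation st := (state R).

(** Hoare triples with a time bound, for the code around [main], which runs before the constants are
    available or outside of the calling convention. *)
Definition triple (c : nat -> program) (pre post : st -> Prop) (T : nat) :=
  forall p off s, located p off (c off) -> pc s = off -> pre s ->
  exists t s', [/\ t <= T, reach p t s s', pc s' = off + size (c off) & post s'].

Lemma triple_seq c1 c2 P Q Z T1 T2 : triple c1 P Q T1 -> triple c2 Q Z T2 ->
  triple (fun off => c1 off ++ c2 (off + size (c1 off))) P Z (T1 + T2).
Proof.
move=> h1 h2 p off s /located_cat[l1 l2] hs hp.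
have [t1 [s1 [b1 r1 p1 q1]]] := h1 _ _ _ l1 hs hp.
have [t2 [s2 [b2 r2 p2 q2]]] := h2 _ _ _ l2 p1 q1.
exists (t1 + t2), s2; split=> //; first exact: leq_add.
  exact: reach_trans r1 r2.
by rewrite p2 size_cat addnA.
Qed.

Lemma triple_straight c (P Q : st -> Prop) : all straight c -> (forall s, P s -> Q (exs s c)) ->
  triple (fun=> c) P Q (size c).
Proof.
move=> hc h p off s hl hs hp; have [h1 h2] := reach_straight hc hl hs.
by exists (size c), (exs s c); split=> //; apply: h.
Qed.

Definition whilec (test : nat -> instr) (body : program) off :=
  test (off + (size body).+2) :: body ++ [:: Jump off].

Lemma triple_while test (tb : st -> bool) body N (P : nat -> st -> Prop) :
  all straight body ->
  (forall b s t, exec b s (test t) = goto s (if tb s then t else (pc s).+1)) ->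
  (forall k s t, P k s -> P k (goto s t)) ->
  (forall k s, k < N -> P k s -> ~~ tb s /\ P k.+1 (exs s body)) ->
  (forall s, P N s -> tb s) ->
  triple (whilec test body) (P 0) (P N) (N * (size body).+2 + 1).
Proof.
move=> hb ht hgo hstep hend p off s /located_cons[l1 /located_cat[l2 /located_cons[l3 _]]] hs hp.
have -> : size (whilec test body off) = (size body).+2 by rewrite /= size_cat addn1.
have H m k s1 : m + k = N -> pc s1 = off -> P k s1 ->
    exists t s', [/\ t <= m * (size body).+2 + 1, reach p t s1 s', pc s' = off + (size body).+2 & P N s'].
  elim: m k s1 => [|m IH] k s1 ek hs1 hk.
    move: hk; rewrite -ek add0n in hend * => hk.
    exists 1, (goto s1 (off + (size body).+2)); split=> //; last exact: hgo.
    by apply: (@reach1 _ _ (test (off + (size body).+2))); rewrite ?hs1// => b; rewrite ht hend.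
  have hkN : k < N by lia.
  have [h1 _] := hstep k s1 hkN hk.
  set s2 := goto s1 off.+1; have hk2 : P k s2 by apply: hgo.
  have [_ h2] := hstep k s2 hkN hk2.
  have [r2 p2] := @reach_straight _ p off.+1 body s2 hb l2 erefl.
  set s3 := exs s2 body in h2 r2 p2.
  have [t [s' [b' r' p' q']]] := IH k.+1 (goto s3 off) (etrans (addnS _ _) ek) erefl (hgo _ _ _ h2).
  exists (1 + (size body + (1 + t))), s'; split=> //.
    by rewrite mulSn; lia.
  apply: (@reach_trans _ _ _ _ _ s2).
    by apply: (@reach1 _ _ (test (off + (size body).+2))); rewrite ?hs1// => b; rewrite ht (negbTE h1) hs1.
  apply: reach_trans r2 _; apply: reach_trans r'.
  by apply: (@reach1 _ _ (Jump off)) => //; rewrite p2.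
by have := H N 0 s (addn0 N) hs hp.
Qed.

Lemma triple_post c (P Q Q' : st -> Prop) T : triple c P Q T -> (forall s, Q s -> Q' s) -> triple c P Q' T.
Proof.
move=> h hq p off s hl hs hp; have [t [s' [h1 h2 h3 h4]]] := h _ _ _ hl hs hp.
by exists t, s'; split=> //; apply: hq.
Qed.

Lemma triple_pre c (P P' Q : st -> Prop) T : triple c P Q T -> (forall s, P' s -> P s) -> triple c P' Q T.
Proof. by move=> h hq p off s hl hs /hq hp; apply: h. Qed.

Fixpoint known (L : seq (nat * nat)) (s : st) : Prop :=
  if L is (j, v) :: L' then ireg s j = v /\ known L' s else True.

Definition mems im rm r0 (s : st) := [/\ imem s = im, rmem s = rm & rreg s 0 = r0].

(** Register 18 is the loop counter of the macros below, so its content is forgotten together with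
    that of the target. Register 19 holds the constant 1. *)
Definition clear i (L : seq (nat * nat)) := [seq y <- L | (y.1 != i) && (y.1 != 18)].

Lemma known_clear L i (s s' : st) : (forall x, x != i -> x != 18 -> ireg s' x = ireg s x) ->
  known L s -> known (clear i L) s'.
Proof.
move=> h; elim: L => //= -[j v] L IH [h1 /IH h2]; rewrite /clear /=.
by case: ifP => //= /andP[h3 h4]; rewrite h.
Qed.

Definition frame i (s s' : st) := [/\ imem s' = imem s, rmem s' = rmem s, rreg s' = rreg s &
  forall x, x != i -> x != 18 -> ireg s' x = ireg s x].

(** A loop that executes [c] as many times as register [a] says; [val k] is the content of register
    [i] after [k] turns. Products and powers of 2 are both of this form. *)
Lemma countP i a c v0 (val : nat -> nat) (s0 : st) : i < 18 -> a < 18 -> i != a -> ireg s0 19 = 1 ->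
  straight c ->
  (forall s, frame i s0 s -> exists v, exec false s c = set_ireg s i v /\
     forall k, ireg s i = val k -> v = val k.+1) -> v0 = val 0 ->
  triple (fun off => [:: IConst i v0; IConst 18 0] ++ whilec (JumpILe a 18) [:: c; IAdd 18 18 19] (off + 2))
    (eq s0) (fun s => frame i s0 s /\ ireg s i = val (ireg s0 a)) (ireg s0 a * 4 + 3).
Proof.
move=> hi ha hia h19 hc hx hv0; set N := ireg s0 a.
have e18 : (18 == i) = false by rewrite gtn_eqF.
have e19 : 19 == i = false by rewrite gtn_eqF// (ltn_trans hi).
pose P k s := [/\ frame i s0 s, ireg s i = val k & ireg s 18 = k].
have -> : N * 4 + 3 = 2 + (N * 4 + 1) by lia.
have ea (s : st) : frame i s0 s -> ireg s a = N.
  by move=> [_ _ _ h]; rewrite h// ?(ltn_eqF ha)// eq_sym.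
have hgo k s t : P k s -> P k (goto s t) by [].
have hs1 : triple (fun=> [:: IConst i v0; IConst 18 0]) (eq s0) (P 0) 2.
  apply: (@triple_straight [:: IConst i v0; IConst 18 0]) => // s <-; split=> /=.
  - by split=> // x /negbTE h1 /negbTE h2; rewrite /= h1 h2.
  - by rewrite (ltn_eqF hi) eqxx.
  - by [].
have hw : triple (whilec (JumpILe a 18) [:: c; IAdd 18 18 19]) (P 0) (P N) (N * 4 + 1).
  apply: (@triple_while (JumpILe a 18) (fun s => ireg s a <= ireg s 18) [:: c; IAdd 18 18 19] N P) => //.
  - by rewrite /= hc.
  - move=> k s hk [h1 h2 h3]; rewrite (ea s h1) h3 -ltnNge; split=> //.
    have [v [hv hval]] := hx s h1; have [m1 m2 m3 m4] := h1; split=> /=; rewrite hv /=.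
    + by split=> //= x /negbTE h4 /negbTE h5; rewrite /= h5 h4 m4 ?h4 ?h5.
    + by rewrite (ltn_eqF hi) eqxx; apply: hval.
    + by rewrite e18 e19 h3 m4 ?e19// h19 addn1.
  - by move=> s [h1 h2 h3]; rewrite (ea s h1) h3.
apply: (triple_post (Q := P N)); last by move=> s [].
exact: (triple_seq hs1 hw).
Qed.

Definition mulc i a b off := [:: IConst i 0; IConst 18 0] ++
  whilec (JumpILe a 18) [:: IAdd i i b; IAdd 18 18 19] (off + 2).
Definition pow2c i a off := [:: IConst i 1; IConst 18 0] ++
  whilec (JumpILe a 18) [:: IAdd i i i; IAdd 18 18 19] (off + 2).

Section Macros.
Variables (im : nat -> nat) (rm : nat -> R) (r0 : R) (L : seq (nat * nat)).
Notation Kn L := (fun s => known L s /\ mems im rm r0 s).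

Lemma mulcP i a b x y : [&& i < 18, a < 18, b < 18, i != a & i != b] ->
  (forall s, known L s -> [/\ ireg s a = x, ireg s b = y & ireg s 19 = 1]) ->
  triple (mulc i a b) (Kn L) (Kn ((i, x * y) :: clear i L)) (x * 4 + 3).
Proof.
move=> /and5P[hi ha hb h1 h2] hL p off s hl hs [hk [m1 m2 m3]].
have [e1 e2 e3] := hL s hk.
have := @countP i a (IAdd i i b) 0 (fun k => k * y) s hi ha h1 e3 isT _ (erefl _) p off s hl hs erefl.
case=> [s1 [_ _ _ h]|t [s1 [q1 q2 q3 [[q4 q5 q6 q7] q8]]]].
  by eexists; split=> //= k ->; rewrite h ?(ltn_eqF hb) 1?eq_sym// e2 mulSn addnC.
exists t, s1; rewrite e1 in q1 q8; split=> //; split=> /=; first by split=> //; apply: known_clear hk.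
by split; rewrite ?q4 ?q5 ?q6.
Qed.

Lemma pow2cP i a x : [&& i < 18, a < 18 & i != a] ->
  (forall s, known L s -> ireg s a = x /\ ireg s 19 = 1) ->
  triple (pow2c i a) (Kn L) (Kn ((i, 2 ^ x) :: clear i L)) (x * 4 + 3).
Proof.
move=> /and3P[hi ha h1] hL p off s hl hs [hk [m1 m2 m3]].
have [e1 e3] := hL s hk.
have := @countP i a (IAdd i i i) 1 (fun k => 2 ^ k) s hi ha h1 e3 isT _ (erefl _) p off s hl hs erefl.
case=> [s1 [_ _ _ h]|t [s1 [q1 q2 q3 [[q4 q5 q6 q7] q8]]]].
  by eexists; split=> //= k ->; rewrite expnS mul2n addnn.
exists t, s1; rewrite e1 in q1 q8; split=> //; split=> /=; first by split=> //; apply: known_clear hk.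
by split; rewrite ?q4 ?q5 ?q6.
Qed.

End Macros.
End Triples.

(** * The constants of an instance *)

Section Prelude.
Variable R : realType.
Notation st := (state R).
Variable d : nat.

Definition sq (c1 c2 : nat -> program) off := c1 off ++ c2 (off + size (c1 off)).

(** The summand [4 d + 10] makes [3 * 2^(3 d) * D < 2^z]. For [e' = e + 6 + 3 d] and portals at
    relative distance [2^-e'], one has [64 * 2^(3 d) * D / 2^e' = D / 2^e <= eps]. The exponent
    [16 X] of [B] exceeds the number of bits of a signature. The heap starts above the input. *)
Definition constants : nat -> program :=
  sq (fun=> [:: IConst 19 1; IAdd 12 0 19; IConst 10 1; IConst 11 0])
 (sq (whilec (JumpILe 12 10) [:: IAdd 10 10 10; IAdd 11 11 19])
 (sq (fun=> [:: IConst 13 (4 * d + 10); IAdd 4 11 13; IAdd 14 4 4; IAdd 14 14 4; IAdd 7 14 19;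
               RConst 1 0; RAdd 1 1 0; ROfInt 2 7; IConst 11 0])
 (sq (whilec (JumpRLe 2 1) [:: RAdd 1 1 1; IAdd 11 11 19])
 (sq (fun=> [:: IConst 13 (6 + 3 * d); IAdd 11 11 13; IConst 13 d])
 (sq (pow2c 6 14)
 (sq (mulc 15 13 11)
 (sq (pow2c 5 15)
 (sq (fun=> [:: IAdd 5 5 5; IAdd 10 1 19])
 (sq (mulc 12 10 4)
 (sq (mulc 10 12 5)
 (sq (fun=> [:: IAdd 10 10 10; IAdd 10 10 10; IAdd 10 10 10; IAdd 10 10 10])
 (sq (pow2c 3 10)
 (sq (mulc 12 0 0)
     (fun=> [:: IAdd 8 12 0; IAdd 8 8 0; IAdd 8 8 1; IAdd 8 8 1; IAdd 8 8 19])))))))))))))).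

Variables (n l k : nat) (im : nat -> nat) (rm : nat -> R) (eps : R).
(* [b] and [e] are found by doubling, as the machine has no logarithm and cannot round reals. *)
Variables (b e : nat).
Hypotheses (hb : n < 2 ^ b) (hbm : forall j, j < b -> 2 ^ j <= n).
Let z := b + (4 * d + 10).
Let D := z + z + z + 1.
Hypotheses (he : (D%:R <= 2 ^+ e * eps)%R) (hem : forall j, j < e -> (2 ^+ j * eps < D%:R)%R).
Let e' := e + (6 + 3 * d).
Let q := 2 ^ (d * e').
Let Q := q + q.
Let X := (l + 1) * z * Q.

Notation Kn L := (fun s => known L s /\ mems im rm eps s).

Ltac kn := 
  let s := fresh "s" in let H := fresh "H" in
  move=> s H; rewrite /clear /mems in H *; cbn -[expn muln addn GRing.natmul GRing.mul GRing.exp GRing.add] in H |- *;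
  repeat match goal with H : _ /\ _ |- _ => destruct H | H : and3 _ _ _ |- _ => destruct H end;
  repeat split; cbn -[expn muln addn GRing.natmul GRing.mul GRing.exp GRing.add];
  repeat match goal with H : ireg s ?j = _ |- context[ireg s ?j] => rewrite H
    | H : rreg s ?j = _ |- context[rreg s ?j] => rewrite H end; try done.

Definition prelude_time := 4 + (b * 4 + 1 + (9 + (e * 4 + 1 + (3 + ((z + z + z) * 4 + 3 +
  (d * 4 + 3 + (d * e' * 4 + 3 + (2 + ((l + 1) * 4 + 3 + ((l + 1) * z * 4 + 3 + (4 +
  (16 * X * 4 + 3 + (n * 4 + 3 + 5))))))))))))).

Lemma constantsP : triple constants (Kn [:: (0, n); (1, l); (2, k); (9, 0)])
  (Kn [:: (0, n); (1, l); (2, k); (3, 2 ^ (16 * X)); (4, z); (5, Q); (6, 2 ^ (z + z + z)); (7, D);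
          (8, n * n + n + n + l + l + 1); (9, 0)]) prelude_time.
Proof.
pose L0 : seq (nat * nat) := [:: (0, n); (1, l); (2, k); (9, 0)].
pose P1 j s := (Kn (L0 ++ [:: (19, 1); (12, n + 1); (10, 2 ^ j); (11, j)])) s.
pose L1 := L0 ++ [:: (19, 1); (4, z); (14, z + z + z); (7, D)].
pose P2 j s := [/\ (Kn (L1 ++ [:: (11, j)])) s, rreg s 1 = (2 ^+ j * eps)%R & rreg s 2 = D%:R%R].
pose L2 := L0 ++ [:: (4, z); (7, D); (19, 1)].
apply: (@triple_seq _ (fun=> _) _ _ (P1 0)).
  by apply: triple_straight => //; rewrite /P1 /L0; kn.
apply: (@triple_seq _ _ _ _ (P1 b)).
  have e1 j s : P1 j s -> ireg s 12 = n + 1 /\ ireg s 10 = 2 ^ j by rewrite /P1 /L0; move: s; kn.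
  apply: (@triple_while _ _ (fun s => ireg s 12 <= ireg s 10) [:: IAdd 10 10 10; IAdd 11 11 19] b P1) => //.
    move=> j s hj hP; split; first by have [-> ->] := e1 _ _ hP; rewrite addn1 -ltnNge ltnS hbm.
    by move: s hP; rewrite /P1 /L0; kn; [rewrite expnS mul2n addnn|rewrite addn1].
  by move=> s /e1[-> ->]; rewrite addn1.
apply: (@triple_seq _ (fun=> _) _ _ (P2 0)).
  apply: triple_straight => //; rewrite /P1 /P2 /L1 /L0; kn; by rewrite ?mulr0n ?add0r ?expr0 ?mul1r.
apply: (@triple_seq _ _ _ _ (P2 e)).
  apply: (@triple_while _ _ (fun s => (rreg s 2 <= rreg s 1)%R) [:: RAdd 1 1 1; IAdd 11 11 19] e P2) => //.
    move=> j s hj hP; split; first by have [_ -> ->] := hP; rewrite -ltNge hem.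
    by move: s hP; rewrite /P2 /L1 /L0; kn; [rewrite addn1|rewrite exprS; ring].
  by move=> s [_ -> ->].
apply: (@triple_seq _ (fun=> _) _ _ (Kn (L2 ++ [:: (14, z + z + z); (11, e'); (13, d)]))).
  by apply: triple_straight => //; rewrite /P2 /L2 /L1 /L0; kn.
apply: (@triple_seq _ _ _ _ (Kn (L2 ++ [:: (6, 2 ^ (z + z + z)); (11, e'); (13, d)]))).
  apply: triple_post; first apply: (@pow2cP R im rm eps _ _ _ (z + z + z)) => //; by rewrite /L2 /L0; kn.
apply: (@triple_seq _ _ _ _ (Kn (L2 ++ [:: (6, 2 ^ (z + z + z)); (15, d * e')]))).
  apply: triple_post; first apply: (@mulcP R im rm eps _ _ _ _ (d) (e')) => //; by rewrite /L2 /L0; kn.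
apply: (@triple_seq _ _ _ _ (Kn (L2 ++ [:: (6, 2 ^ (z + z + z)); (5, q)]))).
  apply: triple_post; first apply: (@pow2cP R im rm eps _ _ _ (d * e')) => //; by rewrite /L2 /L0; kn.
apply: (@triple_seq _ (fun=> _) _ _ (Kn (L2 ++ [:: (6, 2 ^ (z + z + z)); (5, Q); (10, l + 1)]))).
  by apply: triple_straight => //; rewrite /L2 /L0; kn.
apply: (@triple_seq _ _ _ _ (Kn (L2 ++ [:: (6, 2 ^ (z + z + z)); (5, Q); (12, (l + 1) * z)]))).
  apply: triple_post; first apply: (@mulcP R im rm eps _ _ _ _ (l + 1) (z)) => //; by rewrite /L2 /L0; kn.
apply: (@triple_seq _ _ _ _ (Kn (L2 ++ [:: (6, 2 ^ (z + z + z)); (5, Q); (10, X)]))).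
  apply: triple_post; first apply: (@mulcP R im rm eps _ _ _ _ ((l + 1) * z) (Q)) => //; by rewrite /L2 /L0; kn.
apply: (@triple_seq _ (fun=> _) _ _ (Kn (L2 ++ [:: (6, 2 ^ (z + z + z)); (5, Q); (10, 16 * X)]))).
  by apply: triple_straight => //; rewrite /L2 /L0; kn; lia.
apply: (@triple_seq _ _ _ _ (Kn (L2 ++ [:: (6, 2 ^ (z + z + z)); (5, Q); (3, 2 ^ (16 * X))]))).
  apply: triple_post; first apply: (@pow2cP R im rm eps _ _ _ (16 * X)) => //; by rewrite /L2 /L0; kn.
apply: (@triple_seq _ _ _ _ (Kn (L2 ++ [:: (6, 2 ^ (z + z + z)); (5, Q); (3, 2 ^ (16 * X)); (12, n * n)]))).
  apply: triple_post; first apply: (@mulcP R im rm eps _ _ _ _ (n) (n)) => //; by rewrite /L2 /L0; kn.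
by apply: triple_straight => //; rewrite /L2 /L0; kn.
Qed.
End Prelude.

(** * Writing the result *)

Section Output.
Variable R : realType.
Notation st := (state R).

(* The cells of the list may lie below the heap base as far as [rp] tells, so the list is first
   copied above the heap pointer, and only then to the addresses from 0. *)
Definition outc : nat -> program :=
  sq (fun=> [:: IConst 19 1; IAdd 11 8 9])
 (sq (whilec (JumpILe 10 9) [:: ILoad 12 10; IStore 11 12; IAdd 13 10 19; ILoad 10 13; IAdd 11 11 19])
 (sq (fun=> [:: IAdd 11 8 9; IConst 12 0; IAdd 13 0 0])
     (whilec (JumpILe 13 12) [:: ILoad 14 11; IStore 12 14; IAdd 11 11 19; IAdd 12 12 19]))).

Lemma outcP (g : ctx R) (r : seq nat) : okg g -> size r = cn g + cn g ->
  triple outc (fun s => inv g s /\ @rp R (seq nat) (rt_seq (rt_nat R)) g s (ireg s 10) r)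
    (fun s => forall i, i < cn g + cn g -> imem s i = nth 0 r i)
    (2 + ((cn g + cn g) * 7 + 1 + (3 + ((cn g + cn g) * 6 + 1)))).
Proof.
move=> hg hr; set N := cn g + cn g; have hN : N <= base g by case: hg => _ _ _ _ [].
pose F (s : st) := [/\ N <= ireg s 8, ireg s 0 = cn g, ireg s 9 = 0 & ireg s 19 = 1].
pose P1 j (s : st) := [/\ F s, @rp R (seq nat) (rt_seq (rt_nat R)) g s (ireg s 10) (drop j r), ireg s 11 = ireg s 8 + j
  & forall i, i < j -> imem s (ireg s 8 + i) = nth 0 r i].
pose P2 j (s : st) := [/\ F s, ireg s 11 = ireg s 8 + j, ireg s 12 = j /\ ireg s 13 = N,
  forall i, i < N -> imem s (ireg s 8 + i) = nth 0 r i & forall i, i < j -> imem s i = nth 0 r i].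
apply: (@triple_seq _ (fun=> _) _ _ (P1 0)).
  apply: triple_straight => // s [[h1 h2 h3 h4] h5]; split => //=.
  - by split=> //=; [apply: leq_trans hN h3|apply: (h1 0)].
  - by rewrite drop0; apply: rp_regs h5.
  - by rewrite h2.
apply: (@triple_seq _ _ _ _ (P1 N)).
  apply: (@triple_while _ _ (fun s => ireg s 10 <= ireg s 9) _ N P1) => //.
  - by move=> j s t [h1 h2 h3 h4]; split=> //; apply: rp_goto.
  - move=> j s hj [[f1 f2 f3 f4] [h1 h1'] h2 h3]; rewrite f3 leqn0.
    have hjr : j < size r by rewrite hr.
    move: h1'; rewrite (drop_nth 0 hjr) /= => -[k1 k2 k3 k4].
    split; first by rewrite -lt0n.
    split=> //=; last first.
    + move=> i; rewrite ltnS leq_eqVlt h2 => /orP[/eqP->|hi]; first by rewrite eqxx.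
      by rewrite eqn_add2l (ltn_eqF hi) h3.
    + by rewrite h2 f4 addn1 addnS.
    have E : @rp R (seq nat) (rt_seq (rt_nat R)) g s (imem s (ireg s 10).+1) (drop j.+1 r).
      by split=> //; apply: leq_trans h1; rewrite !size_drop; lia.
    rewrite f4 addn1 h2 ltn_eqF; last by apply: leq_trans k2 (leq_addr _ _).
    refine (@rp_ext R (seq nat) (rt_seq (rt_nat R)) g s _ _ (drop j.+1 r) _ E).
    by split=> //= a ha; split=> //; rewrite ltn_eqF// (leq_trans ha) ?leq_addr.
  - by move=> s [[f1 f2 f3 f4] [_ h1] _ _]; move: h1; rewrite drop_oversize ?hr//= => ->.
apply: (@triple_seq _ (fun=> _) _ _ (P2 0)).
  apply: triple_straight => // s [[f1 f2 f3 f4] _ _ h]; split=> //=; by rewrite ?f2 ?f3 ?addn0.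
apply: (triple_post (Q := P2 N)); last by move=> s [].
apply: (@triple_while _ _ (fun s => ireg s 13 <= ireg s 12) _ N P2) => //.
- move=> j s hj [[f1 f2 f3 f4] h1 [h2 h3] h4 h5]; rewrite h2 h3 -ltnNge; split=> //.
  split=> //=.
  + by rewrite f4 h1 addn1 addnS.
  + by rewrite h2 f4 addn1.
  (* The target address [j < N] is below the heap pointer, so the copy is not disturbed. *)
  + move=> i hi; rewrite h2 gtn_eqF ?h4//; apply: leq_trans (leq_trans f1 (leq_addr _ _)); exact: hj.
  + by move=> i; rewrite ltnS leq_eqVlt h2 => /orP[/eqP->|hi]; rewrite ?eqxx ?(ltn_eqF hi) ?h1 ?h4// h5.
- by move=> s [_ _ [-> ->]].
Qed.

End Output.

(** * The constants meet the requirements of the algorithm *)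

Section Context.
Variable R : realType.
Variables (d n l k : nat) (im : nat -> nat) (rm : nat -> R) (b e : nat).
Let z := b + (4 * d + 10).
Let q := 2 ^ (d * (e + (6 + 3 * d))).
Let X := (l + 1) * z * (q + q).

Definition input_ctx : ctx R := Ctx
  (nth 0 [:: n; l; k; 2 ^ (16 * X); z; q + q; 2 ^ (z + z + z); z + z + z + 1])
  (n * n + n + n + l + l + 1) im rm.
Notation g := input_ctx.

Hypothesis hb : n < 2 ^ b.

Let q_gt0 : 0 < q. Proof. by rewrite expn_gt0. Qed.
Let z_ge : 10 <= z. Proof. by rewrite /z; lia. Qed.
Let zX : z <= X.
Proof. by rewrite /X mulnAC leq_pmull// muln_gt0 addn1 /= addn_gt0 q_gt0. Qed.
Let lX : l + 1 <= X.
Proof.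
rewrite /X -mulnA leq_pmulr// muln_gt0 addn_gt0 q_gt0 andbT; exact: leq_trans z_ge.
Qed.
Let nz : n < 2 ^ z.
Proof. by apply: leq_trans hb _; rewrite leq_exp2l// leq_addr. Qed.

Let leB m x : m <= 2 ^ x -> x <= 16 * X -> m <= 2 ^ (16 * X).
Proof. by move=> h1 h2; apply: leq_trans h1 _; rewrite leq_exp2l. Qed.

Lemma input_okg : okg g.
Proof.
split; rewrite /cn /cl /cB /cM /cz /cD /=.
- by rewrite -{1}(expn0 2) ltn_exp2l//; lia.
- by lia.
- by apply: leq_trans nz _; rewrite leq_exp2l//; lia.
- by lia.
split.
- apply: (@leB _ (l + 2)); last by lia.
  by rewrite -muln2 addn2 expnSr leq_mul2r /=; apply/ltnW/ltn_expl.
- by apply: (@leB _ (z + z + z)) => //; lia.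
- by apply: (@leB _ (z * 3)); [exact: ltn_expl|lia].
- by rewrite addn1; apply: (@leB _ (z + z + z)); [exact: ltn_expl|lia].
- by lia.
Qed.

(** In bits: [n + 1 <= 2^z] and counts take [2 z] bits, for a total of [3 z + 1 + z Q + 4 X], which
    is below [16 X]. *)
Lemma input_sigs : sigs g < cB g.
Proof.
rewrite /sigs /nkeys /cn /cl /cQ /cB /=.
have h1 : n.+1 <= 2 ^ z by [].
have h2 : (n.+1 * n).+1 <= 2 ^ (z + z).
  apply: (@leq_trans (n.+1 * n.+1)); first by rewrite mulnS addnC -addn1 leq_add2l.
  by rewrite expnD leq_mul.
apply: (@leq_ltn_trans (2 ^ (z * 3 + 1 + z * (q + q) + (z + z) * ((q + q) * (l.+1 + l.+1))))).
  have hQ0 : 0 < q + q by rewrite addn_gt0 q_gt0.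
  move: hQ0; set Q := q + q => hQ0; set K := Q * _; have hK : 0 < K by rewrite muln_gt0 hQ0.
  rewrite expnD; apply: leq_mul; last by rewrite expnM leq_exp2r.
  rewrite expnD; apply: leq_mul; last by rewrite expnM leq_exp2r.
  by rewrite expnD; apply: leq_mul => //; rewrite expnM leq_exp2r.
rewrite ltn_exp2l// /X; set Q := q + q; have hQ : 2 <= Q by rewrite /Q; lia.
have h3 : z * Q <= (l + 1) * z * Q by rewrite -mulnA leq_pmull// addn1.
have h4 : z * 2 <= z * Q by rewrite leq_mul2l hQ orbT.
have -> : (z + z) * (Q * (l.+1 + l.+1)) = 4 * ((l + 1) * z * Q) by ring.
lia.
Qed.

Lemma input_rounds : rnds g * (cD g).+1 <= cB g.
Proof.
rewrite /rnds /cn /cD /cB /=.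
apply: (@leB _ (z + 2 + (z + 2) + (z * 3 + 1))); last by lia.
have h1 : n + 3 <= 2 ^ (z + 2) by rewrite expnD; lia.
rewrite expnD; apply: leq_mul; first by rewrite expnD leq_mul.
have h2 : z * 3 < 2 ^ (z * 3) by rewrite ltn_expl.
by rewrite expnD; lia.
Qed.

(** Write [z = y + 3 d] with [y = b + d + 10]. After division by [2^(3 d)] it remains to see
    [3 (3 z + 1) < 2^y], which follows from [z <= 4 y] and [36 y + 4 < 2^y] for [y >= 10]. *)
Lemma input_z : 3 * 2 ^ (d * 3) * cD g < 2 ^ cz g.
Proof.
rewrite /cD /cz /=.
have h y : 10 <= y -> 36 * y + 4 < 2 ^ y.
  elim: y => // y IH; rewrite leq_eqVlt => /orP[/eqP <- //|hy].
  have := IH hy; rewrite expnS; lia.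
have -> : z = b + d + 10 + d * 3 by rewrite /z; lia.
have h10 : 10 <= b + d + 10 by lia.
have := h _ h10; move: h10; set y := b + d + 10 => h10 hy; rewrite expnD.
rewrite [3 * _]mulnC -mulnA [X in _ < X]mulnC ltn_mul2l expn_gt0 /=.
apply: leq_trans hy; lia.
Qed.

Lemma input_n2 : n + n <= cB g.
Proof.
rewrite /cB /=; apply: (@leB _ (z + 1)); last by lia.
by rewrite expnD; lia.
Qed.

End Context.

Section Program.
Variable R : realType.
Variable d : nat.

(** The program and the exponent depend on [d] only: they are chosen before the instance, [eps] and
    even the numbers [b] and [e]. *)
Lemma program_exists : exists (p : program) (ee : nat),
  forall (n l k : nat) (eps : R) (b e : nat) (s : state R),
  n < 2 ^ b -> (forall j, j < b -> 2 ^ j <= n) ->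
  let D := (b + (4 * d + 10) + (b + (4 * d + 10)) + (b + (4 * d + 10)) + 1)%N in
  (D%:R <= 2 ^+ e * eps)%R -> (forall j, j < e -> (2 ^+ j * eps < D%:R)%R) ->
  pc s = 0 -> ireg s 0 = n -> ireg s 1 = l -> ireg s 2 = k -> ireg s 9 = 0 -> rreg s 0 = eps ->
  let g := input_ctx d n l k (imem s) (rmem s) b e in
  exists t s', [/\ t <= prelude_time d n l b e + (cB g ^ ee.+1 + (n + n) * 13 + 7),
    reach p t s s', halted p s' & forall i, i < n + n -> imem s' i = nth 0 (main g) i].
Proof.
have [ee [code hcode]] := cpt_main (rt_unit R).
exists (sq (constants d) (sq (code 0) outc) 0), ee.
move=> n l k eps b e s hb hbm D he hem p0 r0 r1 r2 r9 reps g.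
have hg : okg g by apply: input_okg.
have hmain : triple (code 0) (inv g) (fun s => inv g s /\ @rp R (seq nat) (rt_seq (rt_nat R)) g s (ireg s 10) (main g)) (cB g ^ ee.+1).
  move=> p off s1 hl hs1 hi.
  have [t [s' [h1 h2 h3 [h4 _ _] h5]]] := hcode 0 off p g s1 tt hg hl hs1 hi I I.
  by exists t, s'.
have hr : size (main g) = cn g + cn g.
  by rewrite /main /answer size_map iotE ?size_iota//; apply: input_n2.
have hconst := constantsP (im := imem s) (rm := rmem s) hb hbm he hem (l := l) (k := k).
have hT := triple_seq hconst (triple_pre (triple_seq hmain (outcP hg hr)) _).
set p := sq _ _ _.
have hl : located p 0 p by move=> i _; rewrite add0n.
have [||t [s' [h1 h2 h3 h4]]] := hT _ p 0 s hl p0 _; last first.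
- exists t, s'; split=> //; first by apply: leq_trans h1 _; rewrite /cn /=; lia.
  by rewrite /halted h3 add0n.
- by [].
move=> s1 [/= h [m1 m2 m3]].
do 10![case: h => ? h].
by split=> //=; [do 8?case=> //|lia|move=> a _; rewrite m1 m2].
Qed.
End Program.
(** * Instances *)

Lemma count_iota n (P : pred nat) : count P (iota 0 n) = #|[pred i : 'I_n | P i]|.
Proof. by rewrite -sum1_card -val_enum_ord -sum1_count big_map big_enum_cond. Qed.

(** The doubling property iterated [e] times: balls of radius [2 r] covering the large ball are each
    covered by [2^d] balls of radius [r]. *)
Lemma doubling_cover (R : realType) (X : finType) (dist : X -> X -> R) d :
  is_metric dist -> doubling dist d -> forall e u (r : R), (0 <= r)%R ->
  exists S : {set X}, #|S| <= 2 ^ (d * e) /\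
    forall x, (dist u x <= 2 ^+ e * r)%R -> exists2 y, y \in S & (dist y x <= r)%R.
Proof.
move=> [hge0 heq hsym htri] hd; elim=> [|e IH] u r hr.
  exists (finset.set1 u); rewrite cards1 expn_gt0; split=> // x; rewrite expr0 mul1r => h.
  by exists u; rewrite ?inE.
have h2r : (0 <= 2 * r)%R by apply: mulr_ge0.
have [S [hS1 hS2]] := IH u _ h2r.
have hc y : {S' : {set X} | #|S'| <= 2 ^ d /\ cball dist y (2 * r) \subset \bigcup_(z in S') cball dist z r}.
  by apply: cid; apply: hd.
exists (\bigcup_(y in S) sval (hc y)); split.
  apply: (@leq_trans (\sum_(y in S) #|sval (hc y)|)).
    elim/big_rec2: _ => [|y N A _ h]; first by rewrite cards0.
    by apply: leq_trans (leq_card_setU _ _).1 _; rewrite leq_add2l.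
  apply: (@leq_trans (\sum_(y in S) 2 ^ d)); first by apply: leq_sum => y _; case: (svalP (hc y)).
  by rewrite sum_nat_const mulnS addnC expnD leq_mul2r hS1 orbT.
move=> x hx.
have [|y hy1 hy2] := hS2 x; first by rewrite mulrA -exprSr.
have [h1 /fintype.subsetP/(_ x)] := svalP (hc y).
rewrite inE => /(_ hy2) /bigcupP[z hz1 hz2]; exists z; last by rewrite inE in hz2.
by apply/bigcupP; exists y.
Qed.

Section Reading.
Variable R : realType.
Variables (n l : nat) (I : instance R n l) (g : ctx R).
Hypotheses (hn : cn g = n) (hl : cl g = l) (hk : ck g = kmax I).
Hypothesis hcode : forall x : 'I_n, gcode g x = client_code I x.
Hypothesis hfac : forall x : 'I_n, gfac g x = (x \in facilities I) :> nat.
Hypothesis halpha : forall i : 'I_l, galpha g i = alpha I i.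
Hypothesis hbeta : forall i : 'I_l, gbeta g i = beta I i.
Hypothesis hgd : forall x y : 'I_n, gd g x y = dist I x y.

Lemma client_codeP x i : (client_code I x == i.+1) = [exists j : 'I_l, (j == i :> nat) && (x \in group I j)].
Proof.
rewrite /client_code; case: pickP => [j hj|h].
  apply/idP/existsP => [/eqP[e]|[j' /andP[/eqP <- hj']]]; first by exists j; rewrite e eqxx.
  case: (eqVneq j j') => [->//|hne].
  by have /finset.disjoint_setI0 := groups_disjoint I hne; move/setP/(_ x); rewrite !inE hj hj'.
by apply/esym/existsP => -[j /andP[_]]; rewrite h.
Qed.

Lemma client_codeE x (i : 'I_l) : (client_code I x == i.+1) = (x \in group I i).
Proof.
rewrite client_codeP; apply/existsP/idP => [[j /andP[/eqP/val_inj-> //]]|h].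
by exists i; rewrite eqxx.
Qed.

Lemma client_code0 x : (client_code I x != 0) = (x \in clients I).
Proof.
rewrite (groups_cover I) /client_code; case: pickP => [j hj|h].
  by apply/esym/bigcupP; exists j.
by apply/esym/negbTE/bigcupP => -[j _]; rewrite h.
Qed.

Lemma client_code_le x : client_code I x <= l.
Proof. by rewrite /client_code; case: pickP => // j _; apply: ltn_ord. Qed.

Lemma gcode_le c : gcode g c <= cl g.
Proof.
rewrite hl; case: (ltnP c n) => hc; first by rewrite (hcode (Ordinal hc)) client_code_le.
by rewrite /gcode hn ltnNge hc.
Qed.

Lemma gd_out x y : ~~ ((x < n) && (y < n)) -> gd g x y = 0%R.
Proof. by rewrite /gd hn => /negbTE ->. Qed.

Lemma gd_ge0 x y : (0 <= gd g x y)%R.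
Proof.
case: (boolP ((x < n) && (y < n))) => [/andP[hx hy]|/gd_out-> //].
by rewrite (hgd (Ordinal hx) (Ordinal hy)); case: (dist_metric I).
Qed.

Lemma gd_sym x y : gd g x y = gd g y x.
Proof.
case: (boolP ((x < n) && (y < n))) => [/andP[hx hy]|h]; last by rewrite !gd_out// andbC.
by rewrite (hgd (Ordinal hx) (Ordinal hy)) (hgd (Ordinal hy) (Ordinal hx)); case: (dist_metric I).
Qed.

Lemma gd_eq0 x y : x < cn g -> y < cn g -> gd g x y = 0%R -> x = y.
Proof.
rewrite hn => hx hy; rewrite (hgd (Ordinal hx) (Ordinal hy)).
by have [_ h _ _] := dist_metric I; move/h => /(congr1 val).
Qed.

Lemma gd_xx x : gd g x x = 0%R.
Proof.
case: (ltnP x n) => hx; last by rewrite gd_out// andbb -leqNgt.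
by rewrite (hgd (Ordinal hx) (Ordinal hx)); have [_ h _ _] := dist_metric I; apply/h.
Qed.

Lemma gd_tri x y z : x < cn g -> y < cn g -> z < cn g -> (gd g x z <= gd g x y + gd g y z)%R.
Proof.
rewrite hn => hx hy hz.
rewrite (hgd (Ordinal hx) (Ordinal hz)) (hgd (Ordinal hx) (Ordinal hy)) (hgd (Ordinal hy) (Ordinal hz)).
by case: (dist_metric I).
Qed.

Lemma gd_cover d : doubling (dist I) d -> forall e u (r : R), u < cn g -> (0 <= r)%R ->
  exists ga P, size P <= 2 ^ (d * e) /\ forall x, x < cn g -> (gd g u x <= 2 ^+ e * r)%R ->
    [/\ ga x \in P, ga x < cn g & (gd g x (ga x) <= r)%R].
Proof.
rewrite hn => hd e u r hu hr; have [S [hS1 hS2]] := doubling_cover (dist_metric I) hd e (Ordinal hu) hr.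
pose ga x := if [pick y : 'I_n | (y \in S) && (gd g x y <= r)%R] is Some y then val y else 0.
exists ga, (map val (enum S)); split; first by rewrite size_map -cardE.
move=> x hx; rewrite (hgd (Ordinal hu) (Ordinal hx)) => /hS2[y hy1 hy2].
rewrite /ga; case: pickP => [y' /andP[h1 h2]|/(_ y)].
  by split=> //; [apply: (@map_f _ _ val (enum S) y'); rewrite mem_enum|apply: ltn_ord].
by rewrite hy1 /= (hgd (Ordinal hx) y); have [_ _ -> _] := dist_metric I; rewrite hy2.
Qed.

Variables (mu : nat -> nat) (muf : {ffun 'I_n -> 'I_n}).
Hypothesis hmu : forall c, c \in clients I -> mu c = muf c.

Lemma mem_clsE (c : 'I_n) : (val c \in cls g) = (c \in clients I).
Proof. by rewrite mem_filter mem_iota hn /= ltn_ord andbT hcode client_code0. Qed.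

Lemma nclE (i : 'I_l) (f : 'I_n) : ncl g mu i f = #|group I i :&: cluster I muf f|.
Proof.
rewrite /ncl hn count_iota; apply: eq_card => c; rewrite !inE hcode client_codeE.
case: (boolP (c \in group I i)) => //= hc.
have hcl : c \in clients I by rewrite (groups_cover I); apply/bigcupP; exists i.
by rewrite hcl hmu.
Qed.

(** Double counting: the groups are disjoint and cover the clients, so each client of the cluster is
    counted once. *)
Lemma sum_nclE (f : 'I_n) : \sum_(j <- iota 0 l) ncl g mu j f = #|cluster I muf f|.
Proof.
rewrite -val_enum_ord big_map big_enum /= (eq_bigr (fun j => #|group I j :&: cluster I muf f|)); last by move=> j _; apply: nclE.
rewrite (eq_bigr (fun j => \sum_(c in cluster I muf f) (c \in group I j))); last first.
  by move=> j _; rewrite -sum1_card [RHS]big_mkcond [LHS]big_mkcond; apply: eq_bigr => c _; rewrite inE andbC; case: (c \in cluster _ _ _).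
rewrite exchange_big -sum1_card; apply: eq_bigr => c; rewrite inE => /andP[+ _].
rewrite (groups_cover I) => /bigcupP[j _ hj]; rewrite (bigD1 j)//= hj big1 => // j' hne.
have /finset.disjoint_setI0 := groups_disjoint I hne.
by move/setP/(_ c); rewrite !inE hj andbT => ->.
Qed.

Lemma isopenE (f : 'I_n) : isopen g mu f = (cluster I muf f != finset.set0).
Proof.
apply/hasP/set0Pn => [[c hc /eqP hf]|[c]].
  have hcn : c < n by move: hc; rewrite mem_filter mem_iota hn => /andP[].
  have hc' : Ordinal hcn \in clients I by rewrite -mem_clsE.
  by exists (Ordinal hcn); rewrite inE hc' /=; apply/eqP/val_inj; rewrite /= -hmu.
rewrite inE => /andP[h1 /eqP h2]; exists (val c); first by rewrite mem_clsE.
by rewrite /= hmu// h2.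
Qed.

Lemma costE : (\sum_(c <- cls g) gd g c (mu c) = cost I muf)%R.
Proof.
rewrite /cls big_filter hn -val_enum_ord big_map big_enum_cond /= /cost.
apply: eq_big => [c|c]; first by rewrite hcode client_code0.
by rewrite hcode client_code0 => h; rewrite hmu// hgd.
Qed.

Lemma fairE (f : 'I_n) (i : 'I_l) :
  ((ncl g mu i f)%:R / (\sum_(j <- iota 0 l) ncl g mu j f)%:R =
   #|group I i :&: cluster I muf f|%:R / #|cluster I muf f|%:R :> R)%R.
Proof. by rewrite nclE sum_nclE. Qed.

Lemma feasible_solution (F : {set 'I_n}) : feasible I F muf ->
  solution g (isopen g mu) mu (total g mu).
Proof.
move=> /and4P[/fintype.subsetP h1 h2 /forall_inP h3 /forall_inP h4].
have hop (f : 'I_n) : isopen g mu f -> f \in F.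
  by rewrite isopenE => /set0Pn[c]; rewrite inE => /andP[hc /eqP <-]; apply: h3.
have hcls c : c \in cls g -> exists2 c' : 'I_n, c' \in clients I & c = c'.
  move=> hc; have hcn : c < n by move: hc; rewrite mem_filter mem_iota hn => /andP[].
  by exists (Ordinal hcn); rewrite // -mem_clsE.
split=> //.
- rewrite hn => f hf hopf; rewrite (hfac (Ordinal hf)) h1//; exact: (hop (Ordinal hf)).
- rewrite hn hk count_iota; apply: leq_trans h2; apply: subset_leq_card.
  by apply/fintype.subsetP => f; rewrite inE; apply: hop.
- move=> c hc; split; last by apply/hasP; exists c.
  by have [c' hc' ->] := hcls c hc; rewrite hmu// hn.
rewrite hn hl => f hf hopf i hi; have hff := hop (Ordinal hf) hopf.
have := fairE (Ordinal hf) (Ordinal hi); rewrite /= => ->.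
have := h4 _ hff => /forallP/(_ (Ordinal hi)); rewrite -isopenE hopf /= => /andP[a b].
by rewrite (halpha (Ordinal hi)) (hbeta (Ordinal hi)).
Qed.

Lemma solution_feasible (P : nat -> bool) v : solution g P mu v ->
  feasible I (finset.finset (fun x : 'I_n => P x)) muf /\ (cost I muf <= v)%R.
Proof.
move=> [h1 h2 h3 h4]; rewrite costE; split=> //; apply/and4P; split.
- by apply/fintype.subsetP => f; rewrite inE => /h1; rewrite hn hfac => /(_ (ltn_ord f)); case: (_ \in _).
- by move: h2; rewrite hn hk count_iota; apply: leq_trans; rewrite cardsE.
- apply/forall_inP => c hc; rewrite inE -hmu//; by have [] := h3 _ (etrans (mem_clsE c) hc).
apply/forall_inP => f _; apply/forallP => i; apply/implyP; rewrite -isopenE => hopf.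
have := h4 f; rewrite hn hl => /(_ (ltn_ord f) hopf i (ltn_ord i)); rewrite /= fairE halpha hbeta.
by move=> [-> ->].
Qed.

End Reading.

Lemma opt_attained (R : realType) n l (I : instance R n l) : has_solution I ->
  exists F muf, feasible I F muf /\ (cost I muf <= opt I)%R.
Proof.
move=> [F0 [mu0 h0]].
pose fs (x : {set 'I_n} * {ffun 'I_n -> 'I_n}) := feasible I x.1 x.2.
case: (@Order.TotalTheory.arg_minP _ _ _ (F0, mu0) fs (fun x => cost I x.2) h0) => -[F muf] h1 h2.
exists F, muf; split=> //; apply: lb_le_inf; first by exists (cost I mu0), F0, mu0.
by move=> v [F1 [mu1 [h3 ->]]]; apply: (h2 (F1, mu1)).
Qed.

(** In dimension 0 every ball is covered by a single ball of a quarter of its radius. This is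
    impossible for two points, taking their distance as the radius. *)
Lemma doubling0 (R : realType) n (dist : 'I_n -> 'I_n -> R) : is_metric dist -> doubling dist 0 -> n <= 1.
Proof.
move=> hm hd; rewrite leqNgt; apply/negP => hn.
pose x := Ordinal (ltnW hn); pose y := Ordinal hn; have [hge0 heq hsym htri] := hm.
have hp : (0 < dist x y)%R by rewrite lt_neqAle hge0 andbT eq_sym; apply/eqP => /heq/(congr1 val).
have [|S [hS1 hS2]] := @doubling_cover _ _ _ _ hm hd 2 x (dist x y / 4%:R)%R; first by apply: divr_ge0.
have hxx : dist x x = 0%R by apply/heq.
have [|u hu1 hu2] := hS2 x; first by rewrite hxx; apply: mulr_ge0 => //; lra.
have [|w hw1 hw2] := hS2 y; first by rewrite -[(2 ^+ 2)%R]natrX; lra.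
have e : u = w by have /card_le1_eqP := hS1; apply.
by move: hu2; rewrite e hsym => hu2; have := htri x w y; lra.
Qed.
Lemma nth_allpairs_row T S U (x0 : U) (f : T -> S -> U) s (t : seq S) a0 b0 i j :
  i < size s -> j < size t ->
  nth x0 [seq f a b | a <- s, b <- t] (i * size t + j) = f (nth a0 s i) (nth b0 t j).
Proof.
elim: s i => // a s IH [|i] hi hj; rewrite /= nth_cat size_map.
  by rewrite hj (nth_map b0).
by rewrite mulSn -addnA ltnNge leq_addr /= addKn IH.
Qed.

Section InputContext.
Variable R : realType.
Variables (n l : nat) (I : instance R n l) (eps : R) (d b e : nat).
Notation s := (input I eps).
Notation g := (input_ctx d n l (kmax I) (imem s) (rmem s) b e).

Lemma input_code (x : 'I_n) : gcode g x = client_code I x.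
Proof.
rewrite /gcode /cn /= ltn_ord nth_cat size_map size_enum_ord ltn_ord.
by rewrite (nth_map x) ?size_enum_ord// nth_ord_enum.
Qed.

Lemma input_fac (x : 'I_n) : gfac g x = (x \in facilities I) :> nat.
Proof.
rewrite /gfac /cn /= ltn_ord nth_cat size_map size_enum_ord ltnNge leq_addr /= addKn.
by rewrite (nth_map x) ?size_enum_ord// nth_ord_enum.
Qed.

Lemma input_alpha (i : 'I_l) : galpha g i = alpha I i.
Proof.
rewrite /galpha /cl /= ltn_ord nth_cat size_map size_enum_ord ltn_ord.
by rewrite (nth_map i) ?size_enum_ord// nth_ord_enum.
Qed.

Lemma input_beta (i : 'I_l) : gbeta g i = beta I i.
Proof.
rewrite /gbeta /cl /= ltn_ord nth_cat size_map size_enum_ord ltnNge leq_addr /= addKn.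
by rewrite nth_cat size_map size_enum_ord ltn_ord (nth_map i) ?size_enum_ord// nth_ord_enum.
Qed.

Lemma input_d (x y : 'I_n) : gd g x y = dist I x y.
Proof.
rewrite /gd /cn /cl /= !ltn_ord /= nth_cat size_map size_enum_ord -addnA ltnNge leq_addr /= addKn.
rewrite nth_cat size_map size_enum_ord ltnNge leq_addr /= addKn.
have := @nth_allpairs_row _ _ _ 0%R (dist I) (enum 'I_n) (enum 'I_n) x y x y.
by rewrite !size_enum_ord !nth_ord_enum; apply.
Qed.

Hypotheses (hb : n < 2 ^ b).
Hypothesis he : (((b + (4 * d + 10) + (b + (4 * d + 10)) + (b + (4 * d + 10)) + 1)%N)%:R <= 2 ^+ e * eps)%R.
Hypothesis heps0 : (0 < eps)%R.

Lemma main_solves (s' : state R) : doubling (dist I) d -> has_solution I ->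
  (forall i, i < n + n -> imem s' i = nth 0 (main g) i) ->
  solved_within I ((1 + eps) * opt I)%R s'.
Proof.
move=> hd hI hs'; have [F [muf [hF hopt]]] := opt_attained hI.
(* Without points every state encodes the empty solution, of cost 0, whereas the approximation
   argument starts from a point. *)
case: (posnP n) => hn0.
  apply/existsP; exists F; apply/existsP; exists muf; apply/and3P; split=> //.
    by apply/andP; split; apply/forallP => -[i hi]; exfalso; rewrite hn0 in hi.
  rewrite /cost big1; last by move=> -[i hi]; exfalso; rewrite hn0 in hi.
  apply: mulr_ge0; first by rewrite addr_ge0 ?ler01 ?ltW.
  by apply: le_trans hopt; apply: sumr_ge0 => c _; case: (dist_metric I).
have hg : okg g by apply: input_okg.
pose mu c := if insub c is Some c' then val (muf c') else 0.
have hmu c : c \in clients I -> mu c = muf c by move=> _; rewrite /mu valK.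
have hN : cn g = n by [].
have heps : ((64 * 2 ^ (d * 3) * cD g)%:R * delta R (e + (6 + 3 * d)) <= eps)%R.
  rewrite /delta ler_pdivrMr ?exprn_gt0// mulrC.
  have -> : (2 ^+ (e + (6 + 3 * d)) = 2 ^+ e * (64 * 2 ^ (d * 3))%:R :> R)%R.
    by rewrite exprD natrM natrX [3 * d]mulnC exprD; congr (_ * (_ * _))%R; rewrite -natrX.
  by rewrite natrM mulrAC [leRHS]mulrC; apply: ler_wpM2l => //; rewrite mulrC.
have e3 x : x + x + x = x * 3 by lia.
have eM : cM g = 2 ^ (cz g * 3) by rewrite /cM /cz /= e3.
have eD : cD g = (cz g * 3).+1 by rewrite /cD /cz /= e3 addn1.
have hzn : n < 2 ^ cz g by apply: leq_trans hb _; rewrite leq_exp2l// leq_addr.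
have hzz := @input_z R d n l (kmax I) (imem s) (rmem s) b e hb.
have hsg := @input_sigs R d n l (kmax I) (imem s) (rmem s) b e hb.
have hrd := @input_rounds R d n l (kmax I) (imem s) (rmem s) b e hb.
have [v hv hsol] := @best_solution R g hg (gd_ge0 hN input_d) (gd_sym hN input_d) (gd_xx hN input_d)
  (gd_eq0 hN input_d) (gd_tri hN input_d) (gcode_le hN erefl input_code) d
  (gd_cover hN input_d hd) (e + (6 + 3 * d)) eM eD erefl hzn hzz hsg hrd hn0 eps heps mu
  (feasible_solution hN erefl erefl input_code input_fac input_alpha input_beta hmu hF).
have hN2 : cn g + cn g <= cB g by apply: input_n2.
pose mu' c := outmu g (best g).2 c.
(* The default of [insubd] is taken only outside of the clients, because [mu'] maps clients below
   [n]. *)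
pose muf' := [ffun c : 'I_n => insubd c (mu' c)].
have hmu' c : c \in clients I -> mu' c = muf' c.
  move=> hc; have [_ _ h3 _ _] := hsol; have [|h4 _] := h3 c; first by rewrite (mem_clsE hN input_code).
  by rewrite ffunE val_insubd h4.
have [h1 h2] := solution_feasible hN erefl erefl input_code input_fac input_alpha input_beta input_d hmu' hsol.
apply/existsP; eexists; apply/existsP; exists muf'; apply/and3P; split; first last.
- apply: le_trans h2 _; apply: le_trans hv _; apply: ler_wpM2l; first by rewrite addr_ge0 ?ler01 ?ltW.
  by rewrite /total (costE hN input_code input_d hmu).
- exact: h1.
apply/andP; split.
  apply/forallP => x; rewrite inE hs'; last by rewrite ltn_addr.
  by rewrite /main main_fac.
apply/forall_inP => c hc; rewrite hs' ?ltn_add2l//.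
by rewrite /main main_mu// -/(mu' c) hmu'.
Qed.
End InputContext.
(** * Running time *)

Lemma context_z_le d l b e :
  b + (4 * d + 10) <= (l + 1) * (b + (4 * d + 10)) * (2 ^ (d * (e + (6 + 3 * d))) + 2 ^ (d * (e + (6 + 3 * d)))).
Proof. by rewrite mulnAC leq_pmull// muln_gt0 addn1 addn_gt0 expn_gt0. Qed.

Lemma prelude_time_le d n l b e B (z := b + (4 * d + 10)) (q := 2 ^ (d * (e + (6 + 3 * d))))
  (X := (l + 1) * z * (q + q)) : 0 < d -> 16 * X <= B -> n <= B -> prelude_time d n l b e <= 94 * B.
Proof.
move=> hd hX hn; have hde : d * (e + (6 + 3 * d)) < q by apply: ltn_expl.
have hq : 0 < q by apply: leq_ltn_trans hde.
have hz0 : 10 <= z by rewrite /z addnA leq_addl.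
have hzX : (l + 1) * z <= X by rewrite /X leq_pmulr// addn_gt0 hq.
have hz : z <= X by apply: leq_trans hzX; rewrite leq_pmull// addn1.
have hl1 : l + 1 <= X by apply: leq_trans hzX; rewrite leq_pmulr//; apply: leq_trans hz0.
have hqX : q <= X.
  apply: leq_trans (leq_addr q q) _; rewrite /X leq_pmull// muln_gt0 addn1; exact: leq_trans hz0.
have hdX : d * (e + (6 + 3 * d)) <= X by apply: leq_trans (ltnW hde) hqX.
have he : e <= X by apply: leq_trans hdX; apply: leq_trans (leq_addr _ _) (leq_pmull _ hd).
have hbz : b <= z by apply: leq_addr.
have hdz : d <= z by rewrite /z; lia.
rewrite /prelude_time -/z -/q -/X.
clear hqX hde; move: q hq X hX hzX hz hl1 hdX he => q' hq X hX hzX hz hl1 hdX he.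
move: (d * (_ + _)) ((l + 1) * z) hdX hzX => T2 T3 hdX hzX.
by move: z hz0 hbz hdz hz => z' hz0 hbz hdz hz; lia.
Qed.

Section Time.
Variable R : realType.
Variables (d ee : nat).
(** The number of levels is at most [log_factor * ln n], and [2^e'] at most [portal_factor * y] with
    [y] the base of the exponent in the bound. The [threshold] gathers all constant factors of the
    logarithm of [B^ee]. *)
Definition log_factor := 8 * (4 * d + 12).
Definition portal_factor := 2 * log_factor * 2 ^ (6 + 3 * d).
Definition threshold := 64 * ee * (4 * d + 12) * portal_factor ^ d + 1.

Lemma ln2_ge : (2^-1 <= ln 2%:R :> R)%R.
Proof.
have h : (ln (1 + - 2^-1) <= - 2^-1 :> R)%R by apply: le_ln1Dx; lra.
have e : (1 + - 2^-1 = 2%:R^-1 :> R)%R by lra.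
by move: h; rewrite e lnV ?posrE// lerN2.
Qed.

Variables (n l k b e : nat) (im : nat -> nat) (rm : nat -> R) (eps y : R).
Hypotheses (hn : 1 < n) (hl : 0 < l) (hd : 0 < d) (hb : n < 2 ^ b) (hbm : forall j, j < b -> 2 ^ j <= n).
Let z := b + (4 * d + 10).
Hypothesis hem : forall j, j < e -> (2 ^+ j * eps < (z + z + z + 1)%:R)%R.
Hypotheses (heps : (0 < eps)%R) (hy : (ln n%:R / eps <= y)%R) (hK : (threshold%:R <= y)%R).
Notation g := (input_ctx d n l k im rm b e).
Let q := 2 ^ (d * (e + (6 + 3 * d))).
Let X := (l + 1) * z * (q + q).

Let u : R := ln n%:R.
Let w : R := ln 2%:R.
Let w_ge : (2^-1 <= w)%R. Proof. exact: ln2_ge. Qed.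
Let w_u : (w <= u)%R.
Proof. by rewrite ler_ln ?posrE ?ltr0n ?ler_nat// ltnW. Qed.
Let y1 : (1 <= y)%R.
Proof. by apply: le_trans hK; rewrite -[1%R]/(1%:R)%R ler_nat /threshold addn1. Qed.
Let b_gt0 : 0 < b.
Proof. by case: (b) hb => //; rewrite ltnS leqn0; case: (n) hn. Qed.

(** Minimality of [b] gives [2^(b - 1) <= n]; the remaining [4 d + 11] multiples of [ln 2] are
    compared with [ln n] one by one. *)
Let z_w : (z%:R * w <= (4 * d + 12)%:R * u)%R.
Proof.
have h1 : (b.-1%:R * w <= u)%R.
  have : (ln (2%:R ^+ b.-1) <= u :> R)%R.
    rewrite ler_ln ?posrE ?exprn_gt0 ?ltr0n//; last exact: ltnW.
    by rewrite -natrX ler_nat hbm// prednK.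
  by rewrite lnXn// mulr_natl.
have -> : z = b.-1 + (4 * d + 11) by rewrite /z; move: b_gt0; lia.
have -> : 4 * d + 12 = (4 * d + 11).+1 by lia.
set m := 4 * d + 11; have h2 : (m%:R * w <= m%:R * u)%R by apply: ler_wpM2l.
rewrite natrD -(@natr1 R m) !mulrDl mul1r; lra.
Qed.

Let D_u : ((z + z + z + 1)%:R <= log_factor%:R * u)%R.
Proof.
have h : ((z + z + z + 1)%:R <= 4%:R * z%:R :> R)%R by rewrite -natrM ler_nat /z; lia.
have h2 : (z%:R <= 2 * (z%:R * w))%R by have := ler0n R z; have := w_ge; nra.
have := z_w; move: h h2; rewrite /log_factor natrM; move: (z%:R)%R ((z + z + z + 1)%:R)%R ((4 * d + 12)%:R)%R => a1 a2 a3; lra.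
Qed.

Let log_factor_ge1 : (1 <= log_factor%:R :> R)%R.
Proof. by rewrite -[1%R]/(1%:R)%R ler_nat /log_factor; lia. Qed.

(** Minimality of [e] gives [2^(e - 1) < D / eps], and [D] is [O(ln n)]. *)
Let e_y : (2 ^+ e <= (2 * log_factor)%:R * y)%R.
Proof.
rewrite natrM; case: e hem => [_|e1 /(_ e1 (ltnSn _)) h]; first by rewrite expr0 -mulrA; have := mulr_ege1 log_factor_ge1 y1; move: (log_factor%:R * y)%R => v; lra.
have h1 : (2 ^+ e1 < log_factor%:R * u / eps)%R by rewrite ltr_pdivlMr//; apply: lt_le_trans D_u.
have h2 : (log_factor%:R * u / eps <= log_factor%:R * y)%R by rewrite -mulrA; apply: ler_wpM2l.
rewrite exprS; lra.
Qed.

Let q_y : (q%:R <= portal_factor%:R ^+ d * y ^+ d)%R.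
Proof.
rewrite -exprMn /q mulnC expnM natrX; apply: lerXn2r; rewrite ?nnegrE//.
  by apply: mulr_ge0 => //; apply: le_trans y1.
rewrite expnD natrM /portal_factor natrM mulrAC; apply: ler_wpM2r => //.
by rewrite natrX.
Qed.

(** The logarithm [16 X ee ln 2] is at most [K y^d l ln n] for a constant [K]. As [K <= y <= y^d],
    the constant is absorbed in [y^(2 d)]. *)
Lemma power_bound : ((cB g ^ ee)%:R <= expR (y ^+ (2 * d) * l%:R * u))%R.
Proof.
rewrite /cB /= -/z -/q -/X -expnM natrX.
rewrite -[X in (X ^+ _)%R](lnK (x := 2%:R)) ?posrE// -/w -expRM_natl ler_expR.
have yd : (y <= y ^+ d)%R by rewrite -[leLHS]expr1 ler_weXn2l.
have yd0 : (0 <= y ^+ d)%R by apply: exprn_ge0; apply: le_trans y1.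
have u0 : (0 <= u)%R by have := w_ge; have := w_u; lra.
pose K : R := (64 * ee * (4 * d + 12) * portal_factor ^ d)%:R%R.
have hKy : (K <= y ^+ d)%R.
  apply: le_trans yd; apply: le_trans hK; by rewrite ler_nat /threshold leq_addr.
apply: (@le_trans _ _ (K * (y ^+ d * l%:R * u))%R); last first.
  rewrite mul2n -addnn exprD; set Y := (y ^+ d)%R in hKy yd0 *.
  have : (0 <= Y * l%:R * u)%R by apply: mulr_ge0 => //; apply: mulr_ge0.
  have -> : (Y * Y * l%:R * u = Y * (Y * l%:R * u))%R by ring.
  by move=> h; apply: ler_wpM2r.
have -> : 16 * X * ee = 16 * ee * (l + 1) * 2 * q * z by rewrite /X; ring.
rewrite natrM -mulrA mulrC.
have hN : 16 * ee * (l + 1) * 2 * q <= 64 * ee * l * q.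
  have -> : 16 * ee * (l + 1) * 2 * q = 32 * ee * q * (l + 1) by ring.
  have -> : 64 * ee * l * q = 32 * ee * q * (l + l) by ring.
  by rewrite leq_mul2l leq_add2l hl orbT.
have hzw0 : (0 <= z%:R * w)%R by apply: mulr_ge0 => //; have := w_ge; lra.
apply: (@le_trans _ _ ((4 * d + 12)%:R * u * (64 * ee * l * q)%:R)%R).
  by apply: ler_pM => //; rewrite ler_nat.
rewrite natrM /K !natrM.
have -> : (64%:R * ee%:R * (4 * d + 12)%:R * (portal_factor ^ d)%:R * (y ^+ d * l%:R * u) =
  (4 * d + 12)%:R * u * (64%:R * ee%:R * l%:R * ((portal_factor ^ d)%:R * y ^+ d)))%R by ring.
apply: ler_wpM2l; first by apply: mulr_ge0.
by rewrite natrX; apply: ler_wpM2l => //; apply: mulr_ge0 => //; apply: mulr_ge0.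
Qed.

(** The constant is [94 + 1 + 26 + 7]: the prelude, the algorithm, the output and the overhead, each
    compared with [B^(E + 1)]. *)
Lemma time_le E : prelude_time d n l b e + (cB g ^ E.+1 + (n + n) * 13 + 7) <= 128 * cB g ^ E.+1.
Proof.
have hE : cB g <= cB g ^ E.+1 by rewrite -[X in X <= _]expn1 leq_pexp2l// expn_gt0.
have hX : 16 * X <= cB g by apply/ltnW/ltn_expl.
have hnB : n <= cB g.
  apply: leq_trans (ltnW hb) _; rewrite /cB /= leq_exp2l//.
  by apply: leq_trans (leq_addr _ _) (leq_trans (context_z_le d l b e) _); rewrite leq_pmull.
apply: leq_trans (leq_add (prelude_time_le hd hX hnB) (leqnn _)) _.
have hB : 0 < cB g by rewrite expn_gt0.
by move: (cB g ^ E.+1) (cB g) hE hnB hB; clear; move=> T B *; lia.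
Qed.

Lemma time_bound E : ee = E.+1 ->
  ((prelude_time d n l b e + (cB g ^ E.+1 + (n + n) * 13 + 7))%N%:R <=
    128%:R * expR (y ^+ (2 * d) * l%:R * u))%R.
Proof.
move=> eE; apply: (@le_trans _ _ (128 * cB g ^ E.+1)%N%:R); first by rewrite ler_nat time_le.
by rewrite natrM -eE; apply: ler_wpM2l => //; apply: power_bound.
Qed.
End Time.
Local Close Scope nat_scope.

Lemma exists_doubling (R : realType) (eps x : R) : 0 < eps -> exists e : nat,
  x <= 2 ^+ e * eps /\ forall j, (j < e)%N -> 2 ^+ j * eps < x.
Proof.
move=> he; have hex : exists e, x <= 2 ^+ e * eps.
  have [e h] : exists e : nat, x / eps < e%:R.
    by exists (Num.bound `|x / eps|); apply: le_lt_trans (ler_norm _) (archi_boundP (normr_ge0 _)).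
  exists e; rewrite -ler_pdivrMr//; apply: ltW; apply: lt_le_trans h _.
  by rewrite -natrX ler_nat ltnW// ltn_expl.
case: (ex_minnP hex) => e h1 h2; exists e; split=> // j hj.
by rewrite ltNge; apply/negP => /h2; rewrite leqNgt hj.
Qed.

Lemma prob1 (R : realType) T (E : pred (T.-tuple bool)) : (forall w, E w) -> prob R E = 1.
Proof.
move=> h; rewrite /prob (eq_card (B := predT)); last by move=> w; rewrite !inE; apply: h.
by rewrite card_tuple card_bool natrX divff// expf_neq0// pnatr_eq0.
Qed.

Theorem theorem1 (R : realType) :
  exists C : nat, forall d : nat,
  exists (p : program) (a b : nat) (x0 : R),
  forall (n l : nat) (I : instance R n l) (eps : R),
    doubling_dimension (dist I) d -> 0 < eps ->
    exists T : nat,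
      [/\ (1 < n)%N -> (0 < l)%N -> soft_O a b T (qpoly_bound C d x0 n l eps),
          forall w : T.-tuple bool, halted p (run p (input I eps) w),
          has_solution I ->
            forall w : T.-tuple bool, solved I (run p (input I eps) w)
        & has_solution I ->
            2 / 3 <= prob R (fun w : T.-tuple bool =>
              solved_within I ((1 + eps) * opt I) (run p (input I eps) w))].
Proof.
exists 2%N => d; have [p [ee hp]] := program_exists R d.
(* The logarithmic power in the soft O is 0, because polynomial factors are already part of the
   power of [B]. *)
exists p, 128%N, 0%N, (threshold d ee.+1)%:R => n l I eps [hd _] heps.
have [e [he hem]] := @exists_doubling R eps
  (up_log 2 n.+1 + (4 * d + 10) + (up_log 2 n.+1 + (4 * d + 10)) + (up_log 2 n.+1 + (4 * d + 10)) + 1)%N%:R heps.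
set b := up_log 2 n.+1 in he hem.
have hb : (n < 2 ^ b)%N by apply: up_logP.
have hbm j : (j < b)%N -> (2 ^ j <= n)%N.
  by move=> hj; rewrite leqNgt; apply/negP => /(up_log_min (isT : 1 < 2)%N); rewrite leqNgt hj.
have [t [s' [h1 h2 h3 h4]]] := hp n l (kmax I) eps b e (input I eps) hb hbm he hem erefl erefl erefl erefl erefl erefl.
(* The final state is the same for all coins, so the probability of success is 1. *)
have hrun (w : t.-tuple bool) : run p (input I eps) w = s' by apply: h2; rewrite size_tuple.
have hsol : has_solution I -> solved_within I ((1 + eps) * opt I) s'.
  by move=> hI; apply: (main_solves (d := d) (b := b) (e := e)).
exists t; split.
- move=> hn hl; have hn0 : n%:R != 0 :> R by rewrite pnatr_eq0 -lt0n ltnW.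
  rewrite /soft_O expr0 mulr1 /qpoly_bound /powR (negbTE hn0).
  (* Absorbing constants in [y^d] requires a positive exponent; dimension 0 is excluded by
     [n > 1]. *)
  have hd0 : (0 < d)%N.
    rewrite lt0n; apply/eqP => d0; rewrite d0 in hd.
    by have := doubling0 (dist_metric I) hd; rewrite leqNgt hn.
  have hy1 : ln n%:R / eps <= Num.max (ln n%:R / eps) (threshold d ee.+1)%:R by rewrite le_max lexx.
  have hy2 : (threshold d ee.+1)%:R <= Num.max (ln n%:R / eps) (threshold d ee.+1)%:R by rewrite le_max lexx orbT.
  have hT := time_bound (kmax I) (imem (input I eps)) (rmem (input I eps)) hn hl hd0 hb hbm hem heps hy1 hy2 erefl.
  by apply: le_trans hT; rewrite ler_nat.
- by move=> w; rewrite hrun.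
- move=> hI w; rewrite hrun; have /existsP[F /existsP[mu /and3P[a1 a2 _]]] := hsol hI.
  by apply/existsP; exists F; apply/existsP; exists mu; rewrite a1 a2.
move=> hI; rewrite prob1; last by move=> w; rewrite hrun; apply: hsol.
by rewrite ler_pdivrMr ?mul1r ?ler_nat// ltr0n.
Qed.
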